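(* For every $L\ge 2$ there exist positive constants $c(L)$ and $C(L)$, depending only on $L$, such that the following holds. Suppose $W$ is a doubling $2\pi$-periodic weight function with doubling constant $L$. For a positive integer $n$ let $$R^{\mathrm{trig}}_W(n):=\frac{\int_{-\pi}^{\pi} W(\theta)\,d\theta}{\inf_{x\in\mathbb{R}}\int_{x-\frac{1}{n}}^{x+\frac{1}{n}}W(\theta)\,d\theta}.$$ Then $$c(L)\,R^{\mathrm{trig}}_W(n)\leq N^{\mathrm{trig}}_W(n)\leq\overline{N}^{\mathrm{trig}}_W(n)\leq C(L)\,R^{\mathrm{trig}}_W(n)\quad\text{for every integer } n\ge 1.$$
   Context: A $2\pi$-periodic weight function is a non-negative, $2\pi$-periodic measurable function $W$ on $\mathbb{R}$ with $0<\int_{-\pi}^{\pi} W(\theta)\,d\theta<\infty$. It is doubling with doubling constant $L>0$ (necessarily $L\ge 2$) if for every $\delta>0$ and every real $a$, $$\int_{a-2\delta}^{a+2\delta}W(\theta)\,d\theta\leq L\int_{a-\delta}^{a+\delta}W(\theta)\,d\theta.$$ A trigonometric quadrature of degree $n$ for $W$ is a sequence of real nodes $\theta_1\le\theta_2\le\ldots\le\theta_N$ (repetitions allowed) and weights $w_1,\ldots,w_N$ such that $\int_{-\pi}^{\pi}p(\theta)W(\theta)\,d\theta=\sum_{i=1}^N w_i\,p(\theta_i)$ for every trigonometric polynomial $p$ of degree at most $n$ (i.e. every element of the linear span of $1,\sin\theta,\cos\theta,\ldots,\sin n\theta,\cos n\theta$). It is a Chebyshev-type trigonometric quadrature if $w_1=w_2=\cdots=w_N$.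 $N^{\mathrm{trig}}_W(n)$ denotes the minimal number of nodes in a Chebyshev-type trigonometric quadrature of degree $n$ for $W$. $\overline{N}^{\mathrm{trig}}_W(n)$ denotes the minimal number such that for every integer $N\ge\overline{N}^{\mathrm{trig}}_W(n)$ there is a Chebyshev-type trigonometric quadrature of degree $n$ for $W$ with exactly $N$ nodes. *)

(* Defs.v *)
From HB Require Import structures.
From mathcomp Require Import all_boot all_order all_algebra.
From mathcomp Require Import all_classical all_reals all_analysis.

Set Implicit Arguments.
Unset Strict Implicit.
Unset Printing Implicit Defensive.

Import Order.TTheory GRing.Theory Num.Theory.
Import numFieldNormedType.Exports.

Local Open Scope classical_set_scope.
Local Open Scope ring_scope.

(* The real line with the sigma-algebra of all Lebesgue measurable sets (the
   domain of completed_lebesgue_measure); the canonical sigma-algebra on R only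
   contains the Borel sets. *)
Notation lebesgueTypeR R := (caratheodory_type ((wlength (@idfun R))^*)%mu).

Definition interval_integral (R : realType) (a b : R) (f : R -> R) : \bar R :=
  (\int[@completed_lebesgue_measure R]_(t in `[a, b]%classic) (f t)%:E)%E.

Definition periodic_weight (R : realType) (W : R -> R) : Prop :=
  [/\ forall t, 0 <= W t,
      forall t, W (t + 2 * pi) = W t,
      measurable_fun [set: lebesgueTypeR R] (W : lebesgueTypeR R -> R) &
      (0 < interval_integral (- pi) pi W < +oo)%E].

Definition doubling (R : realType) (L : R) (W : R -> R) : Prop :=
  forall delta a : R, 0 < delta ->
    (interval_integral (a - 2 * delta) (a + 2 * delta) W
       <= L%:E * interval_integral (a - delta) (a + delta) W)%E.

Definition trig_polynomial (R : realType) (n : nat) (p : R -> R) : Prop :=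
  exists a b : nat -> R, forall t,
    p t = a 0%N +
      \sum_(1 <= k < n.+1) (a k * cos (k%:R * t) + b k * sin (k%:R * t)).

Definition trig_quadrature (R : realType) (W : R -> R) (n N : nat)
    (theta w : 'I_N -> R) : Prop :=
  (forall i j : 'I_N, (i <= j)%N -> theta i <= theta j) /\
  forall p : R -> R, trig_polynomial n p ->
    interval_integral (- pi) pi (fun t => p t * W t)
      = (\sum_(i < N) w i * p (theta i))%:E.

Definition chebyshev_type_quadrature (R : realType) (W : R -> R) (n N : nat)
    (theta w : 'I_N -> R) : Prop :=
  trig_quadrature W n theta w /\ forall i j : 'I_N, w i = w j.

Definition has_chebyshev_type_quadrature (R : realType) (W : R -> R)
    (n N : nat) : Prop :=
  exists theta w : 'I_N -> R, chebyshev_type_quadrature W n theta w.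

(* The minimum of a set of naturals, as an extended real: it is attained when
   the set is nonempty, and is +oo when the set is empty. *)
Definition nat_min (R : realType) (A : set nat) : \bar R :=
  ereal_inf [set (N%:R)%:E | N in A].

Definition Ntrig (R : realType) (W : R -> R) (n : nat) : \bar R :=
  nat_min R [set N | has_chebyshev_type_quadrature W n N].

Definition Ntrig_bar (R : realType) (W : R -> R) (n : nat) : \bar R :=
  nat_min R [set M | forall N, (M <= N)%N -> has_chebyshev_type_quadrature W n N].

(* The quotient is taken in the extended reals, where 0^-1 = +oo. *)
Definition Rtrig (R : realType) (W : R -> R) (n : nat) : \bar R :=
  (interval_integral (- pi) pi W /
   ereal_inf (range (fun x : R =>
     interval_integral (x - n%:R^-1) (x + n%:R^-1) W)))%E.

(* Main.v *)
Require Import Defs.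
From HB Require Import structures.
From mathcomp Require Import all_boot all_order all_algebra.
From mathcomp Require Import all_classical all_reals all_analysis.
From mathcomp Require Import measurable_realfun.
From mathcomp Require Import ring lra zify.

Set Implicit Arguments.
Unset Strict Implicit.
Unset Printing Implicit Defensive.

Import Order.TTheory GRing.Theory Num.Theory.
Import numFieldNormedType.Exports.

Local Open Scope classical_set_scope.
Local Open Scope ring_scope.

(** Write [T] for the total mass of [W], and call the intervals of radius [1/n]
    balls.  Replacing the doubling constant by a power of two, [L <= 2 ^ s],
    turns doubling into polynomial growth ([mass_growth]): enlarging an interval
    by a factor [x >= 1] multiplies its mass by at most [(2 x) ^ s].  The other
    ingredient is the Jackson kernel [jackson n e], a nonnegative trigonometric
    polynomial of degree less than [n], equal to 1 at 0 and decaying like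
    [(1 + n |t|) ^ (- 2 e)].  For [e = s + 2] this decay beats the growth of the
    masses, so the integral of such a kernel against [W] is at most a constant
    times the mass of the ball around its centre ([tail_integral]).

    Lower bound ([node_count_ge]).  In a quadrature with [N] equal weights every
    weight is [T / N].  The polynomial [(kappa / n ^ 2 - (1 - cos (t - y)))] times
    the kernel centred at [y] has positive integral when [kappa] is large, so it
    is positive at some node; that node lies within [O (1 / n)] of [y] modulo
    the period.  Integrating the kernel centred at this node gives
    [T / N <= C * mass of its ball], and the latter ball is comparable with the
    ball around [y].

    Upper bound ([quadrature_exists]).  Start from the quantiles [theta_i] of the
    measure [W], which cut the circle into arcs of mass [T / N]; when every ball
    has mass at least [C * T / N], the arcs are much shorter than [1 / n].  The
    resulting error [E (p)] of the equal-weight formula on a polynomial [p] of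
    degree at most [n] satisfies [|E (p)| <= beta * sum_i |p' (theta_i)|] with a
    small [beta].  By the Hahn-Banach theorem in finite dimension
    ([hahn_banach_l1]) there are displacements [u_i], all bounded by [beta], with
    [E (p) = sum_i u_i p' (theta_i)] for every [p].  Moving the nodes to
    [theta_i - u_i] cancels the error to first order, and the second order
    remainder satisfies the same kind of estimate with [beta] replaced by
    [C n beta ^ 2].  This is a Newton iteration; it converges quadratically, and
    its limit is an exact quadrature ([newton_solution]).  The corrections are
    controlled in the sup norm, so all nodes stay close to the quantiles.

    All estimates of the iteration rest on one inequality of
    Marcinkiewicz-Zygmund type ([marcinkiewicz_zygmund], [node_sums]): for nodes
    close to the quantiles and [q] of degree at most [n], the sum of the maxima
    of [|q|], or of [|q'| / n], near the nodes is at most a constant times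
    [sum_i |q (x_i)|].  It is proved as follows.  The measure may be singular, so
    [|q|] is compared with its values at the nodes by interpolation rather than
    through a density.  Each interval of length comparable to [1 / n] is cut into
    [m] parts; inside a part, [|q|] is at most a constant times the values of
    [|q|] at [2 ^ d] separated points plus [length ^ d] times the maximum of the
    [d]-th derivative ([interpolation_bound]).  Each of these points can be taken
    to be a node at which [|q|] is at most its average over a small interval.  The
    derivative term is absorbed: Bernstein's inequality at scale [1 / n]
    ([bernstein_wsum]) and the growth of the masses bound it by
    [C * m ^ (s - d)] times the left-hand side, so [d = s + 1] and [m] large
    suffice.  Bernstein's inequality itself follows from a finite formula which
    expresses [q' (x)] through the values of [q] at [5 n] equidistant points,
    weighted by the Jackson kernel ([bernstein_pointwise]). *)

(** * Translation invariance of the completed Lebesgue measure *)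

Lemma integral_measure_preserving d (T : measurableType d) (R : realType)
    (mu : {measure set T -> \bar R}) (phi : T -> T) (D : set T) (f : T -> \bar R) :
  measurable_fun setT phi ->
  (forall A, measurable A -> mu (phi @^-1` A) = mu A) ->
  measurable D -> measurable_fun D f ->
  (\int[mu]_(x in D) f x = \int[mu]_(x in phi @^-1` D) f (phi x))%E.
Proof.
move=> mphi muphi mD mf.
have H (g : T -> \bar R) : measurable_fun D g -> (forall y, 0 <= g y)%E ->
    (\int[mu]_(x in D) g x = \int[mu]_(x in phi @^-1` D) g (phi x))%E.
  move=> mg g0; rewrite -[RHS](ge0_integral_pushforward mphi mu mD mg (fun y _ => g0 y)).
  by apply: eq_measure_integral => A mA _; exact/esym/muphi.
rewrite integralE [RHS]integralE; congr (_ - _)%E.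
  by rewrite (H _ (measurable_funepos mf) (fun y => funepos_ge0 f y)); apply: eq_integral => x _; rewrite !funeposE.
by rewrite (H _ (measurable_funeneg mf) (fun y => funeneg_ge0 f y)); apply: eq_integral => x _; rewrite !funenegE.
Qed.

Section Translation.
Variables (R : realType).
Local Notation outer := ((wlength (@idfun R))^*)%mu.
Local Notation lambda := (@completed_lebesgue_measure R).

Lemma wlength_shift (c : R) (B : set R) : ocitv B ->
  ocitv ((fun x => x + c) @^-1` B) /\
  wlength idfun ((fun x => x + c) @^-1` B) = wlength idfun B.
Proof.
case=> [[a b] _ <-] /=.
have -> : (fun x => x + c) @^-1` `]a, b] = `](a - c), (b - c)]%classic.
  by apply/seteqP; split=> x; rewrite /= !in_itv /= ltrBlDr lerBrDr.
split; first exact: is_ocitv.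
rewrite !wlength_itv /= !lte_fin ltrD2r; case: ifP => // _.
by rewrite -!EFinB; congr EFin; ring.
Qed.

(** Translation maps a cover by half-open intervals to such a cover with the
    same lengths; the opposite inequality comes from the inverse translation. *)
Lemma outer_shift_le (c : R) (A : set R) :
  (outer ((fun x => (x + c)%R) @^-1` A) <= outer A)%E.
Proof.
apply: le_ereal_inf_tmp => _ [B [mB AB] <-].
apply: ereal_inf_lbound.
exists (fun k => (fun x => x + c) @^-1` B k).
  split=> [i|x /AB [k _ Bk]]; last by exists k.
  exact: (wlength_shift c (mB i)).1.
by apply: eq_eseriesr => k _; exact: (wlength_shift c (mB k)).2.
Qed.

Lemma outer_shift (c : R) (A : set R) :
  outer ((fun x => x + c) @^-1` A) = outer A.
Proof.
apply/eqP; rewrite eq_le outer_shift_le /=.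
have {1}-> : A = (fun x => x - c) @^-1` ((fun x => x + c) @^-1` A).
  by apply/seteqP; split=> x /=; rewrite subrK.
exact: outer_shift_le.
Qed.

(** Caratheodory measurability is expressed by the outer measure alone, so it
    inherits the invariance of the latter. *)
Lemma measurable_shift (c : R) :
  measurable_fun [set: lebesgueTypeR R]
    ((fun x => x + c) : lebesgueTypeR R -> lebesgueTypeR R).
Proof.
move=> _ A mA; rewrite setTI.
have {}mA : caratheodory_measurable outer A := mA.
suff : caratheodory_measurable outer ((fun x => x + c) @^-1` A) by [].
move=> X; have := mA ((fun x => x - c) @^-1` X).
rewrite -(outer_shift c) -(outer_shift c (_ `&` A)) -(outer_shift c (_ `&` ~` A)).
rewrite !preimage_setI preimage_setC.
suff -> : (fun x => x + c) @^-1` ((fun x => x - c) @^-1` X) = X by [].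
by apply/seteqP; split=> x /=; rewrite addrK.
Qed.

Lemma measurable_itvL (i : interval R) :
  measurable ([set` i] : set (lebesgueTypeR R)).
Proof. by apply: sub_caratheodory; exact: measurable_itv. Qed.

Lemma interval_integral_shift (a b c : R) (f : R -> R) :
  measurable_fun [set: lebesgueTypeR R] (f : lebesgueTypeR R -> R) ->
  interval_integral (a + c) (b + c) f = interval_integral a b (fun t => f (t + c)).
Proof.
move=> mf; rewrite /interval_integral.
have -> : `[a, b]%classic = (fun x : R => x + c) @^-1` `[(a + c), (b + c)].
  by apply/seteqP; split=> x; rewrite /= !in_itv /= !lerD2r.
apply: (integral_measure_preserving (measurable_shift c)).
- by move=> A _; exact: outer_shift.
- exact: measurable_itvL.
- by apply/measurable_EFinP; exact: measurable_funS mf.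
Qed.

Lemma lambda_set1 (x : R) : lambda [set x] = 0%E.
Proof. exact: (@lebesgue_measure_set1 R x). Qed.

Lemma continuous_measurableL (f : R -> R) : continuous f ->
  measurable_fun [set: lebesgueTypeR R] (f : lebesgueTypeR R -> R).
Proof.
move=> cf _ A mA; apply: sub_caratheodory.
have mf : measurable_fun [set: measurableTypeR R] f by exact: continuous_measurable_fun.
exact: mf.
Qed.

End Translation.

(** * Integrals against a doubling weight *)

Section WeightedIntegral.
Context d (T : measurableType d) (R : realType) (mu : {measure set T -> \bar R}).
Variable W : T -> R.
Hypothesis W0 : forall t, 0 <= W t.
Hypothesis mW : measurable_fun setT W.

Lemma integrable_bounded_weight (D : set T) (f : T -> R) (M : R) :
  measurable D -> measurable_fun setT f -> (forall x, D x -> `|f x| <= M) ->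
  (\int[mu]_(x in D) (W x)%:E < +oo)%E ->
  mu.-integrable D (EFin \o (fun x => f x * W x)).
Proof.
move=> mD mf fM WD.
have iW : mu.-integrable D (EFin \o W).
  apply/integrableP; split.
    by apply/measurable_EFinP; exact: measurable_funS mW.
  apply: le_lt_trans WD; rewrite le_eqVlt; apply/orP; left; apply/eqP.
  by apply: eq_integral => x _; rewrite /= ger0_norm.
have -> : EFin \o (fun x => f x * W x) = ((EFin \o f) \* (EFin \o W))%E.
  by apply/funext => x.
apply: integrableMr => //; first exact: measurable_funS mf.
exists M; split; first exact: num_real.
by move=> y My x Dx; apply: le_trans (fM x Dx) (ltW My).
Qed.

End WeightedIntegral.

Section Weight.
Variables (R : realType) (L : R) (W : R -> R).
Hypothesis W_weight : periodic_weight W.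
Hypothesis W_doubling : doubling L W.
Hypothesis L_ge0 : 0 <= L.
Local Notation lambda := (@completed_lebesgue_measure R).

Let W0 : forall t, 0 <= W t. Proof. by case: W_weight. Qed.
Let mW : measurable_fun [set: lebesgueTypeR R] (W : lebesgueTypeR R -> R).
Proof. by case: W_weight. Qed.

Lemma interval_integral_le (a b c d : R) : c <= a -> b <= d ->
  (interval_integral a b W <= interval_integral c d W)%E.
Proof.
move=> ca bd; apply: ge0_subset_integral; first exact: measurable_itvL.
- exact: measurable_itvL.
- by apply/measurable_EFinP; exact: measurable_funS mW.
- by move=> x _; rewrite lee_fin.
- by move=> x; rewrite /= !in_itv /= => /andP[/(le_trans ca) -> /le_trans -> //].
Qed.

(** Doubling propagates finiteness from one period to the intervals of radius
    [2 ^ k * pi]. *)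
Lemma interval_integral_lty (a b : R) : (interval_integral a b W < +oo)%E.
Proof.
have [_ _ _ /andP[_ Woo]] := W_weight.
have H k : (interval_integral (- (2 ^+ k * pi)) (2 ^+ k * pi) W < +oo)%E.
  elim: k => [|k IH]; first by rewrite expr0 mul1r.
  have p0 : 0 < 2 ^+ k * (pi : R) by rewrite mulr_gt0 ?exprn_gt0 ?pi_gt0.
  have := @W_doubling (2 ^+ k * pi) 0 p0.
  rewrite !add0r mulrA -exprS => /le_lt_trans; apply.
  exact: lte_mul_pinfty.
pose m := Num.max `|a| `|b|.
have [k mk] : exists k, m <= 2 ^+ k * pi.
  exists (Num.bound m).
  have m0 : 0 <= m by rewrite le_max normr_ge0.
  apply: le_trans (ltW (archi_boundP m0)) _.
  have h : (Num.bound m)%:R <= 2 ^+ Num.bound m :> R.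
    by rewrite -natrX ler_nat ltnW // ltn_expl.
  apply: le_trans h _; rewrite ler_peMr ?exprn_ge0 //.
  by have := pi_ge2 R; lra.
apply: le_lt_trans (H k); apply: interval_integral_le.
  by rewrite lerNl (le_trans _ mk) // le_max -normrN ler_norm.
by rewrite (le_trans _ mk) // le_max ler_norm orbT.
Qed.

Definition weighted_integral (a b : R) (f : R -> R) : R :=
  fine (interval_integral a b (fun t => f t * W t)).
Definition interval_mass (a b : R) : R := fine (interval_integral a b W).

Lemma wint1 (a b : R) : weighted_integral a b (fun=> 1) = interval_mass a b.
Proof.
rewrite /weighted_integral /interval_mass; congr (fine (interval_integral _ _ _)).
by apply/funext => t; rewrite mul1r.
Qed.

Lemma continuous_le_itv (f : R -> R) (a b : R) : continuous f ->
  exists2 M, 0 <= M & forall x, a <= x <= b -> `|f x| <= M.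
Proof.
move=> cf; have [ab|ba] := leP a b; last first.
  by exists 0 => // x /andP[ax /(le_trans ax)]; rewrite leNgt ba.
have cn : {within `[a, b], continuous (fun x => `|f x|)}.
  by apply: continuous_subspaceT => x; apply: cvg_norm; exact: cf.
have [c _ cmax] := EVT_max ab cn.
by exists `|f c| => // x axb; apply: cmax; rewrite in_itv.
Qed.

Lemma wint_integrable (a b : R) (f : R -> R) : continuous f ->
  lambda.-integrable (`[a, b]%classic : set (lebesgueTypeR R))
    (EFin \o (fun x => f x * W x)).
Proof.
move=> cf; have [M _ fM] := continuous_le_itv a b cf.
apply: (@integrable_bounded_weight _ _ _ lambda W W0 mW _ f M).
- exact: measurable_itvL.
- exact: continuous_measurableL.
- by move=> x; rewrite /= in_itv => /fM.
- exact: interval_integral_lty.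
Qed.

Lemma wintE (a b : R) (f : R -> R) : continuous f ->
  interval_integral a b (fun t => f t * W t) = (weighted_integral a b f)%:E.
Proof.
move=> cf; rewrite /weighted_integral fineK //.
apply: (@integrable_fin_num _ _ _ lambda); first exact: measurable_itvL.
exact: wint_integrable.
Qed.

Lemma massE (a b : R) : interval_integral a b W = (interval_mass a b)%:E.
Proof.
rewrite /interval_mass fineK // ge0_fin_numE ?interval_integral_lty //.
by apply: integral_ge0 => x _; rewrite lee_fin.
Qed.

Lemma wint_add (a b c : R) (f : R -> R) : continuous f -> a <= b -> b <= c ->
  weighted_integral a c f = weighted_integral a b f + weighted_integral b c f.
Proof.
move=> cf ab bc.
have iac := @wint_integrable a c f cf.
have UE : `[a, c]%classic = `[a, b] `|` `]b, c].
  apply/seteqP; split=> x; rewrite /= !in_itv /=.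
    by move=> /andP[-> ->]; rewrite andbT /=; have [|] := leP x b; [left|right].
  case=> /andP[h1 h2]; first by rewrite h1 (le_trans h2 bc).
  by rewrite h2 andbT (le_trans ab (ltW h1)).
have bcE : `]b, c]%classic = `[b, c] `\ b.
  apply/seteqP; split=> x; rewrite /= !in_itv /=.
    by move=> /andP[h1 h2]; split; [rewrite (ltW h1)|apply/eqP; rewrite gt_eqF].
  by move=> [/andP[h1 h2] /eqP h3]; rewrite h2 andbT lt_def h3.
have mN : measurable ([set b] : set (lebesgueTypeR R)).
  by rewrite -set_itv1; exact: measurable_itvL.
rewrite /weighted_integral /interval_integral -!/(Rintegral lambda _ _).
rewrite UE Rintegral_setU; [|exact: measurable_itvL|exact: measurable_itvL| |].
- congr (_ + _); rewrite /Rintegral bcE; congr fine.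
  rewrite -(@negligible_integral _ _ _ lambda _ [set b]) //.
  + exact: measurable_itvL.
  + exact: wint_integrable.
  + exact: lambda_set1.
- by rewrite -UE.
- apply/disj_set2P; rewrite -subset0 => x [] /=; rewrite !in_itv /= => /andP[_ h1] /andP[h2 _].
  by move: h2; rewrite ltNge h1.
Qed.

Lemma wint_lin (a b k : R) (f g : R -> R) : continuous f -> continuous g ->
  weighted_integral a b (fun t => k * f t + g t) = k * weighted_integral a b f + weighted_integral a b g.
Proof.
move=> cf cg.
rewrite /weighted_integral /interval_integral -!/(Rintegral lambda _ _).
have mD : measurable (`[a, b]%classic : set (lebesgueTypeR R)) by exact: measurable_itvL.
rewrite -(@RintegralZl _ _ _ lambda _ _ _ mD); last exact: wint_integrable.
rewrite -(@RintegralD _ _ _ lambda _ _ _ mD); last exact: wint_integrable.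
  by apply: eq_Rintegral => x _; rewrite mulrDl mulrA.
have ck : continuous (fun t => k * f t) by move=> x; apply: cvgM; [exact: cvg_cst|exact: cf].
have := @wint_integrable a b _ ck; congr (lambda.-integrable _ _).
by apply/funext => x; rewrite /= mulrA.
Qed.

Lemma wint_le (a b : R) (f g : R -> R) : continuous f -> continuous g ->
  (forall t, a <= t <= b -> f t <= g t) -> weighted_integral a b f <= weighted_integral a b g.
Proof.
move=> cf cg fg; rewrite /weighted_integral /interval_integral -!/(Rintegral lambda _ _).
apply: le_Rintegral; first exact: measurable_itvL.
- exact: wint_integrable.
- exact: wint_integrable.
- by move=> x; rewrite /= in_itv => /fg h; rewrite ler_wpM2r.
Qed.

End Weight.

(** * Masses of intervals *)

Section Mass.
Variables (R : realType) (s : nat) (W : R -> R).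
Hypothesis W_weight : periodic_weight W.
Hypothesis W_doubling : doubling (2 ^+ s) W.

Let W0 : forall t, 0 <= W t. Proof. by case: W_weight. Qed.
Let mW : measurable_fun [set: lebesgueTypeR R] (W : lebesgueTypeR R -> R).
Proof. by case: W_weight. Qed.
Let L0 : 0 <= 2 ^+ s :> R. Proof. exact: exprn_ge0. Qed.
Let mE := @massE R (2 ^+ s) W W_weight W_doubling L0.
Local Notation mass := (interval_mass W).
Local Notation wint := (weighted_integral W).

Lemma wint_shift (a b : R) (f : R -> R) : continuous f ->
  (forall t, f (t + 2 * pi) = f t) -> wint (a + 2 * pi) (b + 2 * pi) f = wint a b f.
Proof.
move=> cf pf; rewrite /weighted_integral interval_integral_shift.
  congr (fine (interval_integral _ _ _)); apply/funext => t.
  by case: W_weight => _ -> _ _; rewrite pf.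
by apply: measurable_funM => //; exact: continuous_measurableL.
Qed.

Lemma mass_shift (a b : R) : mass (a + 2 * pi) (b + 2 * pi) = mass a b.
Proof. by rewrite -!wint1 wint_shift // => x; exact: cvg_cst. Qed.

Lemma mass_ge0 (a b : R) : 0 <= mass a b.
Proof. by rewrite /interval_mass fine_ge0 //; apply: integral_ge0 => x _; rewrite lee_fin. Qed.

Lemma mass_add (a b c : R) : a <= b -> b <= c -> mass a c = mass a b + mass b c.
Proof.
move=> ab bc; rewrite -!wint1.
by apply: (wint_add W_weight W_doubling L0) => // x; exact: cvg_cst.
Qed.

Lemma mass_le (a b c d : R) : c <= a -> b <= d -> mass a b <= mass c d.
Proof.
by move=> ca bd; rewrite -lee_fin -!mE; exact: interval_integral_le.
Qed.

Lemma mass_doubling (a r : R) : 0 < r ->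
  mass (a - 2 * r) (a + 2 * r) <= 2 ^+ s * mass (a - r) (a + r).
Proof. by move=> r0; rewrite -lee_fin EFinM -!mE; exact: W_doubling. Qed.

Lemma total_mass_gt0 : 0 < mass (- pi) pi.
Proof. by rewrite -lte_fin -mE; case: W_weight => _ _ _ /andP[]. Qed.

Lemma mass_doubling_iter (a r : R) k : 0 < r ->
  mass (a - 2 ^+ k * r) (a + 2 ^+ k * r) <= 2 ^+ (s * k) * mass (a - r) (a + r).
Proof.
move=> r0; elim: k => [|k IH]; first by rewrite muln0 !expr0 !mul1r.
rewrite exprS -!mulrA; apply: le_trans (mass_doubling _ _) _.
  by rewrite mulr_gt0 // exprn_gt0.
by rewrite mulnS exprD -mulrA ler_wpM2l.
Qed.

Lemma pow2_between (x : R) : 1 <= x -> exists k, x <= 2 ^+ k <= 2 * x.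
Proof.
move=> x1.
have [|k xk kmin] := @ex_minnP (fun k => x <= 2 ^+ k).
  exists (Num.bound x); apply: le_trans (ltW (archi_boundP _)) _; first lra.
  by rewrite -natrX ler_nat ltnW // ltn_expl.
exists k; rewrite xk /=; case: k xk kmin => [|k] _ kmin; first by rewrite expr0; lra.
rewrite exprS ler_pM2l // leNgt; apply/negP => /ltW h.
by have := kmin k h; rewrite ltnn.
Qed.

Lemma mass_growth (a r x : R) : 0 < r -> 1 <= x ->
  mass (a - x * r) (a + x * r) <= (2 * x) ^+ s * mass (a - r) (a + r).
Proof.
move=> r0 x1; have [k /andP[xk k2x]] := pow2_between x1.
have h : x * r <= 2 ^+ k * r by rewrite ler_pM2r.
apply: le_trans (_ : mass (a - 2 ^+ k * r) (a + 2 ^+ k * r) <= _).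
  by apply: mass_le; lra.
apply: le_trans (mass_doubling_iter _ _ r0) _.
apply: ler_wpM2r; first exact: mass_ge0.
by rewrite mulnC exprM lerXn2r // nnegrE; [exact: exprn_ge0 | lra].
Qed.

(** An interval of mass zero would, by growth, give mass zero to a whole period. *)
Lemma mass_ball_gt0 (a r : R) : 0 < r -> 0 < mass (a - r) (a + r).
Proof.
move=> r0; rewrite lt_def mass_ge0 andbT; apply/eqP => m0.
pose x := Num.max 1 ((`|a| + pi) / r).
have x1 : 1 <= x by rewrite le_max lexx.
have := mass_growth a r0 x1; rewrite m0 mulr0 leNgt => /negP; apply.
apply: lt_le_trans total_mass_gt0 _.
have xr : `|a| + pi <= x * r by rewrite -ler_pdivrMr // le_max lexx orbT.
have := ler_norm a; have := ler_norm (- a); rewrite normrN => h1 h2.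
by apply: mass_le; lra.
Qed.

Lemma mass_gt0 (a b : R) : a < b -> 0 < mass a b.
Proof.
move=> ab; have := @mass_ball_gt0 ((a + b) / 2) ((b - a) / 2).
have -> : (a + b) / 2 - (b - a) / 2 = a by field.
have -> : (a + b) / 2 + (b - a) / 2 = b by field.
by apply; lra.
Qed.

(** Reverse doubling: to the right of [a + r] there is still room for an interval
    of radius [r], whose mass is comparable with that of the central one. *)
Lemma mass_annulus (a r : R) : 0 < r ->
  (1 + (2 ^+ (s * 3))^-1) * mass (a - r) (a + r) <= mass (a - 4 * r) (a + 4 * r).
Proof.
move=> r0.
rewrite (@mass_add (a - 4 * r) (a + r)); [|lra|lra].
rewrite mulrDl mul1r lerD //; first by apply: mass_le; lra.
rewrite mulrC ler_pdivrMr ?exprn_gt0 // mulrC.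
have := @mass_doubling_iter (a + 2 * r) r 3 r0.
set m := mass _ _ => h.
apply: le_trans (_ : m <= _).
  by apply: mass_le; lra.
apply: le_trans h _; rewrite ler_wpM2l ?exprn_ge0 //.
by apply: mass_le; lra.
Qed.

Lemma mass_annulus_iter (a r : R) k : 0 < r ->
  (1 + k%:R * (2 ^+ (s * 3))^-1) * mass (a - r) (a + r) <=
    mass (a - 4 ^+ k * r) (a + 4 ^+ k * r).
Proof.
move=> r0; elim: k => [|k IH]; first by rewrite mul0r addr0 expr0 !mul1r.
rewrite exprS -!mulrA; apply: le_trans (mass_annulus _ _); last first.
  by rewrite mulr_gt0 // exprn_gt0.
set c := _^-1 in IH *.
have c0 : 0 <= c by rewrite invr_ge0 exprn_ge0.
have mm : mass (a - r) (a + r) <= mass (a - 4 ^+ k * r) (a + 4 ^+ k * r).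
  have : r <= 4 ^+ k * r by rewrite ler_peMl ?(ltW r0) // exprn_ege1 // ler1n.
  by move=> ?; apply: mass_le; lra.
rewrite [leRHS]mulrDl mul1r.
have := ler_wpM2l c0 mm; rewrite -[k.+1%:R]natr1.
lra.
Qed.

(** Iterating reverse doubling inwards from radius 1 shows that small intervals
    have small mass, uniformly on bounded sets; in particular [W] has no atoms
    and its cumulative function is continuous. *)
Lemma mass_small (M e : R) : 0 < e -> exists2 r, 0 < r &
  forall a, `|a| <= M -> mass (a - r) (a + r) <= e.
Proof.
move=> e0; pose c := (2 ^+ (s * 3))^-1 : R.
have c0 : 0 < c by rewrite invr_gt0 exprn_gt0.
pose A := mass (- (M + 1)) (M + 1).
have A0 : 0 <= A by exact: mass_ge0.
pose k := Num.bound (A / (e * c)).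
have kA : A <= k%:R * (e * c).
  by rewrite -ler_pdivrMr ?mulr_gt0 // ltW // archi_boundP // divr_ge0 // mulr_ge0 // ltW.
exists (1 / 4 ^+ k); first by rewrite divr_gt0 // exprn_gt0.
move=> a; rewrite ler_norml => /andP[a1 a2]; have := @mass_annulus_iter a (1 / 4 ^+ k) k.
rewrite -/c divr_gt0 ?exprn_gt0 // => /(_ isT).
have -> : 4 ^+ k * (1 / 4 ^+ k) = 1 :> R by rewrite mulrC divfK // gt_eqF // exprn_gt0.
set m := mass _ _ => h.
have h2 : mass (a - 1) (a + 1) <= A by apply: mass_le; lra.
have m0 : 0 <= m by exact: mass_ge0.
rewrite leNgt; apply/negP => em.
have : k%:R * (e * c) <= k%:R * (m * c).
  by apply: ler_wpM2l => //; rewrite ler_pM2r // ltW.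
have -> : k%:R * (m * c) = k%:R * c * m by ring.
have : (1 + k%:R * c) * m = m + k%:R * c * m by ring.
lra.
Qed.

Lemma continuous_cumulative (b : R) : continuous (fun x => mass b x).
Proof.
move=> x; apply/cvgrPdist_le => e e0.
have [r r0 rP] := mass_small `|x| e0.
near=> y.
have xy : `|x - y| < r by near: y; apply: cvgr_dist_lt.
have key u v : u <= v -> `|mass b u - mass b v| <= mass u v.
  move=> uv; have [bu|ub] := leP b u.
    by rewrite (mass_add bu uv) opprD addNKr normrN ger0_norm ?mass_ge0.
  have -> : mass b u = 0.
    apply/eqP; rewrite eq_le mass_ge0 andbT /interval_mass /interval_integral.
    by rewrite set_itv_ge ?integral_set0 // bnd_simp -ltNge.
  rewrite sub0r normrN ger0_norm ?mass_ge0 //; apply: mass_le => //; exact: ltW.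
move: xy; rewrite ltr_norml => /andP[h1 h2].
apply: le_trans (rP x (lexx _)).
have [xy|/ltW yx] := leP x y.
  by apply: le_trans (key _ _ xy) _; apply: mass_le; lra.
by rewrite distrC; apply: le_trans (key _ _ yx) _; apply: mass_le; lra.
Unshelve. all: by end_near. Qed.

End Mass.

(** * Trigonometric polynomials *)

Section TrigPoly.
Variable R : realType.
Implicit Types (p q f g : R -> R) (n m k : nat).

(** Products, translates and derivatives are handled by checking cosines and
    sines. *)
Lemma trig_ind n (P : (R -> R) -> Prop) :
  (forall k, (k <= n)%N -> P (fun t => cos (k%:R * t))) ->
  (forall k, (k <= n)%N -> P (fun t => sin (k%:R * t))) ->
  (forall c f g, P f -> P g -> P (fun t => c * f t + g t)) ->
  forall p, trig_polynomial n p -> P p.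
Proof.
move=> Pc Ps Pl p [a [b pE]].
have P0 : P (fun=> 0).
  have := Pl (-1) _ _ (Pc 0 isT) (Pc 0 isT).
  by congr P; apply/funext => t; rewrite mulN1r addNr.
suff H m : (m <= n)%N -> P (fun t => a 0%N + \sum_(1 <= k < m.+1)
    (a k * cos (k%:R * t) + b k * sin (k%:R * t))).
  by have := H n (leqnn n); congr P; apply/funext => t; rewrite pE.
elim: m => [_|m IH mn].
  have := Pl (a 0%N) _ _ (Pc 0 isT) P0.
  by congr P; apply/funext => t; rewrite big_geq // mul0r cos0 mulr1.
have := Pl (a m.+1) _ _ (Pc m.+1 mn) (Pl (b m.+1) _ _ (Ps m.+1 mn) (IH (ltnW mn))).
congr P; apply/funext => t; rewrite [in RHS]big_nat_recr //=.
ring.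
Qed.

Lemma trig_lin n c p q : trig_polynomial n p -> trig_polynomial n q ->
  trig_polynomial n (fun t => c * p t + q t).
Proof.
move=> [a [b pE]] [a' [b' qE]].
exists (fun k => c * a k + a' k), (fun k => c * b k + b' k) => t.
rewrite pE qE mulrDr mulr_sumr addrACA; congr (_ + _).
by rewrite -big_split /=; apply: eq_bigr => k _; ring.
Qed.

Lemma trig_ext n p q : p =1 q -> trig_polynomial n p -> trig_polynomial n q.
Proof. by move=> /funext ->. Qed.

Lemma trig_cst n c : trig_polynomial n (fun _ : R => c).
Proof.
exists (fun k => if k == 0%N then c else 0), (fun=> 0) => t.
rewrite eqxx big_nat big1 ?addr0 // => k /andP[k0 _].
by rewrite -[k == 0%N]negbK -lt0n k0 /= !mul0r addr0.
Qed.

Lemma trig_cos n k : (k <= n)%N -> trig_polynomial n (fun t : R => cos (k%:R * t)).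
Proof.
case: k => [_|k kn].
  by apply: trig_ext (trig_cst n 1) => t; rewrite mul0r cos0.
exists (fun j => (j == k.+1)%:R), (fun=> 0) => t.
rewrite (big_rem k.+1) /=; last by rewrite mem_index_iota.
rewrite eqxx mul1r mul0r !addr0 add0r big_seq big1 ?addr0 // => j.
rewrite mem_rem_uniq ?iota_uniq // inE => /andP[/negbTE -> _].
by rewrite !mul0r addr0.
Qed.

Lemma trig_sin n k : (k <= n)%N -> trig_polynomial n (fun t : R => sin (k%:R * t)).
Proof.
case: k => [_|k kn].
  by apply: trig_ext (trig_cst n 0) => t; rewrite mul0r sin0.
exists (fun=> 0), (fun j => (j == k.+1)%:R) => t.
rewrite (big_rem k.+1) /=; last by rewrite mem_index_iota.
rewrite eqxx mul1r mul0r !add0r big_seq big1 ?addr0 // => j.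
rewrite mem_rem_uniq ?iota_uniq // inE => /andP[/negbTE -> _].
by rewrite !mul0r addr0.
Qed.

Lemma trig_le n m p : (n <= m)%N -> trig_polynomial n p -> trig_polynomial m p.
Proof.
move=> nm; move: p; apply: trig_ind => [k kn|k kn|c f g]; last exact: trig_lin.
- exact/trig_cos/leq_trans/nm.
- exact/trig_sin/leq_trans/nm.
Qed.

Lemma trigZ n c p : trig_polynomial n p -> trig_polynomial n (fun t => c * p t).
Proof.
move=> tp; apply: trig_ext (trig_lin c tp (trig_cst n 0)) => t; exact: addr0.
Qed.

Lemma trigD n p q : trig_polynomial n p -> trig_polynomial n q ->
  trig_polynomial n (fun t => p t + q t).
Proof.
by move=> tp tq; apply: trig_ext (trig_lin 1 tp tq) => t; rewrite mul1r.
Qed.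

Lemma trig_sum n (I : Type) (r : seq I) (F : I -> R -> R) :
  (forall i, trig_polynomial n (F i)) -> trig_polynomial n (fun t => \sum_(i <- r) F i t).
Proof.
move=> tF; elim: r => [|i r IH].
  by apply: trig_ext (trig_cst n 0) => t; rewrite big_nil.
by apply: trig_ext (trigD (tF i) IH) => t; rewrite big_cons.
Qed.

Let cos_sub j k (t : R) : (j <= k)%N ->
  cos ((k - j)%N%:R * t) = cos (k%:R * t) * cos (j%:R * t) + sin (k%:R * t) * sin (j%:R * t).
Proof. by move=> jk; rewrite natrB // mulrBl cosB. Qed.
Let sin_sub j k (t : R) : (j <= k)%N ->
  sin ((k - j)%N%:R * t) = sin (k%:R * t) * cos (j%:R * t) - cos (k%:R * t) * sin (j%:R * t).
Proof. by move=> jk; rewrite natrB // mulrBl sinB. Qed.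
Let cos_add j k (t : R) :
  cos ((j + k)%N%:R * t) = cos (j%:R * t) * cos (k%:R * t) - sin (j%:R * t) * sin (k%:R * t).
Proof. by rewrite natrD mulrDl cosD. Qed.
Let sin_add j k (t : R) :
  sin ((j + k)%N%:R * t) = sin (j%:R * t) * cos (k%:R * t) + cos (j%:R * t) * sin (k%:R * t).
Proof. by rewrite natrD mulrDl sinD. Qed.

Lemma trig_mul n m p q : trig_polynomial n p -> trig_polynomial m q ->
  trig_polynomial (n + m) (fun t => p t * q t).
Proof.
move=> tp tq; move: p tp; apply: trig_ind; last first.
- move=> c f g tf tg; apply: trig_ext (trig_lin c tf tg) => t; ring.
- move=> j jn; move: q tq; apply: trig_ind; last first.
  + move=> c f g tf tg; apply: trig_ext (trig_lin c tf tg) => t; ring.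
  + move=> k km; have jk : (j + k <= n + m)%N by exact: leq_add.
    have [h|/ltnW h] := leqP j k.
      have kj : (k - j <= n + m)%N by rewrite (leq_trans (leq_subr _ _)) // (leq_trans km) // leq_addl.
      apply: trig_ext (trig_lin (- 2^-1) (trig_cos jk) (trigZ 2^-1 (trig_cos kj))) => t.
      by rewrite cos_add cos_sub //; field.
    have kj : (j - k <= n + m)%N by rewrite (leq_trans (leq_subr _ _)) // (leq_trans jn) // leq_addr.
    apply: trig_ext (trig_lin (- 2^-1) (trig_cos jk) (trigZ 2^-1 (trig_cos kj))) => t.
    by rewrite cos_add cos_sub //; field.
  + move=> k km; have jk : (j + k <= n + m)%N by exact: leq_add.
    have [h|/ltnW h] := leqP j k.
      have kj : (k - j <= n + m)%N by rewrite (leq_trans (leq_subr _ _)) // (leq_trans km) // leq_addl.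
      apply: trig_ext (trig_lin (2^-1) (trig_sin jk) (trigZ (- 2^-1) (trig_sin kj))) => t.
      by rewrite sin_add sin_sub //; field.
    have kj : (j - k <= n + m)%N by rewrite (leq_trans (leq_subr _ _)) // (leq_trans jn) // leq_addr.
    apply: trig_ext (trig_lin (2^-1) (trig_sin jk) (trigZ 2^-1 (trig_sin kj))) => t.
    by rewrite sin_add sin_sub //; field.
- move=> j jn; move: q tq; apply: trig_ind; last first.
  + move=> c f g tf tg; apply: trig_ext (trig_lin c tf tg) => t; ring.
  + move=> k km; have jk : (j + k <= n + m)%N by exact: leq_add.
    have [h|/ltnW h] := leqP j k.
      have kj : (k - j <= n + m)%N by rewrite (leq_trans (leq_subr _ _)) // (leq_trans km) // leq_addl.
      apply: trig_ext (trig_lin (2^-1) (trig_sin jk) (trigZ (2^-1) (trig_sin kj))) => t.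
      by rewrite sin_add sin_sub //; field.
    have kj : (j - k <= n + m)%N by rewrite (leq_trans (leq_subr _ _)) // (leq_trans jn) // leq_addr.
    apply: trig_ext (trig_lin (2^-1) (trig_sin jk) (trigZ (- 2^-1) (trig_sin kj))) => t.
    by rewrite sin_add sin_sub //; field.
  + move=> k km; have jk : (j + k <= n + m)%N by exact: leq_add.
    have [h|/ltnW h] := leqP j k.
      have kj : (k - j <= n + m)%N by rewrite (leq_trans (leq_subr _ _)) // (leq_trans km) // leq_addl.
      apply: trig_ext (trig_lin (2^-1) (trig_cos jk) (trigZ 2^-1 (trig_cos kj))) => t.
      by rewrite cos_add cos_sub //; field.
    have kj : (j - k <= n + m)%N by rewrite (leq_trans (leq_subr _ _)) // (leq_trans jn) // leq_addr.
    apply: trig_ext (trig_lin (2^-1) (trig_cos jk) (trigZ 2^-1 (trig_cos kj))) => t.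
    by rewrite cos_add cos_sub //; field.
Qed.

Lemma trig_pow n p e : trig_polynomial n p ->
  trig_polynomial (e * n) (fun t => p t ^+ e).
Proof.
move=> tp; elim: e => [|e IH]; first exact: trig_ext (trig_cst _ 1).
by rewrite mulSn; apply: trig_ext (trig_mul tp IH) => t; rewrite exprS.
Qed.

Lemma trig_translate n p (x : R) : trig_polynomial n p ->
  trig_polynomial n (fun t => p (t + x)).
Proof.
move: p; apply: trig_ind => [k kn|k kn|c f g]; last exact: trig_lin.
- apply: trig_ext (trig_lin (cos (k%:R * x)) (trig_cos kn)
    (trigZ (- sin (k%:R * x)) (trig_sin kn))) => t.
  by rewrite mulrDr cosD; ring.
- apply: trig_ext (trig_lin (cos (k%:R * x)) (trig_sin kn)
    (trigZ (sin (k%:R * x)) (trig_cos kn))) => t.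
  by rewrite mulrDr sinD; ring.
Qed.

Lemma trig_periodic n p : trig_polynomial n p -> forall t, p (t + 2 * pi) = p t.
Proof.
move: p; apply: trig_ind => [k kn t|k kn t|c f g pf pg t]; last by rewrite pf pg.
- rewrite mulrDr (_ : k%:R * (2 * pi) = (pi *+ 2) *+ k); last first.
    by rewrite -[RHS]mulr_natl -[pi *+ 2]mulr_natl.
  by rewrite (periodicn (@cosD2pi R)).
- rewrite mulrDr (_ : k%:R * (2 * pi) = (pi *+ 2) *+ k); last first.
    by rewrite -[RHS]mulr_natl -[pi *+ 2]mulr_natl.
  by rewrite (periodicn (@sinD2pi R)).
Qed.

Lemma trig_deriv n p : trig_polynomial n p ->
  trig_polynomial n (derive1 p) /\ forall x : R, is_derive x (1 : R) p (derive1 p x).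
Proof.
suff H : trig_polynomial n p -> exists2 q, trig_polynomial n q &
    forall x : R, is_derive x (1 : R) p (q x).
  move=> /H [q tq pq].
  have -> : derive1 p = q by apply/funext => x; rewrite derive1E; exact: derive_val.
  by [].
move: p; apply: trig_ind => [k kn|k kn|c f g [f' tf' df] [g' tg' dg]].
- exists (fun t => - k%:R * sin (k%:R * t)); first exact/trigZ/trig_sin.
  move=> x; apply: is_derive_eq.
  by rewrite /GRing.scale /=; ring.
- exists (fun t => k%:R * cos (k%:R * t)); first exact/trigZ/trig_cos.
  move=> x; apply: is_derive_eq.
  by rewrite /GRing.scale /=; ring.
- exists (fun t => c * f' t + g' t); first exact: trig_lin.
  move=> x; have := df x; have := dg x => ? ?; apply: is_derive_eq.
  by rewrite /GRing.scale /=; ring.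
Qed.

Lemma trig_continuous n p : trig_polynomial n p -> continuous p.
Proof.
move=> /trig_deriv[_ dp] x; apply: differentiable_continuous.
by apply/derivable1_diffP; have [] := dp x.
Qed.

Lemma trig_deriv_lin n c p q : trig_polynomial n p -> trig_polynomial n q ->
  derive1 (fun t => c * p t + q t) = fun t => c * derive1 p t + derive1 q t.
Proof.
move=> /trig_deriv[_ dp] /trig_deriv[_ dq]; apply/funext => x.
rewrite derive1E; exact: derive_val.
Qed.

End TrigPoly.

(** * Fejer and Jackson kernels *)

Section Kernel.
Variable R : realType.
Implicit Types (t x : R) (n k e : nat).

Lemma norm_sin_le x : `|sin x| <= `|x|.
Proof.
wlog x0 : x / 0 <= x => [H|].
  have [/H //|/ltW x0] := leP 0 x.
  by have := H (- x); rewrite sinN !normrN oppr_ge0; apply.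
have [c _] := @MVT_segment R sin cos 0 x x0 (fun y _ => is_derive_sin y)
  (continuous_subspaceT (@continuous_sin R)).
rewrite sin0 !subr0 => ->; rewrite normrM.
by rewrite -[leRHS]mul1r ler_wpM2r // cos_max.
Qed.

Lemma one_sub_cosE t : 1 - cos t = 2 * sin (t / 2) ^+ 2.
Proof.
have {1}-> : t = (t / 2) *+ 2 by rewrite -mulr_natr divfK // pnatr_eq0.
by rewrite cos_mulr2n cos2sin2 !mulr2n; ring.
Qed.

Lemma one_sub_cos_le t : 1 - cos t <= t ^+ 2 / 2.
Proof.
rewrite one_sub_cosE.
have : sin (t / 2) ^+ 2 <= (t / 2) ^+ 2.
  by rewrite -[leLHS]real_normK ?num_real // -[leRHS]real_normK ?num_real // lerXn2r ?nnegrE // norm_sin_le.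
have -> : t ^+ 2 / 2 = 2 * (t / 2) ^+ 2 by field.
lra.
Qed.

(** The double angle formula and the mean value theorem reduce the claim to
    [cos (pi / 4) ^ 2 = 1 / 2]. *)
Lemma sin_ge_half x : 0 <= x <= pi / 2 -> x / 2 <= sin x.
Proof.
move=> /andP[x0 x1]; have p0 := pi_gt0 R.
have cos_q : cos (pi / 4) ^+ 2 = 2^-1 :> R.
  have := cos_mulr2n (pi / 4 : R).
  have -> : (pi / 4) *+ 2 = pi / 2 :> R by rewrite -mulr_natr; field.
  by rewrite cos_pihalf -mulr_natr => h; lra.
have cq0 : 0 <= cos (pi / 4 : R) by apply: cos_ge0_pihalf; lra.
have cosm (y : R) : 0 <= y <= pi / 4 -> cos (pi / 4) <= cos y.
  move=> /andP[y0 y1]; rewrite leNgt; apply/negP.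
  by rewrite ltr_cos ?in_itv /=; lra.
have x20 : 0 <= x / 2 by lra.
have [c] := @MVT_segment R sin cos 0 (x / 2) x20 (fun y _ => is_derive_sin y)
  (continuous_subspaceT (@continuous_sin R)).
rewrite in_itv /= => /andP[c0 c1]; rewrite sin0 !subr0 => sE.
have -> : x = (x / 2) *+ 2 by rewrite -mulr_natr divfK // pnatr_eq0.
rewrite sin_mulr2n -mulr_natr mulfK ?pnatr_eq0 // sE.
have h1 : cos (pi / 4) <= cos c by apply: cosm; apply/andP; split; lra.
have h2 : cos (pi / 4) <= cos (x / 2) by apply: cosm; apply/andP; split; lra.
have : cos (pi / 4) * cos (pi / 4) <= cos (x / 2) * cos c by apply: ler_pM.
rewrite -expr2 cos_q => h3.
have := ler_wpM2r x20 h3.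
by rewrite -mulr_natr; lra.
Qed.

Lemma one_sub_cos_ge t : `|t| <= pi -> t ^+ 2 / 8 <= 1 - cos t.
Proof.
move=> tpi; rewrite -cos_norm one_sub_cosE.
have h : `|t| / 2 / 2 <= sin (`|t| / 2).
  by apply: sin_ge_half; rewrite divr_ge0 //= ler_pM2r ?invr_gt0.
have : (`|t| / 2 / 2) ^+ 2 <= sin (`|t| / 2) ^+ 2.
  rewrite lerXn2r // ?nnegrE; first by rewrite !divr_ge0.
  by apply: le_trans h; rewrite !divr_ge0.
have -> : (`|t| / 2 / 2) ^+ 2 = t ^+ 2 / 16 by rewrite -[t ^+ 2]real_normK ?num_real //; field.
lra.
Qed.

Definition csum k t : R := \sum_(j < k) cos (j%:R * t).
Definition ssum k t : R := \sum_(j < k) sin (j%:R * t).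

(** Real and imaginary parts of [(1 - z) * (1 + z + ... + z ^ (k - 1)) = 1 - z ^ k]
    for [z = exp (i t)]. *)
Lemma geometric_cos k t :
  csum k t * (1 - cos t) + ssum k t * sin t = 1 - cos (k%:R * t) /\
  ssum k t * (1 - cos t) - csum k t * sin t = - sin (k%:R * t).
Proof.
rewrite /csum /ssum; elim: k => [|k [IH1 IH2]].
  by rewrite !big_ord0 !mul0r cos0 sin0; split; ring.
rewrite !big_ord_recr /= -[k.+1%:R]natr1 [(k%:R + 1) * t]mulrDl mul1r cosD sinD.
split.
  have -> : 1 - (cos (k%:R * t) * cos t - sin (k%:R * t) * sin t) =
    (1 - cos (k%:R * t)) + cos (k%:R * t) * (1 - cos t) + sin (k%:R * t) * sin t by ring.
  by rewrite -IH1; ring.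
have -> : - (sin (k%:R * t) * cos t + cos (k%:R * t) * sin t) =
  - sin (k%:R * t) + sin (k%:R * t) * (1 - cos t) - cos (k%:R * t) * sin t by ring.
by rewrite -IH2; ring.
Qed.

Lemma geometric_sqr k t :
  (csum k t ^+ 2 + ssum k t ^+ 2) * (1 - cos t) = 1 - cos (k%:R * t).
Proof.
have [h1 h2] := geometric_cos k t.
have sc u : sin u ^+ 2 = 1 - cos u ^+ 2 :> R by exact: sin2cos2.
have E : (csum k t ^+ 2 + ssum k t ^+ 2) * ((1 - cos t) ^+ 2 + sin t ^+ 2) =
   (1 - cos (k%:R * t)) ^+ 2 + sin (k%:R * t) ^+ 2.
  by rewrite -h1 -[sin (k%:R * t) ^+ 2]sqrrN -h2; ring.
have E1 u : (1 - cos u) ^+ 2 + sin u ^+ 2 = 2 * (1 - cos u) :> R by rewrite sc; ring.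
by move: E; rewrite !E1; lra.
Qed.

(** The squared modulus of [1 + z + ... + z ^ (k - 1)] at [z = exp (i t)],
    normalised to be 1 at [t = 0]: the Fejer kernel. *)
Definition fejer k t : R := (csum k t ^+ 2 + ssum k t ^+ 2) / k%:R ^+ 2.

Lemma csum_trig k : trig_polynomial k.-1 (csum k).
Proof.
apply: trig_sum => j; apply: trig_cos.
by case: k j => [[]|k] //= j; rewrite -ltnS.
Qed.
Lemma ssum_trig k : trig_polynomial k.-1 (ssum k).
Proof.
apply: trig_sum => j; apply: trig_sin.
by case: k j => [[]|k] //= j; rewrite -ltnS.
Qed.

Lemma fejer_trig k : trig_polynomial (2 * k.-1) (fejer k).
Proof.
apply: trig_ext (trigZ ((k%:R ^+ 2)^-1)
  (trigD (trig_pow 2 (csum_trig k)) (trig_pow 2 (ssum_trig k)))) => t.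
by rewrite mulrC.
Qed.

Lemma fejer_ge0 k t : 0 <= fejer k t.
Proof. by rewrite divr_ge0 ?addr_ge0 ?sqr_ge0. Qed.

Lemma fejerN k t : fejer k (- t) = fejer k t.
Proof.
rewrite /fejer; congr ((_ + _) / _).
  by congr (_ ^+ 2); apply: eq_bigr => j _; rewrite mulrN cosN.
rewrite -sqrrN; congr (_ ^+ 2); rewrite -sumrN; apply: eq_bigr => j _.
by rewrite mulrN sinN opprK.
Qed.

Lemma csum0 k : csum k 0 = k%:R.
Proof.
rewrite /csum (eq_bigr (fun=> 1)) => [|j _]; last by rewrite mulr0 cos0.
by rewrite sumr_const card_ord.
Qed.

Lemma fejer0 k : (0 < k)%N -> fejer k 0 = 1.
Proof.
move=> k0; rewrite /fejer csum0.
have -> : ssum k 0 = 0 by rewrite /ssum big1 // => j _; rewrite mulr0 sin0.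
by rewrite expr0n addr0 divff // expf_eq0 /= pnatr_eq0 -lt0n.
Qed.

Lemma fejer_le1 k t : fejer k t <= 1.
Proof.
case: (posnP k) => [->|k0]; first by rewrite /fejer expr0n invr0 mulr0.
rewrite ler_pdivrMr ?exprn_gt0 ?ltr0n // mul1r.
elim: k {k0} => [|k IH]; first by rewrite /csum /ssum !big_ord0 expr0n addr0.
rewrite /csum /ssum !big_ord_recr /= -/(csum k t) -/(ssum k t) -[k.+1%:R]natr1.
set C := csum k t in IH *; set S := ssum k t in IH *.
set c := cos _; set d := sin _.
have cd : c ^+ 2 + d ^+ 2 = 1 by exact: cos2Dsin2.
(* Cauchy-Schwarz, since [c ^+ 2 + d ^+ 2 = 1]. *)
have CS : C * c + S * d <= k%:R.
  have k0 : (0 : R) <= k%:R by [].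
  have [//|lt] := leP (C * c + S * d) k%:R.
  have : (C * c + S * d) ^+ 2 <= k%:R ^+ 2.
    apply: le_trans IH.
    have : 0 <= (C * d - S * c) ^+ 2 by exact: sqr_ge0.
    have : C ^+ 2 + S ^+ 2 = (C ^+ 2 + S ^+ 2) * (c ^+ 2 + d ^+ 2) by rewrite cd mulr1.
    by move=> ->; lra.
  by rewrite ler_pXn2r ?nnegrE // ?(le_trans k0 (ltW lt)) // leNgt lt.
by rewrite -subr_ge0; move: IH CS cd; rewrite -subr_ge0 => IH CS cd; nra.
Qed.

Lemma fejer_ge_quarter k t : (0 < k)%N -> `|k.-1%:R * t| <= 1 -> 4^-1 <= fejer k t.
Proof.
move=> k0 kt.
have C1 : k%:R / 2 <= csum k t.
  have -> : k%:R / 2 = \sum_(j < k) (2^-1 : R) by rewrite sumr_const card_ord mulr_natl.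
  apply: ler_sum => j _.
  have : (j%:R * t) ^+ 2 <= 1.
    rewrite -[leLHS]real_normK ?num_real // expr_le1 //.
    apply: le_trans kt; rewrite !normrM ler_wpM2r // !ger0_norm // ler_nat.
    by case: (k) j k0 => [[]|m] //= j _; rewrite -ltnS.
  by have := one_sub_cos_le (j%:R * t); lra.
rewrite /fejer ler_pdivlMr ?exprn_gt0 ?ltr0n //.
have : (k%:R / 2) ^+ 2 <= csum k t ^+ 2.
  by rewrite lerXn2r // ?nnegrE ?divr_ge0 // (le_trans _ C1) // divr_ge0.
have := sqr_ge0 (ssum k t).
have -> : (k%:R / 2) ^+ 2 = 4^-1 * k%:R ^+ 2 :> R by field.
lra.
Qed.

(** Multiplication by [1 - cos t], which is at least [t ^ 2 / 8], collapses the
    geometric sum. *)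
Lemma fejer_decay k t : (0 < k)%N -> `|t| <= pi -> fejer k t * (k%:R * t) ^+ 2 <= 16.
Proof.
move=> k0 tpi.
have k2 : k%:R ^+ 2 != 0 :> R by rewrite expf_eq0 /= pnatr_eq0 -lt0n.
have -> : fejer k t * (k%:R * t) ^+ 2 = (csum k t ^+ 2 + ssum k t ^+ 2) * t ^+ 2.
  by rewrite /fejer exprMn; field; rewrite pnatr_eq0 -lt0n.
have A0 : 0 <= csum k t ^+ 2 + ssum k t ^+ 2 by rewrite addr_ge0 ?sqr_ge0.
have := ler_wpM2l A0 (one_sub_cos_ge tpi); rewrite geometric_sqr.
have := cos_geN1 (k%:R * t); lra.
Qed.

(** The order is the largest for which the [e]-th power of the Fejer kernel has
    degree at most [n - 1]; this leaves room for one factor of degree 1. *)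
Definition jackson_order n e := (n.-1 %/ (2 * e)).+1.
Definition jackson n e t : R := fejer (jackson_order n e) t ^+ e.

Lemma jackson_trig n e : trig_polynomial n.-1 (jackson n e).
Proof.
apply: trig_le (trig_pow e (fejer_trig (jackson_order n e))).
by rewrite /= mulnA (mulnC e 2) mulnC leq_divM.
Qed.

Lemma jackson_ge0 n e t : 0 <= jackson n e t.
Proof. by rewrite exprn_ge0 // fejer_ge0. Qed.
Lemma jacksonN n e t : jackson n e (- t) = jackson n e t.
Proof. by rewrite /jackson fejerN. Qed.
Lemma jackson0 n e : jackson n e 0 = 1.
Proof. by rewrite /jackson fejer0 // expr1n. Qed.

Lemma jackson_ge n e t : (0 < n)%N -> `|t| <= n%:R^-1 -> (4 ^+ e)^-1 <= jackson n e t.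
Proof.
move=> n0 tn; rewrite /jackson -exprVn lerXn2r ?nnegrE ?invr_ge0 ?fejer_ge0 //.
apply: fejer_ge_quarter => //=; rewrite normrM ger0_norm //.
apply: le_trans (_ : n%:R * n%:R^-1 <= _); last by rewrite divff // pnatr_eq0 -lt0n.
apply: ler_pM => //; rewrite ler_nat.
by rewrite (leq_trans (leq_div _ _)) // leq_pred.
Qed.

Definition jackson_const e : R := (2 + 128 * e%:R ^+ 2) ^+ e.

Lemma jackson_decay n e t : (0 < n)%N -> (0 < e)%N -> `|t| <= pi ->
  jackson n e t * (1 + n%:R * `|t|) ^+ (2 * e) <= jackson_const e.
Proof.
move=> n0 e0 tpi; rewrite /jackson /jackson_const exprM -exprMn.
apply: lerXn2r; rewrite ?nnegrE.
- by rewrite mulr_ge0 ?fejer_ge0 ?sqr_ge0.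
- by rewrite addr_ge0 // mulr_ge0 // sqr_ge0.
set k := jackson_order n e.
have nk : n%:R <= (2 * e%:R) * k%:R :> R.
  rewrite -!natrM ler_nat /k /jackson_order.
  by rewrite -[leqLHS](prednK n0) mulnC ltn_ceil // muln_gt0.
have fd := @fejer_decay k t isT tpi; have f1 := fejer_le1 k t; have f0 := fejer_ge0 k t.
set F := fejer k t in fd f1 f0 *.
have nt : (n%:R * `|t|) ^+ 2 <= 4 * e%:R ^+ 2 * (k%:R * t) ^+ 2.
  have -> : 4 * e%:R ^+ 2 * (k%:R * t) ^+ 2 = ((2 * e%:R) * k%:R * `|t|) ^+ 2.
    rewrite !exprMn real_normK ?num_real //; ring.
  by rewrite lerXn2r ?nnegrE ?mulr_ge0 // ler_wpM2r.
have s2 : (1 + n%:R * `|t|) ^+ 2 <= 2 + 2 * (n%:R * `|t|) ^+ 2.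
  by rewrite -subr_ge0; have := sqr_ge0 (1 - n%:R * `|t|); lra.
have e2 : 0 <= e%:R ^+ 2 :> R by exact: exprn_ge0.
have := ler_wpM2l f0 s2; have := ler_wpM2l f0 nt; have := ler_wpM2l e2 fd.
move: s2 nt fd f1 f0 e2; set Z := (k%:R * t) ^+ 2; set Y := n%:R * `|t|.
set X := (1 + Y) ^+ 2; set E := e%:R ^+ 2; set Y2 := Y ^+ 2.
clearbody F Z Y X E Y2 => *; lra.
Qed.

End Kernel.

(** * A pointwise Bernstein inequality *)

Section Bernstein.
Variable R : realType.
Implicit Types (t x : R) (n k e : nat).

Definition grid M k : R := 2 * pi * k%:R / M%:R.

Lemma gridC M i k : i%:R * grid M k = k%:R * grid M i.
Proof. by rewrite /grid; ring. Qed.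

(** The sums of the [M]-th roots of unity to the power [i], by the geometric sum. *)
Lemma grid_sums M i : (0 < i < M)%N ->
  \sum_(k < M) cos (i%:R * grid M k) = 0 /\ \sum_(k < M) sin (i%:R * grid M k) = 0.
Proof.
move=> /andP[i0 iM]; have M0 : (0 < M)%N by exact: leq_trans iM.
set t := grid M i.
have -> : \sum_(k < M) cos (i%:R * grid M k) = csum M t.
  by apply: eq_bigr => k _; rewrite gridC.
have -> : \sum_(k < M) sin (i%:R * grid M k) = ssum M t.
  by apply: eq_bigr => k _; rewrite gridC.
have := geometric_sqr M t.
have -> : M%:R * t = (pi *+ 2) *+ i.
  rewrite /t /grid mulrC divfK ?pnatr_eq0 -?lt0n //.
  by rewrite -[RHS]mulr_natr -[pi *+ 2]mulr_natr; ring.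
have -> : cos ((pi *+ 2) *+ i) = 1 :> R.
  by have := periodicn (@cosD2pi R) i 0; rewrite add0r cos0.
rewrite subrr => /eqP; rewrite mulf_eq0 => /orP[|]; last first.
  rewrite one_sub_cosE mulf_eq0 pnatr_eq0 /= expf_eq0 /= => /eqP st.
  have : 0 < sin (t / 2).
    apply: sin_gt0_pi; rewrite /t /grid.
    have p0 := pi_gt0 R.
    have -> : 2 * pi * i%:R / M%:R / 2 = pi * (i%:R / M%:R) :> R by field; rewrite pnatr_eq0 -lt0n.
    by rewrite mulr_gt0 ?divr_gt0 ?ltr0n //= gtr_pMr // ltr_pdivrMr ?ltr0n // mul1r ltr_nat.
  by rewrite st ltxx.
rewrite paddr_eq0 ?sqr_ge0 // !expf_eq0 /= => /andP[/eqP -> /eqP ->].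
by [].
Qed.

Lemma cos_grid_sum M i : (i < M)%N ->
  \sum_(k < M) cos (i%:R * grid M k) = M%:R *+ (i == 0%N).
Proof.
case: i => [|i] iM; last by rewrite (grid_sums _).1.
rewrite (eq_bigr (fun=> 1)) => [|k _]; last by rewrite mul0r cos0.
by rewrite sumr_const card_ord eqxx mulr1n.
Qed.

Lemma sin_grid_sum M i : (i < M)%N -> \sum_(k < M) sin (i%:R * grid M k) = 0.
Proof.
case: i => [|i] iM; last by rewrite (grid_sums _).2.
by rewrite big1 // => k _; rewrite mul0r sin0.
Qed.

Lemma sin_sin_grid M j l : (0 < l)%N -> (j + l < M)%N ->
  \sum_(k < M) sin (j%:R * grid M k) * sin (l%:R * grid M k) = (M%:R / 2) *+ (l == j).
Proof.
move=> l0 jlM.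
wlog jl : j l l0 jlM / (l <= j)%N => [H|].
  have [/H|] := leqP l j; first exact.
  case: j jlM => [|j] jlM jl.
    by rewrite big1 ?gtn_eqF // => k _; rewrite mul0r sin0 mul0r.
  rewrite eq_sym -H ?(ltnW jl) // 1?addnC //.
  by apply: eq_bigr => k _; rewrite mulrC.
have E (t : R) : sin (j%:R * t) * sin (l%:R * t) =
    2^-1 * cos ((j - l)%N%:R * t) - 2^-1 * cos ((j + l)%N%:R * t).
  by rewrite natrB // natrD mulrBl mulrDl cosB cosD; field.
rewrite (eq_bigr (fun k : 'I_M => 2^-1 * cos ((j - l)%N%:R * grid M k) -
   2^-1 * cos ((j + l)%N%:R * grid M k))) => [|k _]; last exact: E.
rewrite sumrB -!mulr_sumr !cos_grid_sum //; last first.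
  by rewrite (leq_ltn_trans _ jlM) // (leq_trans (leq_subr _ _)) // leq_addr.
have -> : (j + l == 0)%N = false by rewrite addn_eq0 andbC; case: (l) l0.
have -> : (j - l == 0)%N = (l == j) by rewrite subn_eq0 eqn_leq jl.
by case: (l == j); rewrite ?mulr1n ?mulr0n ?mulr0 ?subr0 // mulrC.
Qed.

Lemma cos_sin_grid M j l : (j + l < M)%N ->
  \sum_(k < M) cos (j%:R * grid M k) * sin (l%:R * grid M k) = 0.
Proof.
move=> jlM.
have jM : (j - l < M)%N.
  by rewrite (leq_ltn_trans _ jlM) // (leq_trans (leq_subr _ _)) // leq_addr.
have lM : (l - j < M)%N.
  by rewrite (leq_ltn_trans _ jlM) // (leq_trans (leq_subr _ _)) // leq_addl.
have [jl|/ltnW jl] := leqP l j.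
  rewrite (eq_bigr (fun k : 'I_M => 2^-1 * sin ((j + l)%N%:R * grid M k) -
   2^-1 * sin ((j - l)%N%:R * grid M k))) => [|k _].
    by rewrite sumrB -!mulr_sumr !sin_grid_sum // mulr0 subrr.
  by rewrite natrB // natrD mulrBl mulrDl sinB sinD; field.
rewrite (eq_bigr (fun k : 'I_M => 2^-1 * sin ((j + l)%N%:R * grid M k) +
   2^-1 * sin ((l - j)%N%:R * grid M k))) => [|k _].
  by rewrite big_split /= -!mulr_sumr !sin_grid_sum // mulr0 addr0.
by rewrite natrB // natrD mulrBl mulrDl sinB sinD; field.
Qed.

(** Up to the factor [-2], the derivative of the Dirichlet kernel of degree [G]. *)
Definition dsum G t : R := \sum_(l < G.+1) l%:R * sin (l%:R * t).

(** Differentiation is convolution with the derivative of the Dirichlet kernel, and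
    the convolution integral is computed exactly by the average over [M > 2 G]
    equidistant points. *)
Lemma deriv0_formula G M (g : R -> R) : (2 * G < M)%N -> trig_polynomial G g ->
  derive1 g 0 = 2 / M%:R * \sum_(k < M) g (grid M k) * dsum G (grid M k).
Proof.
move=> GM tg.
have M0 : (M%:R : R) != 0 by rewrite pnatr_eq0 -lt0n (leq_ltn_trans _ GM).
suff : trig_polynomial G g /\ derive1 g 0 = 2 / M%:R * \sum_(k < M) g (grid M k) * dsum G (grid M k) by case.
move: g tg; apply: trig_ind.
- move=> j jG; split; first exact: trig_cos.
  have -> : derive1 (fun t => cos (j%:R * t)) 0 = 0 :> R.
    rewrite derive1E; apply: derive_val.
    apply: is_derive_eq; rewrite mulr0 sin0 /GRing.scale /=; ring.
  rewrite (eq_bigr (fun k : 'I_M => \sum_(l < G.+1) l%:R *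
     (cos (j%:R * grid M k) * sin (l%:R * grid M k)))) => [|k _]; last first.
    by rewrite /dsum mulr_sumr; apply: eq_bigr => l _; ring.
  rewrite exchange_big /= big1 ?mulr0 // => l _.
  rewrite -mulr_sumr cos_sin_grid ?mulr0 //.
  by rewrite (leq_ltn_trans _ GM) // mul2n -addnn leq_add // -ltnS.
- move=> j jG; split; first exact: trig_sin.
  have -> : derive1 (fun t => sin (j%:R * t)) 0 = j%:R :> R.
    rewrite derive1E; apply: derive_val.
    apply: is_derive_eq; rewrite mulr0 cos0 /GRing.scale /=; ring.
  rewrite (eq_bigr (fun k : 'I_M => \sum_(l < G.+1) l%:R *
     (sin (j%:R * grid M k) * sin (l%:R * grid M k)))) => [|k _]; last first.
    by rewrite /dsum mulr_sumr; apply: eq_bigr => l _; ring.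
  rewrite exchange_big /=.
  rewrite (eq_bigr (fun l : 'I_G.+1 => if l == inord j then j%:R * (M%:R / 2) else 0)).
    by rewrite -big_mkcond big_pred1_eq; field.
  move=> l _; rewrite -mulr_sumr.
  have lj : (l == inord j) = (l == j :> nat) by rewrite -val_eqE /= inordK.
  case: (posnP l) => [l0|l0].
    rewrite lj l0 mul0r; case: eqP => // <-; by rewrite mul0r.
  rewrite sin_sin_grid //; last first.
    by rewrite (leq_ltn_trans _ GM) // mul2n -addnn leq_add // -ltnS.
  by rewrite lj; case: eqP => [->|]; rewrite ?mulr1n ?mulr0n ?mulr0.
- move=> c f g [tf Hf] [tg Hg]; split; first exact: trig_lin.
  rewrite (trig_deriv_lin c tf tg) Hf Hg.
  rewrite [in RHS](eq_bigr (fun k : 'I_M => c * (f (grid M k) * dsum G (grid M k)) +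
     g (grid M k) * dsum G (grid M k))) => [|k _]; last by ring.
  by rewrite big_split /= -mulr_sumr; ring.
Qed.

Lemma dsum_le G t : `|dsum G t| <= (G%:R * (G%:R + 1)) / 2.
Proof.
rewrite /dsum; elim: G => [|G IH].
  by rewrite big_ord_recr big_ord0 /= !mul0r addr0 normr0.
rewrite big_ord_recr /=; apply: le_trans (ler_normD _ _) _.
have h : `|G.+1%:R * sin (G.+1%:R * t)| <= G.+1%:R.
  rewrite normrM [`|G.+1%:R|]ger0_norm // -[leRHS]mulr1 ler_wpM2l //.
  exact: sin_max.
apply: le_trans (lerD IH h) _; rewrite -[G.+1%:R]natr1; lra.
Qed.

(** The formula for the derivative at 0 is applied to [q (x + t) * jackson n e t].
    As the kernel is even and equal to 1 at 0, this product has derivative [q' x],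
    and the crude bound [O (n ^ 2)] on [dsum] is compensated by the decay of the
    kernel on the grid. *)
Lemma bernstein_pointwise n e (q : R -> R) x : (0 < n)%N -> (0 < e)%N ->
  trig_polynomial n q ->
  `|derive1 q x| <= 2 * n%:R *
    \sum_(k < 5 * n) jackson n e (grid (5 * n) k) * `|q (x + grid (5 * n) k)|.
Proof.
move=> n0 e0 tq.
pose g t := q (t + x) * jackson n e t.
have tb := jackson_trig R n e.
have tqx := trig_translate x tq.
have tg : trig_polynomial (2 * n) g.
  by apply: trig_le (trig_mul tqx tb); rewrite mul2n -addnn leq_add2l leq_pred.
(* The kernel is even. *)
have db : derive1 (jackson n e : R -> R) 0 = 0.
  have [_ /(_ 0) d0] := trig_deriv tb.
  have dn : is_derive (0 : R) (1 : R) (jackson n e : R -> R) (- derive1 (jackson n e : R -> R) 0).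
    have d0' : is_derive (- 0 : R) (1 : R) (jackson n e : R -> R) (derive1 (jackson n e : R -> R) 0).
      by rewrite oppr0.
    have E : (jackson n e : R -> R) = (jackson n e : R -> R) \o -%R.
      by apply/funext => t /=; rewrite jacksonN.
    rewrite [X in is_derive _ _ X _]E -mulrN1.
    exact: is_derive1_comp d0' (is_deriveNid _ _).
  have : derive1 (jackson n e : R -> R) 0 = - derive1 (jackson n e : R -> R) 0.
    by rewrite {1}derive1E; exact: derive_val.
  lra.
have dg : derive1 g 0 = derive1 q x.
  have [_ /(_ x) d1] := trig_deriv tq.
  have [_ /(_ 0) d2] := trig_deriv tb.
  have d1' : is_derive (0 : R) (1 : R) (fun t => q (t + x)) (derive1 q x).
    have -> : (fun t => q (t + x)) = q \o (fun t => t + x) by [].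
    have d1'' : is_derive (0 + x : R) (1 : R) q (derive1 q x) by rewrite add0r.
    by apply: is_derive_eq; rewrite /GRing.scale /=; ring.
  rewrite derive1E; apply: derive_val.
  by apply: is_derive_eq; rewrite db jackson0 /GRing.scale /=; ring.
have M5 : (2 * (2 * n) < 5 * n)%N by rewrite mulnA ltn_pmul2r.
rewrite -dg (deriv0_formula M5 tg) normrM ger0_norm ?divr_ge0 //.
apply: le_trans (_ : 2 / (5 * n)%:R * \sum_(k < 5 * n)
    (jackson n e (grid (5 * n) k) * `|q (x + grid (5 * n) k)| * (n%:R * (2 * n%:R + 1))) <= _).
  rewrite ler_wpM2l ?divr_ge0 //; apply: le_trans (ler_norm_sum _ _ _) _.
  apply: ler_sum => k _; rewrite !normrM addrC [`|jackson _ _ _|]ger0_norm ?jackson_ge0 //.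
  rewrite [`|q _| * _]mulrC; apply: ler_wpM2l; first by rewrite mulr_ge0 ?jackson_ge0.
  apply: le_trans (dsum_le _ _) _; rewrite natrM; lra.
rewrite -mulr_suml mulrCA [leRHS]mulrC; apply: ler_wpM2l.
  by apply: sumr_ge0 => k _; rewrite mulr_ge0 ?jackson_ge0.
have n1 : (1 : R) <= n%:R by rewrite ler1n.
rewrite natrM mulrAC ler_pdivrMr; last by rewrite mulr_gt0 //; lra.
have := mulr_ge0 (ler0n R n) (ler0n R n).
have : n%:R * 1 <= n%:R * n%:R :> R by rewrite ler_wpM2l.
lra.
Qed.

End Bernstein.

(** * Bernstein's inequality for doubling weights *)

Section SupNorm.
Variable R : realType.
Implicit Types (f : R -> R) (a b : R).

Definition sup_on f a b : R := sup [set `|f x| | x in `[a, b]].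

Lemma le_sup_on f a b x : continuous f -> a <= x <= b -> `|f x| <= sup_on f a b.
Proof.
move=> cf xab; apply: ub_le_sup; last by exists x => //=; rewrite in_itv.
have [M _ fM] := continuous_le_itv a b cf.
by exists M => _ [y + <-]; rewrite /= in_itv => /fM.
Qed.

Lemma sup_on_le f a b M : a <= b -> (forall x, a <= x <= b -> `|f x| <= M) ->
  sup_on f a b <= M.
Proof.
move=> ab fM; apply: ge_sup; first by exists `|f a|, a => //=; rewrite in_itv /= lexx.
by move=> _ [y + <-]; rewrite /= in_itv => /fM.
Qed.

Lemma sup_on_ge0 f a b : continuous f -> a <= b -> 0 <= sup_on f a b.
Proof.
by move=> cf ab; apply: le_trans (normr_ge0 (f a)) _; apply: le_sup_on; rewrite ?lexx.
Qed.

End SupNorm.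

Section Sums.
Variable R : realType.

Lemma sum_inv_sqr M : \sum_(k < M) ((1 + k%:R) ^+ 2)^-1 <= 2 :> R.
Proof.
have H m : \sum_(k < m.+1) ((1 + k%:R) ^+ 2)^-1 <= 2 - (m.+1%:R)^-1 :> R.
  elim: m => [|m IH]; first by rewrite big_ord_recr big_ord0 /= add0r addr0 expr1n invr1; lra.
  rewrite big_ord_recr /=; apply: le_trans (lerD IH (lexx _)) _.
  have -> : m.+2%:R = m.+1%:R + 1 :> R by rewrite natr1.
  set x : R := m.+1%:R; have x0 : 0 < x by rewrite ltr0n.
  have -> : 2 - x^-1 + ((1 + x) ^+ 2)^-1 = 2 - (x + 1)^-1 - (x * (1 + x) ^+ 2)^-1.
    by field; rewrite !gt_eqF //; lra.
  by rewrite gerBl invr_ge0 mulr_ge0 ?exprn_ge0 //; lra.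
case: M => [|m]; first by rewrite big_ord0.
by apply: le_trans (H m) _; rewrite gerBl invr_ge0.
Qed.

Lemma sum_inv_sqr_rev M : \sum_(k < M) ((1 + (M - k)%:R) ^+ 2)^-1 <= 2 :> R.
Proof.
apply: le_trans (sum_inv_sqr M); rewrite (reindex_inj rev_ord_inj) /=.
apply: ler_sum => k _; rewrite lef_pV2 ?posrE ?exprn_gt0 //; try by rewrite ltr_pwDl.
rewrite lerXn2r ?nnegrE ?addr_ge0 // lerD2l ler_nat.
by rewrite subKn.
Qed.

(** This replaces translation of the circle in sums over its pieces. *)
Lemma sum_periodic_shift (F : nat -> R) n i : (forall j, F (j + n)%N = F j) ->
  \sum_(j < n) F (j + i)%N = \sum_(j < n) F j.
Proof.
move=> Fn; elim: i => [|i IH]; first by apply: eq_bigr => j _; rewrite addn0.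
rewrite -IH; case: n Fn {IH} => [|n] Fn; first by rewrite !big_ord0.
rewrite big_ord_recr [in RHS]big_ord_recl /= addrC; congr (_ + _).
  by rewrite add0n -[in RHS]Fn addnS -addSn addnC.
by apply: eq_bigr => j _; rewrite /= addnS addSn.
Qed.

Lemma sum_nested (F : nat -> R) n m :
  \sum_(i < n * m) F i = \sum_(j < n) \sum_(r < m) F (j * m + r)%N.
Proof.
elim: n => [|n IH]; first by rewrite mul0n !big_ord0.
rewrite big_ord_recr /= -IH mulSn addnC.
rewrite -(big_mkord xpredT F) (big_cat_nat _ (leq_addr _ _)) //= big_mkord; congr (_ + _).
have -> : \sum_(n * m <= i < n * m + m) F i = \sum_(0 <= r < m) F (r + n * m)%N.
  by have := big_addn 0 (n * m + m) (n * m) xpredT F; rewrite add0n addKn.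
by rewrite big_mkord; apply: eq_bigr => r _; rewrite addnC.
Qed.

Lemma partition_cover (a l x : R) m : (0 < m)%N -> a <= x <= a + m%:R * l ->
  exists2 r, (r < m)%N & a + r%:R * l <= x <= a + r.+1%:R * l.
Proof.
case: m => // m _; elim: m => [|m IH] /andP[x1 x2].
  by exists 0%N => //; rewrite mul0r addr0 x1.
have [h|/ltW h] := leP x (a + m.+1%:R * l).
  have [|r rm rx] := IH; first by rewrite x1.
  by exists r => //; exact: ltnW.
by exists m.+1 => //; rewrite h.
Qed.

End Sums.

Section Pieces.
Variables (R : realType) (s : nat) (W : R -> R).
Hypothesis W_weight : periodic_weight W.
Hypothesis W_doubling : doubling (2 ^+ s) W.
Local Notation mass := (interval_mass W).

Lemma mass_compare (a b c d x : R) : a < b -> 1 <= x ->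
  (a + b) / 2 - x * ((b - a) / 2) <= c -> d <= (a + b) / 2 + x * ((b - a) / 2) ->
  mass c d <= (2 * x) ^+ s * mass a b.
Proof.
move=> ab x1 hc hd; apply: le_trans (mass_le W_weight W_doubling hc hd) _.
have r0 : 0 < (b - a) / 2 by lra.
have := mass_growth W_weight W_doubling ((a + b) / 2) r0 x1.
have -> : (a + b) / 2 - (b - a) / 2 = a by field.
by have -> : (a + b) / 2 + (b - a) / 2 = b by field.
Qed.

Definition pt (h : R) (j : nat) : R := - pi + j%:R * h.
Definition piece_mass (h : R) (j : nat) : R := mass (pt h j) (pt h j.+1).

Lemma ptS h j : pt h j.+1 = pt h j + h.
Proof. by rewrite /pt -[j.+1%:R]natr1; ring. Qed.

Lemma pt_le h i j : 0 <= h -> (i <= j)%N -> pt h i <= pt h j.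
Proof. by move=> h0 ij; rewrite lerD2l ler_wpM2r // ler_nat. Qed.

Lemma wt_ge0 h j : 0 <= piece_mass h j.
Proof. exact: (mass_ge0 W_weight). Qed.

Lemma piece_growth h i j d : 0 < h -> (i <= j + d)%N -> (j <= i + d)%N ->
  piece_mass h j <= (2 * (2 * d%:R + 1)) ^+ s * piece_mass h i.
Proof.
move=> h0 ij ji.
have ij' : i%:R <= j%:R + d%:R :> R by rewrite -natrD ler_nat.
have ji' : j%:R <= i%:R + d%:R :> R by rewrite -natrD ler_nat.
have := ler_wpM2r (ltW h0) ij'; have := ler_wpM2r (ltW h0) ji'.
by move=> h1 h2; apply: mass_compare; rewrite ?ptS /pt; lra.
Qed.

Lemma wt_periodic n j : (0 < n)%N -> piece_mass (2 * pi / n%:R) (j + n) = piece_mass (2 * pi / n%:R) j.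
Proof.
move=> n0; have n1 : n%:R != 0 :> R by rewrite pnatr_eq0 -lt0n.
have ptn i : pt (2 * pi / n%:R) (i + n) = pt (2 * pi / n%:R) i + 2 * pi.
  by rewrite /pt natrD mulrDl addrA [n%:R * _]mulrC divfK.
by rewrite /piece_mass -addSn !ptn (mass_shift W_weight).
Qed.

(** The factor [6 ^ s] comes from the growth between pieces and the power of [5 / 4]
    from [1 + k <= 5 / 4 * (1 + n * grid (5 * n) k)]; 16 is the product of the factor
    2 in the pointwise inequality, of the bound 4 for two convergent series, and of
    the 2 pieces met by a shifted piece. *)
Definition bern_const : R := 16 * (jackson_const R (s + 2) * (5 / 4) ^+ (2 * (s + 2)) * 6 ^+ s).

Lemma jackson_const_ge0 e : 0 <= jackson_const R e.
Proof. by rewrite exprn_ge0 // addr_ge0 // mulr_ge0 // exprn_ge0. Qed.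

Lemma bern_const_ge0 : 0 <= bern_const.
Proof. by rewrite !mulr_ge0 ?jackson_const_ge0 ?exprn_ge0. Qed.

Variable n : nat.
Hypothesis n0 : (0 < n)%N.
Let n_gt0 : 0 < n%:R :> R. Proof. by rewrite ltr0n. Qed.
Let H : R := 2 * pi / n%:R.
Let H0 : 0 < H. Proof. by rewrite divr_gt0 // mulr_gt0 // pi_gt0. Qed.
Let e := (s + 2)%N.

Let n_grid k : n%:R * grid R (5 * n) k = 2 * pi / 5 * k%:R.
Proof. by rewrite /grid natrM; field; rewrite pnatr_eq0 -lt0n. Qed.

Let ge45 (k : R) : 0 <= k -> 1 + k <= 5 / 4 * (1 + 2 * pi / 5 * k).
Proof. by move=> k0; have := ler_wpM2r k0 (pi_ge2 R); lra. Qed.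

(** Modulo the period, the distance of the [k]-th grid point to 0 is governed by [k] on
    the first half of the grid and by [5 n - k] on the second half. *)
Lemma jackson_grid_decay k : (k < 5 * n)%N ->
  exists2 y, (y = k \/ y = 5 * n - k)%N &
  jackson n e (grid R (5 * n) k) * (1 + y%:R) ^+ (2 * e) <=
    jackson_const R e * (5 / 4) ^+ (2 * e).
Proof.
move=> kn; have p0 := pi_gt0 R.
have g0 : 0 <= grid R (5 * n) k.
  by rewrite /grid divr_ge0 // mulr_ge0 // mulr_ge0 // ltW.
have e0 : (0 < e)%N by rewrite /e addn2.
have main (y : nat) u : `|u| <= pi -> n%:R * `|u| = 2 * pi / 5 * y%:R ->
    jackson n e u * (1 + y%:R) ^+ (2 * e) <= jackson_const R e * (5 / 4) ^+ (2 * e).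
  move=> upi nu; have := jackson_decay n0 e0 upi; rewrite nu => h.
  apply: le_trans (_ : jackson n e u * ((5 / 4) * (1 + 2 * pi / 5 * y%:R)) ^+ (2 * e) <= _).
    apply: ler_wpM2l; first exact: jackson_ge0.
    by rewrite lerXn2r ?nnegrE ?addr_ge0 // ?ge45 // mulr_ge0 // addr_ge0 // mulr_ge0 //; lra.
  rewrite exprMn mulrCA [leRHS]mulrC; apply: ler_wpM2l; last exact: h.
  by apply: exprn_ge0; lra.
have [up|/ltW pu] := leP (grid R (5 * n) k) pi.
  by exists k; [left | apply: main; rewrite ger0_norm // n_grid].
exists (5 * n - k)%N; first by right.
have -> : jackson n e (grid R (5 * n) k) = jackson n e (2 * pi - grid R (5 * n) k).
  rewrite -[RHS]jacksonN opprB; have := trig_periodic (jackson_trig R n e) (grid R (5 * n) k - 2 * pi).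
  by rewrite subrK.
have u2 : grid R (5 * n) k <= 2 * pi.
  rewrite /grid ler_pdivrMr ?ltr0n ?muln_gt0 //; apply: ler_wpM2l; first by rewrite mulr_ge0 // ltW.
  by rewrite ler_nat ltnW.
apply: main; rewrite ger0_norm ?subr_ge0 //; first lra.
by rewrite mulrBr n_grid natrB ?(ltnW kn) // natrM; field.
Qed.

(** The pieces [j] and [j + i] are about [i] steps apart in one direction of the circle
    and [n - i] steps in the other; [y] selects the relevant direction. *)
Lemma grid_growth k y i j : (k < 5 * n)%N -> (y = k \/ y = 5 * n - k)%N ->
  (k %/ 5 <= i <= (k %/ 5).+1)%N ->
  piece_mass H j <= (6 * (1 + y%:R)) ^+ s * piece_mass H (j + i).
Proof.
move=> kn yk /andP[i1 i2].
have k5 := leq_divM k 5.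
have k5' := ltn_ceil k (isT : (0 < 5)%N).
have fin d : piece_mass H j <= (2 * (2 * d%:R + 1)) ^+ s * piece_mass H (j + i) -> (d <= y.+1)%N ->
    (d <= 1 \/ d <= y)%N -> piece_mass H j <= (6 * (1 + y%:R)) ^+ s * piece_mass H (j + i).
  move=> h d1 d2; apply: le_trans h _; apply: ler_wpM2r; first exact: wt_ge0.
  rewrite lerXn2r ?nnegrE ?mulr_ge0 ?addr_ge0 ?mulr_ge0 //.
  have y0 : 0 <= y%:R :> R by [].
  case: d2; rewrite -(ler_nat R) => ?; lra.
have kd : (k %/ 5 < n)%N by rewrite ltn_divLR // mulnC.
move: kd k5 k5' i1 i2; set q := (k %/ 5)%N => kd k5 k5' i1 i2.
case: yk => yk.
  by apply: (fin q.+1); [apply: piece_growth => //; lia | lia | lia].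
apply: (fin y) => //; last by right.
by rewrite -(wt_periodic j n0); apply: piece_growth => //; lia.
Qed.

(** A substitute for the weighted [L^1] norm in which [|f|] is replaced by its
    maximum on each piece; unlike the integral it controls pointwise values. *)
Definition piece_sup_sum (h : R) (K : nat) (f : R -> R) : R :=
  \sum_(j < K) piece_mass h j * sup_on f (pt h j) (pt h j.+1).

Lemma pt_lt h j : 0 < h -> pt h j < pt h j.+1.
Proof. by move=> h0; rewrite ptS ltrDl. Qed.

Lemma pt_addn i : pt H (i + n) = pt H i + 2 * pi.
Proof. by rewrite /pt natrD mulrDl addrA [n%:R * _]mulrC divfK // gt_eqF. Qed.

Lemma sup_on_periodic (f : R -> R) j : continuous f -> (forall t, f (t + 2 * pi) = f t) ->
  sup_on f (pt H (j + n)) (pt H (j + n).+1) = sup_on f (pt H j) (pt H j.+1).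
Proof.
move=> cf pf; rewrite -addSn !pt_addn.
apply/eqP; rewrite eq_le; apply/andP; split.
  apply: sup_on_le => [|x /andP[x1 x2]]; first by rewrite lerD2r ltW // pt_lt.
  have := pf (x - 2 * pi); rewrite subrK => ->; apply: le_sup_on => //.
  by apply/andP; split; lra.
apply: sup_on_le => [|x /andP[x1 x2]]; first by rewrite ltW // pt_lt.
rewrite -pf; apply: le_sup_on => //; apply/andP; split; lra.
Qed.

Lemma grid_in_pieces x j k : pt H j <= x <= pt H j.+1 ->
  pt H (j + k %/ 5) <= x + grid R (5 * n) k <= pt H (j + (k %/ 5).+1).+1.
Proof.
move=> /andP[x1 x2].
have gE : grid R (5 * n) k = k%:R / 5 * H.
  by rewrite /H /grid natrM; field; rewrite gt_eqF.
have k1 : (k %/ 5)%:R <= k%:R / 5 :> R.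
  by rewrite ler_pdivlMr // -natrM ler_nat leq_divM.
have k2 : k%:R / 5 <= (k %/ 5).+1%:R :> R.
  by rewrite ler_pdivrMr // -natrM ler_nat ltnW // ltn_ceil.
have := ler_wpM2r (ltW H0) k1; have := ler_wpM2r (ltW H0) k2; rewrite -gE.
move: x1 x2; rewrite !ptS /pt !natrD -[(k %/ 5).+1%:R]natr1 => ? ? ? ?.
by apply/andP; split; lra.
Qed.

Lemma bernstein_piece (q : R -> R) j : trig_polynomial n q ->
  sup_on (derive1 q) (pt H j) (pt H j.+1) <= 2 * n%:R * \sum_(k < 5 * n)
    jackson n e (grid R (5 * n) k) *
      (sup_on q (pt H (j + k %/ 5)) (pt H (j + k %/ 5).+1) +
       sup_on q (pt H (j + (k %/ 5).+1)) (pt H (j + (k %/ 5).+1).+1)).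
Proof.
move=> tq; have cq := trig_continuous tq.
apply: sup_on_le => [|x xj]; first by rewrite ltW // pt_lt.
have e0 : (0 < e)%N by rewrite /e addn2.
apply: le_trans (bernstein_pointwise x n0 e0 tq) _.
rewrite ler_wpM2l ?mulr_ge0 //; apply: ler_sum => k _.
apply: ler_wpM2l; first exact: jackson_ge0.
have /andP[g1 g2] := grid_in_pieces k xj.
have s1 : 0 <= sup_on q (pt H (j + k %/ 5)) (pt H (j + k %/ 5).+1).
  by apply: sup_on_ge0 => //; rewrite ltW // pt_lt.
have s2 : 0 <= sup_on q (pt H (j + (k %/ 5).+1)) (pt H (j + (k %/ 5).+1).+1).
  by apply: sup_on_ge0 => //; rewrite ltW // pt_lt.
have [h|/ltW h] := leP (x + grid R (5 * n) k) (pt H (j + k %/ 5).+1).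
  by rewrite -[leLHS]addr0 lerD // le_sup_on // g1.
by rewrite -[leLHS]add0r lerD // le_sup_on // g2 andbT addnS.
Qed.

(** Decay of order [2 (s + 2)] against growth of order [s] leaves a summable
    factor. *)
Lemma jackson_growth k i j : (k < 5 * n)%N -> (k %/ 5 <= i <= (k %/ 5).+1)%N ->
  jackson n e (grid R (5 * n) k) * piece_mass H j <=
  bern_const / 16 * (((1 + k%:R) ^+ 2)^-1 + ((1 + (5 * n - k)%:R) ^+ 2)^-1) * piece_mass H (j + i).
Proof.
move=> kn ki; have [y yk Jy] := jackson_grid_decay kn.
have Gy := grid_growth j kn yk ki.
set B := jackson_const R e * _ in Jy.
have BE : bern_const / 16 = B * 6 ^+ s by rewrite /bern_const -/e -/B mulrAC mulfV ?mul1r.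
have B0 : 0 <= B by rewrite mulr_ge0 ?jackson_const_ge0 ?exprn_ge0.
have y1 : 0 < 1 + y%:R :> R by rewrite ltr_pwDl.
have y1' : 1 <= 1 + y%:R :> R by rewrite lerDl.
apply: le_trans (_ : B * 6 ^+ s * ((1 + y%:R) ^+ 2)^-1 * piece_mass H (j + i) <= _); last first.
  rewrite BE; apply: ler_wpM2r; first exact: wt_ge0.
  apply: ler_wpM2l; first by rewrite mulr_ge0 ?exprn_ge0.
  by case: yk => ->; rewrite ?lerDl ?lerDr invr_ge0 exprn_ge0 // addr_ge0.
have J0 := jackson_ge0 n e (grid R (5 * n) k).
have w0 : 0 <= piece_mass H (j + i) by exact: wt_ge0.
apply: le_trans (ler_wpM2l J0 Gy) _; rewrite mulrA; apply: ler_wpM2r => //.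
rewrite ler_pdivlMr ?exprn_gt0 // exprMn.
have -> : jackson n e (grid R (5 * n) k) * (6 ^+ s * (1 + y%:R) ^+ s) * (1 + y%:R) ^+ 2 =
  jackson n e (grid R (5 * n) k) * (1 + y%:R) ^+ (s + 2) * 6 ^+ s by rewrite exprD; ring.
apply: ler_wpM2r; first exact: exprn_ge0.
apply: le_trans Jy; apply: ler_wpM2l => //.
by apply: ler_weXn2l => //; rewrite -/e leq_pmull.
Qed.

(** Summing the pointwise inequality over the pieces, exchanging the sums, and
    moving each shifted piece back to its place at the cost of a growth factor. *)
Lemma bernstein_wsum (q : R -> R) : trig_polynomial n q ->
  piece_sup_sum H n (derive1 q) <= bern_const * n%:R * piece_sup_sum H n q.
Proof.
move=> tq; have cq := trig_continuous tq; have pq := trig_periodic tq.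
pose F j := piece_mass H j * sup_on q (pt H j) (pt H j.+1).
have Fn j : F (j + n)%N = F j by rewrite /F /H wt_periodic // sup_on_periodic.
pose c k : R := bern_const / 16 * (((1 + k%:R) ^+ 2)^-1 + ((1 + (5 * n - k)%:R) ^+ 2)^-1).
have g0 j : 0 <= sup_on q (pt H j) (pt H j.+1) by apply: sup_on_ge0 => //; rewrite ltW // pt_lt.
apply: le_trans (_ : \sum_(j < n) 2 * n%:R * \sum_(k < 5 * n)
   c k * (F (j + k %/ 5)%N + F (j + (k %/ 5).+1)%N) <= _).
  apply: ler_sum => j _; apply: le_trans (ler_wpM2l (wt_ge0 _ _) (bernstein_piece _ tq)) _.
  rewrite mulrCA; apply: ler_wpM2l; first by rewrite mulr_ge0.
  rewrite mulr_sumr; apply: ler_sum => k _.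
  rewrite mulrCA !mulrDr [_ * (piece_mass _ _ * _)]mulrA [_ * (piece_mass _ _ * sup_on q _ (pt H (j + (k %/ 5).+1).+1))]mulrA.
  rewrite /F !mulrA; apply: lerD; apply: ler_wpM2r => //; apply: jackson_growth => //;
  by rewrite leqnn ?leqnSn.
rewrite -mulr_sumr exchange_big /=.
have -> : \sum_(k < 5 * n) \sum_(j < n) c k * (F (j + k %/ 5)%N + F (j + (k %/ 5).+1)%N) =
    (\sum_(k < 5 * n) c k) * (2 * piece_sup_sum H n q).
  rewrite mulr_suml; apply: eq_bigr => k _; rewrite -mulr_sumr big_split /=.
  by rewrite !sum_periodic_shift // /piece_sup_sum -/F; congr (_ * _); rewrite mulr2n mulrDl mul1r.
have Y0 : 0 <= piece_sup_sum H n q by apply: sumr_ge0 => j _; rewrite mulr_ge0 ?wt_ge0.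
have sc : \sum_(k < 5 * n) c k <= bern_const / 16 * 4.
  rewrite /c -mulr_sumr; apply: ler_wpM2l; first by rewrite divr_ge0 // bern_const_ge0.
  rewrite big_split /=; have := sum_inv_sqr R (5 * n); have := sum_inv_sqr_rev R (5 * n); lra.
have : (\sum_(k < 5 * n) c k) * (2 * piece_sup_sum H n q) <= bern_const / 16 * 4 * (2 * piece_sup_sum H n q).
  by apply: ler_wpM2r => //; rewrite mulr_ge0.
move=> h; have n2 : 0 <= 2 * n%:R :> R by rewrite mulr_ge0.
by apply: le_trans (ler_wpM2l n2 h) _; rewrite le_eqVlt; apply/orP; left; apply/eqP; field.
Qed.

End Pieces.

(** * Two tools: norm-preserving extension and interpolation *)

Section HahnBanach.
Variables (R : realType) (X : Type) (T : set (X -> R)).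

Definition linear_on (E : (X -> R) -> R) := forall c p q, T p -> T q ->
  E (fun t => c * p t + q t) = c * E p + E q.

Hypothesis T_lin : forall c p q, T p -> T q -> T (fun t => c * p t + q t).

Lemma scale_on c p : T p -> T (fun t => c * p t) /\
  forall E, linear_on E -> E (fun t => c * p t) = c * E p.
Proof.
move=> Tp; have -> : (fun t => c * p t) = (fun t => (c - 1) * p t + p t).
  by apply/funext => t; ring.
split; first exact: T_lin.
by move=> E lE; rewrite lE //; ring.
Qed.

(** Hahn-Banach for a functional on a space of functions, dominated by an [l^1]
    norm pulled back along [g_0, ..., g_(N-1)], in terms of the representing
    vector [u].  The coordinates of [u] are chosen one at a time: the last one is
    the supremum of the lower constraints, which stay below the upper constraints
    because the domination inequality holds for differences. *)
Lemma hahn_banach_l1 (B : R) (g : nat -> (X -> R) -> R) (N : nat) (E : (X -> R) -> R) :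
  0 <= B -> linear_on E -> (forall i, linear_on (g i)) ->
  (forall p, T p -> `|E p| <= B * \sum_(i < N) `|g i p|) ->
  exists2 u : nat -> R, forall i, `|u i| <= B &
    forall p, T p -> E p = \sum_(i < N) u i * g i p.
Proof.
move=> B0 + lg; elim: N E => [|N IH] E lE EB.
  exists (fun=> 0) => [i|p Tp]; first by rewrite normr0.
  rewrite big_ord0; apply/eqP; rewrite -normr_le0.
  by have := EB p Tp; rewrite big_ord0 mulr0.
pose S p := B * \sum_(i < N) `|g i p|.
have EB' p : T p -> `|E p| <= S p + B * `|g N p|.
  by move=> /EB; rewrite big_ord_recr /= mulrDr.
have Ssub p q : T p -> T q -> S (fun t => -1 * p t + q t) <= S p + S q.
  move=> Tp Tq; rewrite /S -mulrDr ler_wpM2l // -big_split /=.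
  apply: ler_sum => i _; rewrite lg // mulN1r.
  by apply: le_trans (ler_normD _ _) _; rewrite normrN.
have Sscale c p : T p -> S (fun t => c * p t) = `|c| * S p.
  move=> Tp; rewrite /S mulrCA; congr (_ * _); rewrite mulr_sumr.
  by apply: eq_bigr => i _; rewrite ((scale_on c Tp).2 _ (lg i)) normrM.
(* The element [- B] keeps [A] nonempty when [g N] never takes the value 1. *)
pose A := [set a | a = - B \/ exists2 p, T p /\ g N p = 1 & a = E p - S p].
have AB a : A a -> a <= B.
  move=> [->|[p [Tp gp] ->]]; first lra.
  by have := EB' p Tp; rewrite gp normr1 ler_norml => /andP[_]; lra.
have Asup : has_sup A by split; [exists (- B); left | exists B => a /AB].
pose u := sup A.
have uB : `|u| <= B.
  rewrite ler_norml; apply/andP; split; last exact: ge_sup Asup.1 AB.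
  by apply: ub_le_sup Asup.2 _ _; left.
have u_lo p : T p -> g N p = 1 -> E p - S p <= u.
  by move=> Tp gp; apply: ub_le_sup Asup.2 _ _; right; exists p.
have u_hi p : T p -> g N p = 1 -> u <= E p + S p.
  move=> Tp gp; apply: ge_sup Asup.1 _ => a [->|[q [Tq gq] ->]].
    by have := EB' p Tp; rewrite gp normr1 ler_norml => /andP[+ _]; lra.
  have Tqp := T_lin (-1) Tp Tq.
  have := EB' _ Tqp; rewrite lE // lg // gp gq !mulN1r addNr normr0 mulr0 addr0.
  have := Ssub p q Tp Tq; rewrite ler_norml => h1 /andP[_ h2]; lra.
have [||u' u'B u'E] := IH (fun p => E p - u * g N p).
- by move=> c p q Tp Tq; rewrite lE // lg //; ring.
- move=> p Tp; rewrite -/(S p).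
  have [g0|gn0] := eqVneq (g N p) 0.
    by have := EB' p Tp; rewrite g0 normr0 !mulr0 addr0 subr0.
  have [Tp1 p1E] := scale_on (g N p)^-1 Tp.
  have g1 : g N (fun t => (g N p)^-1 * p t) = 1 by rewrite (p1E _ (lg N)) mulVf.
  have lo := u_lo _ Tp1 g1; have hi := u_hi _ Tp1 g1.
  have : `|E (fun t => (g N p)^-1 * p t) - u| <= S (fun t => (g N p)^-1 * p t).
    by rewrite ler_norml; apply/andP; split; lra.
  rewrite (p1E _ lE) Sscale // => h.
  have -> : E p - u * g N p = g N p * ((g N p)^-1 * E p - u) by rewrite mulrBr mulVKf // [u * _]mulrC.
  rewrite normrM; apply: le_trans (ler_wpM2l (normr_ge0 _) h) _.
  by rewrite normfV mulVKf // normr_eq0.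
exists (fun i => if i == N then u else u' i) => [i|p Tp]; first by case: eqP.
rewrite big_ord_recr /= eqxx.
have -> : E p = (E p - u * g N p) + u * g N p by ring.
rewrite u'E //; congr (_ + _); apply: eq_bigr => i _.
by rewrite ifN // neq_ltn ltn_ord.
Qed.

End HahnBanach.

Section Interpolation.
Variable R : realType.

(** Induction on [d].  By the mean value theorem, two consecutive points of a pair
    enclose a point where [|f']| is at most [2 eta / (sig * ell)]; the pairs
    [(y_0, y_1), (y_2, y_3), ...] thus yield half as many points for [f'], with the
    same separation, since whole gaps lie between them. *)
Lemma interpolation_bound (sig : R) (d : nat) : 0 < sig ->
  exists2 C : R, 0 <= C &
  forall (ell : R) (f : nat -> R -> R) (a : R) (y : nat -> R) (eta D : R),
    0 < ell ->
    (forall k x, is_derive x (1 : R) (f k) (f k.+1 x)) ->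
    (forall l, (l < 2 ^ d)%N -> a <= y l <= a + ell) ->
    (forall l, (l.+1 < 2 ^ d)%N -> y l + sig * ell <= y l.+1) ->
    (forall l, (l < 2 ^ d)%N -> `|f 0%N (y l)| <= eta) ->
    (forall x, a <= x <= a + ell -> `|f d x| <= D) ->
    forall x, a <= x <= a + ell -> `|f 0%N x| <= C * eta + ell ^+ d * D.
Proof.
move=> sig0; elim: d => [|d [C C0 IH]].
  exists 0 => // ell f a y eta D ell0 df yI ysep fy fD x /fD.
  by rewrite mul0r add0r expr0 mul1r.
exists (1 + 2 * C / sig) => [|ell f a y eta D ell0 df yI ysep fy fD x xI].
  by rewrite addr_ge0 // divr_ge0 ?mulr_ge0 // ltW.
have fc k : continuous (f k).
  by move=> z; apply: differentiable_continuous; apply/derivable1_diffP; have [] := df k z.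
have eta0 : 0 <= eta by apply: le_trans (fy 0%N _); rewrite ?expn_gt0.
have pairs l : (l < 2 ^ d)%N -> exists z, y l.*2 <= z <= y l.*2.+1 /\
    `|f 1%N z| <= 2 * eta / (sig * ell).
  move=> ld; have l2 : (l.*2.+1 < 2 ^ d.+1)%N by rewrite expnS mul2n ltn_Sdouble.
  have sep := ysep _ l2.
  have se0 : 0 < sig * ell by exact: mulr_gt0.
  have lt : y l.*2 < y l.*2.+1 by lra.
  have [z zI] := @MVT R (f 0%N) (f 1%N) _ _ lt (fun w _ => df 0%N w)
    (continuous_subspaceT (fc 0%N)).
  move: zI; rewrite in_itv /= => /andP[z1 z2] E.
  exists z; split; first by rewrite !ltW.
  rewrite ler_pdivlMr //.
  apply: le_trans (_ : `|f 1%N z| * (y l.*2.+1 - y l.*2) <= _).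
    by rewrite ler_wpM2l //; lra.
  rewrite -[y l.*2.+1 - _]gtr0_norm ?subr_gt0 // -normrM -E.
  apply: le_trans (ler_normB _ _) _.
  have := fy _ l2; have := fy _ (ltnW l2); lra.
have /choice [z zP] : forall l, exists z, (l < 2 ^ d)%N -> y l.*2 <= z <= y l.*2.+1 /\
    `|f 1%N z| <= 2 * eta / (sig * ell).
  move=> l; case: (ltnP l (2 ^ d)) => [/pairs [z ?]|_]; last by exists 0.
  by exists z.
have f1 w : a <= w <= a + ell -> `|f 1%N w| <= C * (2 * eta / (sig * ell)) + ell ^+ d * D.
  apply: (IH ell (fun k => f k.+1) a z) => // [l ld|l ld|l ld].
  - have [/andP[z1 z2] _] := zP l ld.
    have l2 : (l.*2.+1 < 2 ^ d.+1)%N by rewrite expnS mul2n ltn_Sdouble.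
    have /andP[h1 _] := yI _ (ltnW l2); have /andP[_ h2] := yI _ l2.
    by rewrite (le_trans h1) // (le_trans z2).
  - have [/andP[_ z2] _] := zP l (ltnW ld).
    have [/andP[z1 _] _] := zP l.+1 ld.
    have l2 : (l.*2.+2 < 2 ^ d.+1)%N.
      by rewrite -doubleS expnS mul2n ltn_double.
    have := ysep _ l2; move: z1; rewrite doubleS; lra.
  - by have [] := zP l ld.
have y0I := yI 0%N; rewrite expn_gt0 /= in y0I; have {}y0I := y0I isT.
have fy0 := fy 0%N; rewrite expn_gt0 /= in fy0; have {}fy0 := fy0 isT.
set M := C * _ + _ in f1.
have M0 : 0 <= M by apply: le_trans (f1 a _) => //; rewrite lexx lerDl ltW.
have : `|f 0%N x - f 0%N (y 0%N)| <= M * ell.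
  move: xI y0I => /andP[x1 x2] /andP[y1 y2].
  have [yx|/ltW xy] := leP (y 0%N) x.
    have [c] := MVT_segment yx (fun w _ => df 0%N w) (continuous_subspaceT (fc 0%N)).
    rewrite in_itv /= => /andP[c1 c2] ->; rewrite normrM ler_pM //.
      by apply: f1; apply/andP; split; lra.
    by rewrite ger0_norm; lra.
  have [c] := MVT_segment xy (fun w _ => df 0%N w) (continuous_subspaceT (fc 0%N)).
  rewrite in_itv /= => /andP[c1 c2]; rewrite distrC => ->; rewrite normrM ler_pM //.
    by apply: f1; apply/andP; split; lra.
  by rewrite ger0_norm; lra.
have -> : M * ell = 2 * C / sig * eta + ell ^+ d.+1 * D.
  by rewrite /M exprS; field; rewrite !gt_eqF.
have := ler_normD (f 0%N x - f 0%N (y 0%N)) (f 0%N (y 0%N)); rewrite subrK.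
lra.
Qed.

End Interpolation.

(** * Refining the partition, and the quantile nodes *)

Section SumLemmas.
Variable R : realType.

Lemma min_le_average (v : nat -> R) i0 i1 : (i0 < i1)%N ->
  exists2 i, (i0 <= i < i1)%N & (i1 - i0)%:R * v i <= \sum_(i0 <= k < i1) v k.
Proof.
move=> lt; have [d ->] : exists d, i1 = (i0 + d.+1)%N by exists (i1 - i0.+1)%N; lia.
rewrite addKn {lt i1}; elim: d => [|d [i ii IH]].
  by exists i0; [lia | rewrite addn1 big_nat1 mul1r].
rewrite addnS big_nat_recr /=; last lia.
rewrite -[d.+2%:R]natr1 in IH *.
have [h|/ltW h] := leP (v i) (v (i0 + d.+1)%N).
  by exists i; [lia | rewrite mulrDl mul1r lerD].
exists (i0 + d.+1)%N; first lia.
rewrite mulrDl mul1r lerD // (le_trans _ IH) //.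
by rewrite ler_wpM2l // -natr1 addr_ge0.
Qed.

Lemma sum_odd_le (g : nat -> R) D : (forall r, 0 <= g r) ->
  \sum_(l < D) g (2 * l).+1 <= \sum_(r < (2 * D).+1) g r.
Proof.
move=> g0; elim: D => [|D IH]; first by rewrite big_ord0 sumr_ge0.
rewrite big_ord_recr /= mulnS !big_ord_recr /=.
have := g0 (2 + 2 * D)%N; have -> : (2 + 2 * D)%N = (2 * D).+2 by lia.
move: IH; rewrite !big_ord_recr /=; lra.
Qed.

Lemma sum_consecutive (v : nat -> R) (i : nat -> nat) K : i 0%N = 0%N ->
  (forall k, (k < K)%N -> (i k <= i k.+1)%N) ->
  \sum_(k < K) \sum_(i k <= j < i k.+1) v j = \sum_(j < i K) v j.
Proof.
move=> i0; elim: K => [|K IH] imono; first by rewrite i0 !big_ord0.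
rewrite big_ord_recr /= IH => [|k kK]; last exact/imono/ltnW.
by rewrite -!(big_mkord xpredT v) -big_cat_nat // imono.
Qed.

End SumLemmas.

Section Refinement.
Variables (R : realType) (s : nat) (W : R -> R).
Hypothesis W_weight : periodic_weight W.
Hypothesis W_doubling : doubling (2 ^+ s) W.
Local Notation mass := (interval_mass W).
Local Notation wt := (piece_mass W).
Local Notation wsum := (piece_sup_sum W).

Variables (h : R) (m : nat).
Hypothesis h0 : 0 < h.
Hypothesis m0 : (0 < m)%N.

Let m1 : 1 <= m%:R :> R. Proof. by rewrite ler1n. Qed.

Lemma pt_coarse j : pt (m%:R * h) j = pt h (j * m).
Proof. by rewrite /pt natrM mulrA. Qed.

Lemma wt_sum i k : \sum_(r < k) wt h (i + r) = mass (pt h i) (pt h (i + k)).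
Proof.
elim: k => [|k IH].
  rewrite big_ord0 addn0 /interval_mass /interval_integral set_itv1.
  apply/esym; have := mass_add W_weight W_doubling (lexx (pt h i)) (lexx (pt h i)).
  by rewrite /interval_mass /interval_integral set_itv1; lra.
rewrite big_ord_recr /= IH addnS; apply/esym/(mass_add W_weight W_doubling).
  by apply: pt_le; [exact: ltW | exact: leq_addr].
by apply: pt_le; [exact: ltW | exact: leqnSn].
Qed.

Lemma wt_coarse_le j r : (r < m)%N ->
  wt (m%:R * h) j <= (4 * m%:R) ^+ s * wt h (j * m + r).
Proof.
move=> rm; have -> : 4 * m%:R = 2 * (2 * m%:R) :> R by ring.
have r1 : r%:R + 1 <= m%:R :> R by rewrite natr1 ler_nat.
have r0 : 0 <= r%:R :> R by [].
set a := pt h (j * m + r).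
have aE : a = pt (m%:R * h) j + r%:R * h by rewrite /a pt_coarse /pt natrD mulrDl addrA.
have e2 : 2 * m%:R * ((a + h - a) / 2) = m%:R * h by rewrite addrAC subrr add0r; field.
have := ler_wpM2r (ltW h0) r1; have := ler_wpM2r (ltW h0) r0.
rewrite mulrDl mul1r mul0r => h1 h2; have h0' := h0; have m1' := m1.
apply: (mass_compare W_weight W_doubling); rewrite ?ptS -/a ?e2 ?aE; lra.
Qed.

Lemma wsum_refine_le (f : R -> R) n : continuous f ->
  wsum h (n * m) f <= wsum (m%:R * h) n f.
Proof.
move=> cf; rewrite /piece_sup_sum (sum_nested (fun i => wt h i * sup_on f (pt h i) (pt h i.+1))).
apply: ler_sum => j _.
have -> : wt (m%:R * h) j = \sum_(r < m) wt h (j * m + r).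
  by rewrite wt_sum /piece_mass !pt_coarse mulSn addnC.
rewrite mulr_suml; apply: ler_sum => r _.
rewrite ler_wpM2l ?(wt_ge0 W_weight) //; apply: sup_on_le => [|x /andP[x1 x2]].
  by rewrite ltW // pt_lt.
apply: le_sup_on => //; rewrite !pt_coarse; apply/andP; split.
  by apply: le_trans x1; apply: pt_le; [exact: ltW | exact: leq_addr].
by apply: le_trans x2 _; apply: pt_le; [exact: ltW | rewrite mulSn; have := ltn_ord r; lia].
Qed.

(** The maximum over a coarse piece is attained in one of its [m] parts, and the mass
    of that part is smaller by at most a factor [(4 m) ^ s]. *)
Lemma wsum_coarse_le (f : R -> R) n : continuous f ->
  wsum (m%:R * h) n f <= (4 * m%:R) ^+ s * wsum h (n * m) f.
Proof.
move=> cf; rewrite /piece_sup_sum (sum_nested (fun i => wt h i * sup_on f (pt h i) (pt h i.+1))).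
rewrite mulr_sumr; apply: ler_sum => j _.
apply: le_trans (_ : wt (m%:R * h) j *
    \sum_(r < m) sup_on f (pt h (j * m + r)) (pt h (j * m + r).+1) <= _).
  apply: ler_wpM2l; first exact: (wt_ge0 W_weight).
  apply: sup_on_le => [|x]; first by rewrite ltW // pt_lt // mulr_gt0 // ltr0n.
  rewrite ptS pt_coarse => /(partition_cover m0) [r rm /andP[x1 x2]].
  rewrite (bigD1 (Ordinal rm)) //=.
  apply: le_trans (_ : sup_on f (pt h (j * m + r)) (pt h (j * m + r).+1) <= _); last first.
    by rewrite lerDl; apply: sumr_ge0 => i _; apply: sup_on_ge0; rewrite // ltW // pt_lt.
  apply: le_sup_on => //; move: x1 x2; rewrite /pt -addnS !natrD !mulrDl => x1 x2.
  by apply/andP; split; lra.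
rewrite !mulr_sumr; apply: ler_sum => r _.
rewrite mulrA; apply: ler_wpM2r; last exact: wt_coarse_le.
by apply: sup_on_ge0; rewrite // ltW // pt_lt.
Qed.

End Refinement.

Section Nodes.
Variables (R : realType) (s : nat) (W : R -> R).
Hypothesis W_weight : periodic_weight W.
Hypothesis W_doubling : doubling (2 ^+ s) W.
Local Notation mass := (interval_mass W).
Local Notation T := (mass (- pi) pi).
Variable N : nat.
Hypothesis N0 : (0 < N)%N.

Let NR0 : 0 < N%:R :> R. Proof. by rewrite ltr0n. Qed.
Let T0 : 0 < T. Proof. exact: (total_mass_gt0 W_weight W_doubling). Qed.

(** Intermediate values of the continuous cumulative function. *)
Lemma quantile_exists : exists tau : nat -> R, forall i, (i <= N)%N ->
  - pi <= tau i <= pi /\ mass (- pi) (tau i) = i%:R * T / N%:R.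
Proof.
suff : forall i, exists t, (i <= N)%N -> - pi <= t <= pi /\ mass (- pi) t = i%:R * T / N%:R.
  by move=> /choice [tau tauP]; exists tau.
move=> i; case: (leqP i N) => iN; last by exists 0.
have pp : - pi <= pi :> R by have := pi_gt0 R; lra.
have c : {within `[- pi, pi], continuous (fun x : R => mass (- pi) x)}.
  by apply: continuous_subspaceT; exact: (continuous_cumulative W_weight W_doubling).
have m00 : mass (- pi) (- pi) = 0.
  by have := mass_add W_weight W_doubling (lexx (- pi : R)) (lexx _); lra.
have [|t] := @IVT R _ _ _ (i%:R * T / N%:R) pp c.
  rewrite m00 (min_idPl (ltW T0)) (max_idPr (ltW T0)) divr_ge0 ?mulr_ge0 // ?(ltW T0) //=.
  by rewrite ler_pdivrMr // mulrC ler_pM2l // ler_nat.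
by rewrite in_itv /= => ? ?; exists t.
Qed.

Variable theta : nat -> R.
Hypothesis theta_quantile : forall i, (i < N)%N ->
  - pi <= theta i <= pi /\ mass (- pi) (theta i) = i.+1%:R * T / N%:R.

(** When [theta_i] is the quantile of order [(i + 1) / N], this is the number of nodes
    in [[-pi, x]]. *)
Definition node_index (x : R) : nat := Num.truncn (N%:R * mass (- pi) x / T).

Lemma idx_ge0 x : 0 <= N%:R * mass (- pi) x / T.
Proof. by rewrite divr_ge0 ?mulr_ge0 ?(mass_ge0 W_weight). Qed.

Lemma idxNpi : node_index (- pi) = 0%N.
Proof.
rewrite /node_index; have -> : mass (- pi) (- pi) = 0.
  by have := mass_add W_weight W_doubling (lexx (- pi : R)) (lexx _); lra.
by rewrite mulr0 mul0r truncn0.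
Qed.

Lemma idx_pi : node_index pi = N.
Proof. by rewrite /node_index mulfK ?gt_eqF // natrK. Qed.

Lemma idx_le (a b : R) : a <= b -> (node_index a <= node_index b)%N.
Proof.
move=> ab; apply: le_truncn; rewrite ler_pM2r ?invr_gt0 // ler_pM2l //.
exact: (mass_le W_weight W_doubling).
Qed.

Let count_eq (a b : R) : - pi <= a -> a <= b ->
  N%:R * mass a b / T = N%:R * mass (- pi) b / T - N%:R * mass (- pi) a / T.
Proof.
move=> pa ab; rewrite (mass_add W_weight W_doubling pa ab); field.
by rewrite gt_eqF.
Qed.

(** Rounding costs at most one node, which is harmless when the interval carries at
    least the mass of two nodes. *)
Lemma idx_count_ge (a b : R) : - pi <= a -> a <= b -> 2 * T <= N%:R * mass a b ->
  N%:R * mass a b <= 2 * T * (node_index b - node_index a)%:R.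
Proof.
move=> pa ab big; have ceq := count_eq pa ab.
have /andP[b1 b2] := truncn_itv (idx_ge0 b); have /andP[a1 a2] := truncn_itv (idx_ge0 a).
have ii := idx_le ab; rewrite natrB //.
rewrite -/(node_index b) -[(node_index b).+1%:R]natr1 in b1 b2.
rewrite -/(node_index a) -[(node_index a).+1%:R]natr1 in a1 a2.
have z2 : 2 <= N%:R * mass a b / T by rewrite ler_pdivlMr.
have -> : N%:R * mass a b = (N%:R * mass a b / T) * T by rewrite divfK // gt_eqF.
set z := _ / T in ceq z2 *.
have : z <= 2 * ((node_index b)%:R - (node_index a)%:R) by lra.
by move=> /(ler_wpM2r (ltW T0)); lra.
Qed.

Lemma idx_count_le (a b : R) : - pi <= a -> a <= b -> T <= N%:R * mass a b ->
  T * (node_index b - node_index a)%:R <= 2 * (N%:R * mass a b).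
Proof.
move=> pa ab big; have ceq := count_eq pa ab.
have /andP[b1 b2] := truncn_itv (idx_ge0 b); have /andP[a1 a2] := truncn_itv (idx_ge0 a).
have ii := idx_le ab; rewrite natrB //.
rewrite -/(node_index b) -[(node_index b).+1%:R]natr1 in b1 b2.
rewrite -/(node_index a) -[(node_index a).+1%:R]natr1 in a1 a2.
have z2 : 1 <= N%:R * mass a b / T by rewrite ler_pdivlMr // mul1r.
have -> : N%:R * mass a b = (N%:R * mass a b / T) * T by rewrite divfK // gt_eqF.
set z := _ / T in ceq z2 *.
have : (node_index b)%:R - (node_index a)%:R <= 2 * z by lra.
by move=> /(ler_wpM2r (ltW T0)); lra.
Qed.

Lemma theta_in_piece (a b : R) i : - pi <= a -> a <= b -> b <= pi ->
  (node_index a <= i < node_index b)%N -> (i < N)%N /\ a <= theta i <= b.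
Proof.
move=> pa ab bp /andP[ai ib].
have iN : (i < N)%N by rewrite -idx_pi (leq_trans ib) // idx_le.
split=> //; have [/andP[t1 t2] tE] := theta_quantile iN.
have E : N%:R * mass (- pi) (theta i) / T = i.+1%:R.
  by rewrite tE; field; rewrite !gt_eqF.
apply/andP; split; rewrite leNgt; apply/negP => lt.
  have : (node_index (theta i) <= node_index a)%N by apply/idx_le/ltW.
  by rewrite {1}/node_index E natrK leqNgt ltnS ai.
have := mass_gt0 W_weight W_doubling lt.
have := mass_add W_weight W_doubling (le_trans pa ab) (ltW lt).
move: ib; rewrite truncn_gt_nat -E ler_pM2r ?invr_gt0 // ler_pM2l //; lra.
Qed.

Lemma idx_sum (h : R) (K : nat) (v : nat -> R) : 0 <= h -> pt h K = pi ->
  \sum_(k < K) \sum_(node_index (pt h k) <= j < node_index (pt h k.+1)) v j = \sum_(j < N) v j.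
Proof.
move=> h0 hK; rewrite (sum_consecutive v (i := fun k => node_index (pt h k))) ?hK ?idx_pi //.
  by rewrite /pt mul0r addr0 idxNpi.
by move=> k _; apply/idx_le/pt_le.
Qed.

End Nodes.

(** * The Marcinkiewicz-Zygmund inequality *)

Section MZ.
Variables (R : realType) (s : nat).

(** The number of parts into which the pieces of length [2 pi / n] are cut; it is
    large enough for [mz_contraction]. *)
Definition mz_coarse : nat := (Num.bound (2 * (8 * bern_const R s) ^+ s.+1 * 4 ^+ s)).+1.
(** Each part is cut into an odd number of fine pieces, so that the [2 ^ (s + 1)]
    pieces with odd index are separated by whole pieces and do not touch the ends of
    the part: nodes may then move a little without spoiling the separation. *)
Definition mz_split : nat := (2 * 2 ^ s.+1).+1.
Definition mz_step (n : nat) : R := 2 * pi / (n * mz_coarse)%:R.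
Definition mz_fine (n : nat) : R := mz_step n / mz_split%:R.

Definition nderiv k (q : R -> R) : R -> R := iter k (fun f : R -> R => derive1 f) q.

Lemma trig_iter_deriv n (q : R -> R) k : trig_polynomial n q ->
  trig_polynomial n (nderiv k q).
Proof. by move=> tq; elim: k => //= k IH; exact: (trig_deriv IH).1. Qed.

Lemma mz_step_gt0 n : (0 < n)%N -> 0 < mz_step n.
Proof. by move=> n0; rewrite divr_gt0 ?mulr_gt0 ?pi_gt0 // ltr0n muln_gt0 n0. Qed.

Lemma mz_stepE n : (0 < n)%N -> mz_coarse%:R * mz_step n = 2 * pi / n%:R.
Proof.
by move=> n0; rewrite /mz_step natrM; field; rewrite !pnatr_eq0 -!lt0n n0.
Qed.

Lemma mz_fineE n : mz_split%:R * mz_fine n = mz_step n.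
Proof. by rewrite /mz_fine mulrC divfK // pnatr_eq0. Qed.

Lemma mz_fine_gt0 n : (0 < n)%N -> 0 < mz_fine n.
Proof. by move=> n0; rewrite divr_gt0 ?mz_step_gt0 // ltr0n. Qed.

Lemma mz_fine_total n : (0 < n)%N -> pt (mz_fine n) (n * mz_coarse * mz_split) = pi.
Proof.
move=> n0; rewrite /pt natrM -mulrA mz_fineE /mz_step mulrC divfK.
  by ring.
by rewrite pnatr_eq0 muln_eq0 negb_or -!lt0n n0.
Qed.

Lemma pi_le4 : pi <= 4 :> R.
Proof. by have := pihalf_lt2 R; lra. Qed.

(** The exponent [s + 1] of the step beats the exponent [s] of the growth factor,
    which leaves a factor [1 / mz_coarse]. *)
Lemma mz_contraction n : (0 < n)%N ->
  mz_step n ^+ s.+1 * ((bern_const R s * n%:R) ^+ s.+1 * (4 * mz_coarse%:R) ^+ s) <= 2^-1.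
Proof.
move=> n0; have B0 := bern_const_ge0 R s.
set m : R := mz_coarse%:R; have m0 : 0 < m by rewrite ltr0n.
have n1 : n%:R != 0 :> R by rewrite pnatr_eq0 -lt0n.
have -> : mz_step n ^+ s.+1 * ((bern_const R s * n%:R) ^+ s.+1 * (4 * m) ^+ s) =
   (2 * pi * bern_const R s) ^+ s.+1 * 4 ^+ s / m.
  rewrite mulrA -exprMn /mz_step natrM -/m.
  have -> : 2 * pi / (n%:R * m) * (bern_const R s * n%:R) = (2 * pi * bern_const R s) / m.
    by field; rewrite n1 gt_eqF.
  rewrite exprMn [(4 * m) ^+ s]exprMn exprVn [m ^+ s.+1]exprS.
  by field; rewrite expf_neq0 ?gt_eqF.
rewrite ler_pdivrMr //.
apply: le_trans (_ : (8 * bern_const R s) ^+ s.+1 * 4 ^+ s <= _).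
  apply: ler_wpM2r; first exact: exprn_ge0.
  have p0 := pi_ge0 R; have p4 := pi_le4.
  apply: lerXn2r; rewrite ?nnegrE; [|exact: mulr_ge0|].
    by rewrite mulr_ge0 // mulr_ge0.
  by apply: ler_wpM2r => //; lra.
have : 2 * (8 * bern_const R s) ^+ s.+1 * 4 ^+ s <= m.
  apply: le_trans (ltW (archi_boundP _)) _.
    by rewrite !mulr_ge0 ?exprn_ge0 // mulr_ge0.
  by rewrite /m /mz_coarse ler_nat leqnSn.
lra.
Qed.

Section Weight.
Variable W : R -> R.
Hypothesis W_weight : periodic_weight W.
Hypothesis W_doubling : doubling (2 ^+ s) W.
Local Notation mass := (interval_mass W).
Local Notation T := (mass (- pi) pi).
Variables n N : nat.
Hypothesis n0 : (0 < n)%N.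
Hypothesis N0 : (0 < N)%N.
Local Notation m := mz_coarse.
Local Notation P := mz_split.
Local Notation h := (mz_step n).
Local Notation eta := (mz_fine n).
Let h0 : 0 < h. Proof. exact: mz_step_gt0. Qed.
Let eta0 : 0 < eta. Proof. exact: mz_fine_gt0. Qed.
Let NR0 : 0 < N%:R :> R. Proof. by rewrite ltr0n. Qed.
Let T0 : 0 < T. Proof. exact: (total_mass_gt0 W_weight W_doubling). Qed.

Lemma wsum_iter_deriv (q : R -> R) k : trig_polynomial n q ->
  piece_sup_sum W (2 * pi / n%:R) n (nderiv k q) <=
    (bern_const R s * n%:R) ^+ k * piece_sup_sum W (2 * pi / n%:R) n q.
Proof.
move=> tq; elim: k => [|k IH]; first by rewrite expr0 mul1r.
apply: le_trans (bernstein_wsum W_weight W_doubling n0 (trig_iter_deriv k tq)) _.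
by rewrite exprS -[leRHS]mulrA; apply: ler_wpM2l => //; rewrite mulr_ge0 // bern_const_ge0.
Qed.

(** Bernstein's inequality is used on the coarse pieces, where its constant does not
    depend on the refinement; passing to the fine scale and back costs one growth
    factor. *)
Lemma wsum_deriv_half (q : R -> R) : trig_polynomial n q ->
  h ^+ s.+1 * piece_sup_sum W h (n * m) (nderiv s.+1 q) <= 2^-1 * piece_sup_sum W h (n * m) q.
Proof.
move=> tq; have cq := trig_continuous tq.
have X0 : 0 <= piece_sup_sum W h (n * m) q.
  by apply: sumr_ge0 => i _; rewrite mulr_ge0 ?(wt_ge0 W_weight) // sup_on_ge0 // ltW // pt_lt.
have cqd := trig_continuous (trig_iter_deriv s.+1 tq).
have h1 := wsum_refine_le W_weight W_doubling h0 (m := m) isT n cqd.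
have h2 := wsum_iter_deriv s.+1 tq.
have h3 := wsum_coarse_le W_weight W_doubling h0 (m := m) isT n cq.
rewrite mz_stepE // in h1 h3.
have B0 : 0 <= (bern_const R s * n%:R) ^+ s.+1 by rewrite exprn_ge0 // mulr_ge0 // bern_const_ge0.
have h4 := le_trans h1 (le_trans h2 (ler_wpM2l B0 h3)).
have h5 : 0 <= h ^+ s.+1 by rewrite exprn_ge0 // ltW.
apply: le_trans (ler_wpM2l h5 h4) _.
have := ler_wpM2r X0 (mz_contraction n0).
by apply: le_trans; rewrite le_eqVlt; apply/orP; left; apply/eqP; ring.
Qed.

Variable theta : nat -> R.
Hypothesis theta_quantile : forall i, (i < N)%N ->
  - pi <= theta i <= pi /\ mass (- pi) (theta i) = i.+1%:R * T / N%:R.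
Variable x : nat -> R.
Hypothesis x_near : forall i, (i < N)%N -> `|x i - theta i| <= eta / 4.
Hypothesis fine_mass : forall k, 2 * T <= N%:R * piece_mass W eta k.

Local Notation idx := (node_index W N).
Let S (q : R -> R) k := \sum_(idx (pt eta k) <= j < idx (pt eta k.+1)) `|q (x j)|.

Let ptNpi k : - pi <= pt eta k.
Proof. by rewrite /pt lerDl mulr_ge0 // ltW. Qed.

(** The representative is the node with the smallest value of [|q|] among those whose
    quantile lies in the piece, and a minimum is at most the average. *)
Lemma piece_representative (q : R -> R) k : (k < n * m * P)%N ->
  exists2 y, pt eta k - eta / 4 <= y <= pt eta k.+1 + eta / 4 &
    piece_mass W eta k * `|q y| <= 2 * T / N%:R * S q k.
Proof.
move=> kK.
have pp : pt eta k <= pt eta k.+1 by rewrite ltW // pt_lt.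
have cnt := idx_count_ge W_weight W_doubling N0 (ptNpi k) pp (fine_mass k).
have lt : (idx (pt eta k) < idx (pt eta k.+1))%N.
  rewrite -subn_gt0 lt0n; apply/eqP => E; move: cnt; rewrite E mulr0.
  by have := fine_mass k; rewrite /piece_mass; have T0' := T0; lra.
have [i iI iS] := min_le_average (fun j => `|q (x j)|) lt.
have kpi : pt eta k.+1 <= pi.
  by rewrite -(mz_fine_total n0); apply: pt_le => //; exact: ltW.
have [iN /andP[t1 t2]] := theta_in_piece W_weight W_doubling N0 theta_quantile (ptNpi k) pp kpi iI.
exists (x i).
  by have := x_near iN; rewrite ler_norml => /andP[? ?]; apply/andP; split; lra.
have c0 : 0 <= 2 * T / N%:R by rewrite divr_ge0 ?mulr_ge0 // ltW.
apply: le_trans (ler_wpM2l c0 iS); rewrite mulrA; apply: ler_wpM2r => //.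
by rewrite mulrAC ler_pdivlMr // mulrC.
Qed.

Lemma sum_pieces (q : R -> R) :
  \sum_(i < n * m) \sum_(r < P) S q (i * P + r) = \sum_(j < N) `|q (x j)|.
Proof.
rewrite -(sum_nested (S q)).
exact: (idx_sum W_weight W_doubling N0 _ (ltW eta0) (mz_fine_total n0)).
Qed.

(** On every part the interpolation points are representatives of the odd fine
    pieces; the derivative term is at most half of the left-hand side. *)
Lemma marcinkiewicz_zygmund_aux (C : R) (q : R -> R) : 0 <= C ->
  (forall (ell : R) (f : nat -> R -> R) (a : R) (y : nat -> R) (e D : R),
    0 < ell ->
    (forall k t, is_derive t (1 : R) (f k) (f k.+1 t)) ->
    (forall l, (l < 2 ^ s.+1)%N -> a <= y l <= a + ell) ->
    (forall l, (l.+1 < 2 ^ s.+1)%N -> y l + (2 * P%:R)^-1 * ell <= y l.+1) ->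
    (forall l, (l < 2 ^ s.+1)%N -> `|f 0%N (y l)| <= e) ->
    (forall t, a <= t <= a + ell -> `|f s.+1 t| <= D) ->
    forall t, a <= t <= a + ell -> `|f 0%N t| <= C * e + ell ^+ s.+1 * D) ->
  trig_polynomial n q ->
  piece_sup_sum W h (n * m) q <= 2 * (C * (4 * P%:R) ^+ s * (2 * T / N%:R)) * \sum_(j < N) `|q (x j)|.
Proof.
move=> C0 interp tq; set D := (2 ^ s.+1)%N.
have PD : P = (2 * D).+1 by [].
have cq := trig_continuous tq.
have cqd := trig_continuous (trig_iter_deriv s.+1 tq).
have PE : P%:R * eta = h by exact: mz_fineE.
have P0 : 0 < P%:R :> R by rewrite ltr0n.
have sigE : (2 * P%:R)^-1 * h = eta / 2 by rewrite -PE; field; rewrite gt_eqF.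
have eta0' := eta0.
suff main i : (i < n * m)%N -> piece_mass W h i * sup_on q (pt h i) (pt h i.+1) <=
    C * (4 * P%:R) ^+ s * (2 * T / N%:R) * (\sum_(r < P) S q (i * P + r)) +
    h ^+ s.+1 * (piece_mass W h i * sup_on (nderiv s.+1 q) (pt h i) (pt h i.+1)).
  have : piece_sup_sum W h (n * m) q <= C * (4 * P%:R) ^+ s * (2 * T / N%:R) * (\sum_(j < N) `|q (x j)|)
     + h ^+ s.+1 * piece_sup_sum W h (n * m) (nderiv s.+1 q).
    rewrite -sum_pieces /piece_sup_sum !mulr_sumr -big_split /=.
    by apply: ler_sum => i _; exact: main.
  have := wsum_deriv_half tq; lra.
move=> inm.
have piece l : exists y, (l < D)%N ->
    pt eta (i * P + (2 * l).+1) - eta / 4 <= y <= pt eta (i * P + (2 * l).+1).+1 + eta / 4 /\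
    piece_mass W eta (i * P + (2 * l).+1) * `|q y| <= 2 * T / N%:R * S q (i * P + (2 * l).+1).
  case: (ltnP l D) => lD; last by exists 0.
  have kK : (i * P + (2 * l).+1 < n * m * P)%N.
    apply: leq_trans (_ : i.+1 * P <= _)%N; last by rewrite leq_mul2r inm orbT.
    by rewrite [(i.+1 * _)%N]mulSn [leqRHS]addnC ltn_add2l PD ltnS ltn_mul2l.
  by have [y yI yS] := piece_representative q kK; exists y.
have {}piece : exists y : nat -> R, forall l, (l < D)%N ->
    pt eta (i * P + (2 * l).+1) - eta / 4 <= y l <= pt eta (i * P + (2 * l).+1).+1 + eta / 4 /\
    piece_mass W eta (i * P + (2 * l).+1) * `|q (y l)| <= 2 * T / N%:R * S q (i * P + (2 * l).+1).
  by have [y yP] := choice piece; exists y.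
have [y yP] := piece.
have ptE l : pt eta (i * P + l) = pt h i + l%:R * eta.
  by rewrite -PE pt_coarse /pt natrD mulrDl addrA.
(* The sum bounds every [|q (y l)|] and is additive in the pieces. *)
pose e := \sum_(l < D) `|q (y l)|.
have yI l : (l < D)%N -> pt h i + (2 * l%:R + 3 / 4) * eta <= y l <= pt h i + (2 * l%:R + 9 / 4) * eta.
  move=> /yP [+ _]; rewrite -addnS !ptE -[(2 * l).+2%:R]natr1 -[(2 * l).+1%:R]natr1 natrM.
  by move=> /andP[? ?]; apply/andP; split; lra.
have supb : sup_on q (pt h i) (pt h i.+1) <=
    C * e + h ^+ s.+1 * sup_on (nderiv s.+1 q) (pt h i) (pt h i.+1).
  apply: sup_on_le => [|t]; first by rewrite ltW // pt_lt.
  rewrite ptS; apply: (interp h (fun k => nderiv k q) _ y) => //.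
  - by move=> k u; exact: (trig_deriv (trig_iter_deriv k tq)).2.
  - move=> l lD; have /andP[y1 y2] := yI l lD.
    have lD' : l%:R + 1 <= D%:R :> R by rewrite natr1 ler_nat.
    have l0 : 0 <= l%:R :> R by [].
    have hE : h = (2 * D%:R + 1) * eta by rewrite -PE /mz_split -natr1 natrM.
    have := ler_wpM2r (ltW eta0) lD'; have := ler_wpM2r (ltW eta0) l0.
    by move=> ? ?; apply/andP; split; lra.
  - move=> l lD; rewrite sigE; have /andP[_ y1] := yI l (ltnW lD); have /andP[y2 _] := yI _ lD.
    move: y2; rewrite -[l.+1%:R]natr1; lra.
  - move=> l lD; rewrite /e (bigD1 (Ordinal lD)) //= lerDl.
    by apply: sumr_ge0.
  - by move=> u uI; apply: le_sup_on => //; rewrite ptS.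
have w0 : 0 <= piece_mass W h i by exact: (wt_ge0 W_weight).
apply: le_trans (ler_wpM2l w0 supb) _; rewrite mulrDr; apply: lerD; last first.
  by rewrite mulrCA.
rewrite mulrCA -!mulrA; apply: ler_wpM2l => //.
rewrite /e mulr_sumr; apply: le_trans (_ : \sum_(l < D) (4 * P%:R) ^+ s * (2 * T / N%:R * S q (i * P + (2 * l).+1)) <= _).
  apply: ler_sum => l _; have [_ yS] := yP l (ltn_ord l).
  have c0 : 0 <= (4 * P%:R) ^+ s :> R by rewrite exprn_ge0 // mulr_ge0.
  apply: le_trans (ler_wpM2l c0 yS); rewrite mulrA; apply: ler_wpM2r => //.
  rewrite -PE; apply: (wt_coarse_le W_weight W_doubling) => //.
  by rewrite /mz_split ltnS -/D ltn_mul2l //= (ltn_ord l).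
rewrite -mulr_sumr; apply: ler_wpM2l; first by rewrite exprn_ge0 // mulr_ge0.
rewrite -mulr_sumr !mulrA; apply: ler_wpM2l; first by rewrite divr_ge0 ?mulr_ge0 // ltW.
apply: (sum_odd_le (g := fun r => S q (i * P + r))).
by move=> r; apply: sumr_ge0.
Qed.

End Weight.
End MZ.

(** * Newton's iteration for the nodes *)

Section Newton.
Variable R : realType.

(** Nested intervals: [a_k - 2 c / 2 ^ k] increases and [a_k + 2 c / 2 ^ k] decreases. *)
Lemma geometric_limit (a : nat -> R) (c : R) : 0 <= c ->
  (forall k, `|a k.+1 - a k| <= c / 2 ^+ k) ->
  exists l, forall k, `|a k - l| <= 2 * c / 2 ^+ k.
Proof.
move=> c0 ac.
have p2 k : 0 < 2 ^+ k :> R by exact: exprn_gt0.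
pose lo k := a k - 2 * c / 2 ^+ k; pose hi k := a k + 2 * c / 2 ^+ k.
have half k : 2 * c / 2 ^+ k.+1 = c / 2 ^+ k.
  by rewrite exprS; field; rewrite gt_eqF.
have e0 k : 0 <= c / 2 ^+ k by rewrite divr_ge0 // ltW.
have dbl k : 2 * c / 2 ^+ k = 2 * (c / 2 ^+ k) by rewrite mulrA.
have lo_step k : lo k <= lo k.+1.
  by have := ac k; rewrite /lo half dbl ler_norml => /andP[? ?]; lra.
have hi_step k : hi k.+1 <= hi k.
  by have := ac k; rewrite /hi half dbl ler_norml => /andP[? ?]; lra.
have lo_le i j : (i <= j)%N -> lo i <= lo j.
  move=> ij; rewrite -(subnK ij); elim: (j - i)%N => [|d IH] //.
  by rewrite addSn; exact: le_trans (lo_step _).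
have hi_le i j : (i <= j)%N -> hi j <= hi i.
  move=> ij; rewrite -(subnK ij); elim: (j - i)%N => [|d IH] //.
  by rewrite addSn; apply: le_trans IH.
have lohi i j : lo i <= hi j.
  apply: le_trans (lo_le _ _ (leq_maxl i j)) _; apply: le_trans (hi_le _ _ (leq_maxr i j)).
  by rewrite /lo /hi dbl; have := e0 (maxn i j); lra.
pose A := [set lo k | k in setT].
have A0 : A !=set0 by exists (lo 0%N), 0%N.
have Asup : has_ubound A by exists (hi 0%N) => _ [k _ <-].
exists (sup A) => k; rewrite ler_distl; apply/andP; split.
  have : sup A <= hi k by apply: ge_sup => // _ [j _ <-].
  by rewrite /hi; lra.
have : lo k <= sup A by apply: ub_le_sup => //; exists k.
by rewrite /lo; lra.
Qed.

Lemma mean_value (f f' : R -> R) (a b u v : R) :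
  (forall t, is_derive t (1 : R) f (f' t)) -> a <= u <= b -> a <= v <= b ->
  exists2 c, a <= c <= b /\ `|c - u| <= `|v - u| & f v - f u = f' c * (v - u).
Proof.
move=> df uI vI.
have cf : continuous f.
  by move=> z; apply: differentiable_continuous; apply/derivable1_diffP; have [] := df z.
have [uv|/ltW vu] := leP u v.
  have [c] := MVT_segment uv (fun w _ => df w) (continuous_subspaceT cf).
  rewrite in_itv /= => /andP[c1 c2] E; exists c => //.
  split; first by apply/andP; split; lra.
  by rewrite !ger0_norm ?subr_ge0 ?(le_trans c1) //; lra.
have [c] := MVT_segment vu (fun w _ => df w) (continuous_subspaceT cf).
rewrite in_itv /= => /andP[c1 c2] E; exists c; last lra.
split; first by apply/andP; split; lra.
by rewrite !ler0_norm; lra.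
Qed.

Lemma taylor2_bound (p p' p'' : R -> R) (a b x y M : R) :
  (forall t, is_derive t (1 : R) p (p' t)) -> (forall t, is_derive t (1 : R) p' (p'' t)) ->
  (forall t, a <= t <= b -> `|p'' t| <= M) -> a <= x <= b -> a <= y <= b ->
  `|p y - p x - p' x * (y - x)| <= M * (y - x) ^+ 2.
Proof.
move=> dp dp' pM xI yI.
have [c [cI cx] E] := mean_value dp xI yI.
have [d [dI _] E'] := mean_value dp' xI cI.
rewrite E -mulrBl E' !normrM -[(y - x) ^+ 2]real_normK ?num_real // expr2 mulrA.
apply: ler_wpM2r => //; apply: ler_pM => //; exact: pM.
Qed.

Lemma lipschitz_bound (p p' : R -> R) (a b x y M : R) :
  (forall t, is_derive t (1 : R) p (p' t)) ->
  (forall t, a <= t <= b -> `|p' t| <= M) -> a <= x <= b -> a <= y <= b ->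
  `|p y - p x| <= M * `|y - x|.
Proof.
move=> dp pM xI yI; have [c [cI _] ->] := mean_value dp xI yI.
by rewrite normrM; apply: ler_wpM2r => //; exact: pM.
Qed.

Variables (n N : nat) (theta : nat -> R) (del H C b0 : R) (I : (R -> R) -> R).
Hypothesis I_lin : forall c p q, trig_polynomial n p -> trig_polynomial n q ->
  I (fun t => c * p t + q t) = c * I p + I q.
Hypothesis b0_ge0 : 0 <= b0.
Hypothesis delH : del <= H.
Hypothesis b0_del : 2 * b0 <= del.
Hypothesis C_ge0 : 0 <= C.
Hypothesis C_b0 : C * b0 <= 2^-1.

Definition near_nodes (x : nat -> R) d := forall i, (i < N)%N -> `|x i - theta i| <= d.
Definition defect (x : nat -> R) (p : R -> R) := \sum_(i < N) p (x i) - I p.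

Hypothesis deriv_bound : forall x q, near_nodes x del -> trig_polynomial n q ->
  \sum_(i < N) sup_on (derive1 q) (theta i - H) (theta i + H) <= C * \sum_(i < N) `|q (x i)|.
Hypothesis defect0 : forall p, trig_polynomial n p ->
  `|defect theta p| <= b0 * \sum_(i < N) `|derive1 p (theta i)|.

(** The correction [u] solves the linearised system exactly and is bounded by [b]; the
    new defect is the second order Taylor remainder, summed with [|p''|] near the nodes,
    which [deriv_bound] for [q = p'] brings back to the values of [p'] at the new nodes. *)
Lemma newton_step (x : nat -> R) (b : R) : 0 <= b -> near_nodes x del ->
  (forall p, trig_polynomial n p -> `|defect x p| <= b * \sum_(i < N) `|derive1 p (x i)|) ->
  exists2 x', forall i, `|x' i - x i| <= b &
    near_nodes x' del -> forall p, trig_polynomial n p ->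
      `|defect x' p| <= C * b ^+ 2 * \sum_(i < N) `|derive1 p (x' i)|.
Proof.
move=> b_ge0 xnear xb.
have tl (c : R) (p q : R -> R) : trig_polynomial n p -> trig_polynomial n q ->
  trig_polynomial n (fun t => c * p t + q t) by exact: trig_lin.
have lg i : linear_on (trig_polynomial n : set (R -> R)) (fun p : R -> R => derive1 p (x i)).
  by move=> c p q tp tq; rewrite (trig_deriv_lin c tp tq).
have lE : linear_on (trig_polynomial n : set (R -> R)) (defect x).
  move=> c p q tp tq; rewrite /defect I_lin // big_split /= -mulr_sumr; ring.
have [u ub uE] := hahn_banach_l1 tl b_ge0 lE lg xb.
exists (fun i => x i - u i) => [i|x'near p tp].
  by rewrite addrAC subrr sub0r normrN.
set x' := fun i => _ in x'near *.
have [tp' dp] := trig_deriv tp; have [tp'' dp'] := trig_deriv tp'.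
have b2 : 0 <= b ^+ 2 by exact: exprn_ge0.
have := ler_wpM2l b2 (deriv_bound x'near tp'); rewrite mulrA [b ^+ 2 * C]mulrC.
apply: le_trans.
have -> : defect x' p = \sum_(i < N) (p (x' i) - p (x i) - derive1 p (x i) * (x' i - x i)).
  have -> : defect x' p = \sum_(i < N) p (x' i) - \sum_(i < N) p (x i) + defect x p.
    by rewrite /defect; ring.
  rewrite uE // -sumrB -big_split /=; apply: eq_bigr => i _; rewrite /x'; ring.
apply: le_trans (ler_norm_sum _ _ _) _; rewrite mulr_sumr; apply: ler_sum => i _.
have iN := ltn_ord i; have delH' := delH.
have inI (w : nat -> R) : near_nodes w del -> theta i - H <= w i <= theta i + H.
  by move=> /(_ _ iN); rewrite ler_norml => /andP[? ?]; apply/andP; split; lra.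
have := taylor2_bound dp dp' (fun t => le_sup_on (trig_continuous tp'')) (inI _ xnear) (inI _ x'near).
move/le_trans; apply; rewrite mulrC; apply: ler_wpM2r.
  by apply: le_trans (le_sup_on (trig_continuous tp'') (inI _ xnear)).
rewrite /x' addrAC subrr sub0r sqrrN -[leLHS]real_normK ?num_real //.
by rewrite lerXn2r ?nnegrE.
Qed.

(** With [C * b0 <= 1 / 2] the bound on the defect at least halves in every step, so the
    nodes never move further than [2 * b0] and converge. *)
Lemma newton_solution : exists x : nat -> R, forall p, trig_polynomial n p ->
  \sum_(i < N) p (x i) = I p.
Proof.
have b0' := b0_ge0; have b0d := b0_del; have dH := delH.
have p2 k : 0 < 2 ^+ k :> R by exact: exprn_gt0.
(* The radii [2 * b0 * (1 - 2 ^ (- k))] leave room for the next correction,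
   which is at most [b0 / 2 ^ k]. *)
pose Inv k x := near_nodes x (2 * b0 * (1 - (2 ^+ k)^-1)) /\
  forall p, trig_polynomial n p ->
    `|defect x p| <= b0 / 2 ^+ k * \sum_(i < N) `|derive1 p (x i)|.
have near_del k x : near_nodes x (2 * b0 * (1 - (2 ^+ k)^-1)) -> near_nodes x del.
  move=> xn i iN; apply: le_trans (xn i iN) _; apply: le_trans b0d.
  have c1 : 1 - (2 ^+ k)^-1 <= 1 :> R by rewrite gerBl invr_ge0 ltW.
  by have := ler_wpM2l b0' c1; lra.
have step (kx : nat * (nat -> R)) : exists x', Inv kx.1 kx.2 ->
    Inv kx.1.+1 x' /\ forall i, `|x' i - kx.2 i| <= b0 / 2 ^+ kx.1.
  case: kx => k x /=; have [[xn xE]|no] := pselect (Inv k x); last by exists x.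
  have bk0 : 0 <= b0 / 2 ^+ k by rewrite divr_ge0 // ltW.
  have [x' x'x x'E] := newton_step bk0 (near_del _ _ xn) xE.
  exists x' => _; split => //.
  have x'n : near_nodes x' (2 * b0 * (1 - (2 ^+ k.+1)^-1)).
    move=> i iN; have -> : x' i - theta i = (x' i - x i) + (x i - theta i) by ring.
    apply: le_trans (ler_normD _ _) _; apply: le_trans (lerD (x'x i) (xn i iN)) _.
    rewrite le_eqVlt; apply/orP; left; apply/eqP; rewrite exprS; field.
    by rewrite gt_eqF.
  split=> // p tp; apply: le_trans (x'E (near_del _ _ x'n) p tp) _.
  apply: ler_wpM2r; first exact: sumr_ge0.
  have -> : C * (b0 / 2 ^+ k) ^+ 2 = (C * b0) * (b0 / 2 ^+ k) * (2 ^+ k)^-1.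
    by rewrite expr2 !mulrA; ring.
  have -> : b0 / 2 ^+ k.+1 = 2^-1 * (b0 / 2 ^+ k) * 1.
    by rewrite exprS mulr1; field; rewrite gt_eqF.
  apply: ler_pM; first by rewrite !mulr_ge0 ?C_ge0 ?invr_ge0 ?(ltW (p2 k)).
  - by rewrite invr_ge0 ltW.
  - by apply: ler_wpM2r => //; exact: C_b0.
  - by rewrite invf_le1 // exprn_ege1 // ler1n.
have [F FP] := choice step.
pose X := fix X k := if k is k'.+1 then F (k', X k') else theta.
have XI k : Inv k (X k).
  elim: k => [|k IH]; last by have [] := FP (k, X k) IH.
  split=> [i iN|p tp]; first by rewrite subrr normr0 expr0 invr1 subrr mulr0.
  by rewrite expr0 divr1; exact: defect0.
have XS k i : `|X k.+1 i - X k i| <= b0 / 2 ^+ k by have [_] := FP (k, X k) (XI k); apply.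
have [x xP] : exists x : nat -> R, forall i k, `|X k i - x i| <= 2 * b0 / 2 ^+ k.
  have /choice [x xP] : forall i, exists l, forall k, `|X k i - l| <= 2 * b0 / 2 ^+ k.
    by move=> i; apply: geometric_limit.
  by exists x.
exists x => p tp; apply/eqP; rewrite -subr_eq0 -normr_le0 -/(defect x p).
have [tp' dp] := trig_deriv tp; have cp' := trig_continuous tp'.
have Xdel k := near_del k (X k) (XI k).1.
have xdel : near_nodes x del.
  move=> i iN; have := xP i 0%N; rewrite expr0 divr1 distrC.
  by have -> : x i - theta i = x i - X 0%N i by []; move=> h; apply: le_trans h _.
have inI (w : nat -> R) i : (i < N)%N -> near_nodes w del -> theta i - H <= w i <= theta i + H.
  by move=> iN /(_ _ iN); rewrite ler_norml => /andP[? ?]; apply/andP; split; lra.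
pose Z := \sum_(i < N) sup_on (derive1 p) (theta i - H) (theta i + H).
have Z0 : 0 <= Z.
  apply: sumr_ge0 => i _; apply: le_trans (normr_ge0 (derive1 p (theta i))) _.
  by apply: le_sup_on => //; apply: (inI theta) => // j jN; rewrite subrr normr0; lra.
have small k : `|defect x p| <= 3 * b0 * Z / 2 ^+ k.
  have d1 : `|defect (X k) p| <= b0 / 2 ^+ k * Z.
    apply: le_trans ((XI k).2 p tp) _; apply: ler_wpM2l.
      by rewrite divr_ge0 // ltW.
    by apply: ler_sum => i _; apply: le_sup_on => //; exact: inI.
  have d2 : `|defect x p - defect (X k) p| <= 2 * b0 / 2 ^+ k * Z.
    have -> : defect x p - defect (X k) p = \sum_(i < N) (p (x i) - p (X k i)).
      by rewrite sumrB /defect; ring.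
    apply: le_trans (ler_norm_sum _ _ _) _; rewrite mulr_sumr; apply: ler_sum => i _.
    have iN := ltn_ord i.
    apply: le_trans (lipschitz_bound dp (fun t => le_sup_on cp') (inI _ _ iN (Xdel k)) (inI _ _ iN xdel)) _.
    rewrite mulrC; apply: ler_wpM2r; last by rewrite distrC.
    by apply: le_trans (le_sup_on cp' (inI _ _ iN xdel)).
  have := ler_normD (defect x p - defect (X k) p) (defect (X k) p); rewrite subrK.
  have -> : 3 * b0 * Z / 2 ^+ k = 2 * b0 / 2 ^+ k * Z + b0 / 2 ^+ k * Z by ring.
  lra.
rewrite leNgt; apply/negP => pos.
have [K Kb] : exists K : nat, 3 * b0 * Z < K%:R * `|defect x p|.
  exists (Num.bound (3 * b0 * Z / `|defect x p|)).
  by rewrite -ltr_pdivrMr // archi_boundP // divr_ge0 // !mulr_ge0.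
have := small K; rewrite ler_pdivlMr // => h.
have : K%:R * `|defect x p| <= `|defect x p| * 2 ^+ K.
  by rewrite mulrC ler_wpM2l // -natrX ler_nat ltnW // ltn_expl.
lra.
Qed.

End Newton.

(** * Sums over nodes close to the quantiles *)

Section NodeSums.
Variables (R : realType) (s : nat).

Definition nodes_quantile (W : R -> R) N (theta : nat -> R) := forall i, (i < N)%N ->
  - pi <= theta i <= pi /\ interval_mass W (- pi) (theta i) = i.+1%:R * interval_mass W (- pi) pi / N%:R.

Lemma marcinkiewicz_zygmund : exists2 C : R, 0 <= C &
  forall (W : R -> R) (n N : nat) (theta x : nat -> R) (q : R -> R),
    periodic_weight W -> doubling (2 ^+ s) W -> (0 < n)%N -> (0 < N)%N ->
    nodes_quantile W N theta ->
    (forall k, 2 * interval_mass W (- pi) pi <= N%:R * piece_mass W (mz_fine R s n) k) ->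
    near_nodes N theta x (mz_fine R s n / 4) -> trig_polynomial n q ->
    piece_sup_sum W (2 * pi / n%:R) n q <=
      C * (interval_mass W (- pi) pi / N%:R) * \sum_(j < N) `|q (x j)|.
Proof.
have sig0 : 0 < (2 * (mz_split s)%:R)^-1 :> R by rewrite invr_gt0 mulr_gt0 // ltr0n.
have [C C0 interp] := interpolation_bound s.+1 sig0.
have m4 : 0 <= (4 * (mz_coarse R s)%:R) ^+ s :> R by rewrite exprn_ge0 // mulr_ge0.
have P4 : 0 <= (4 * (mz_split s)%:R) ^+ s :> R by rewrite exprn_ge0 // mulr_ge0.
exists ((4 * (mz_coarse R s)%:R) ^+ s * (4 * (C * (4 * (mz_split s)%:R) ^+ s))).
  by rewrite !mulr_ge0.
move=> W n N theta x q Ww Wd n0 N0 tq fm xn trq.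
have aux := marcinkiewicz_zygmund_aux Ww Wd n0 N0 tq xn fm C0 interp trq.
have h0 := mz_step_gt0 R s n0.
have := wsum_coarse_le Ww Wd h0 (m := mz_coarse R s) isT n (trig_continuous trq).
rewrite mz_stepE // => /le_trans; apply.
apply: le_trans (ler_wpM2l m4 aux) _.
rewrite le_eqVlt; apply/orP; left; apply/eqP; ring.
Qed.

(** The neighbourhood of a node is covered by three consecutive pieces, whose masses are
    comparable, and a piece contains at most [2 N / T] times its mass of nodes. *)
Lemma node_sup_sum (W : R -> R) (n N : nat) (theta : nat -> R) (f : R -> R) :
  periodic_weight W -> doubling (2 ^+ s) W -> (0 < n)%N -> (0 < N)%N ->
  nodes_quantile W N theta ->
  (forall j, interval_mass W (- pi) pi <= N%:R * piece_mass W (2 * pi / n%:R) j) ->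
  continuous f -> (forall t, f (t + 2 * pi) = f t) ->
  interval_mass W (- pi) pi * \sum_(i < N) sup_on f (theta i - 2 * pi / n%:R) (theta i + 2 * pi / n%:R) <=
    6 * 6 ^+ s * N%:R * piece_sup_sum W (2 * pi / n%:R) n f.
Proof.
move=> Ww Wd n0 N0 tq big cf pf; set T := interval_mass W (- pi) pi; set H := 2 * pi / n%:R.
have nR : 0 < n%:R :> R by rewrite ltr0n.
have H0 : 0 < H by rewrite divr_gt0 // mulr_gt0 // pi_gt0.
have Hpi : pt H n = pi by rewrite /pt /H mulrC divfK ?gt_eqF //; ring.
have T0 : 0 < T by exact: (total_mass_gt0 Ww Wd).
pose g j := sup_on f (pt H j) (pt H j.+1).
have g0 j : 0 <= g j by apply: sup_on_ge0 => //; rewrite ltW // pt_lt.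
pose F j := piece_mass W H j * g j.
have Fn j : F (j + n)%N = F j.
  by rewrite /F /g /H (wt_periodic Ww j n0) sup_on_periodic.
(* Adding the period [n] keeps the index of the piece before the [j]-th one a
   natural number. *)
pose G j := g (j + n.-1)%N + g (j + n)%N + g (j + n.+1)%N.
have ptn j : pt H (j + n) = pt H j + 2 * pi.
  by rewrite /pt natrD mulrDl addrA /H [n%:R * _]mulrC divfK // gt_eqF.
have z_le j i : (j < n)%N -> (node_index W N (pt H j) <= i < node_index W N (pt H j.+1))%N ->
    sup_on f (theta i - H) (theta i + H) <= G j.
  move=> jn ii; have jpi : pt H j.+1 <= pi by rewrite -Hpi; apply: pt_le => //; exact: ltW.
  have jNpi : - pi <= pt H j by rewrite /pt lerDl mulr_ge0 // ltW.
  have [iN /andP[t1 t2]] := theta_in_piece Ww Wd N0 tq jNpi (ltW (pt_lt j H0)) jpi ii.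
  apply: sup_on_le => [|t /andP[u1 u2]]; first lra.
  rewrite -pf.
  have e1 : pt H (j + n) = pt H (j + n.-1) + H by rewrite -ptS -addnS prednK.
  have e2 : pt H (j + n).+1 = pt H (j + n) + H by rewrite ptS.
  have e3 : pt H (j + n.+1).+1 = pt H (j + n).+1 + H by rewrite ptS addnS.
  have e4 : pt H j.+1 = pt H j + H by rewrite ptS.
  have e5 := ptn j.
  rewrite /G; have [h1|/ltW h1] := leP (t + 2 * pi) (pt H (j + n)).
    apply: le_trans (_ : g (j + n.-1)%N <= _); last by rewrite -addrA lerDl addr_ge0.
    by apply: le_sup_on => //; rewrite -addnS prednK // h1 andbT; lra.
  have [h2|/ltW h2] := leP (t + 2 * pi) (pt H (j + n).+1).
    apply: le_trans (_ : g (j + n)%N <= _); last first.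
      by rewrite -addrA [g (j + n)%N + _]addrC addrA lerDr addr_ge0.
    by apply: le_sup_on => //; rewrite h1 h2.
  apply: le_trans (_ : g (j + n.+1)%N <= _); last by rewrite lerDr addr_ge0.
  by apply: le_sup_on => //; rewrite e3 addnS h2 /=; lra.
rewrite -(idx_sum Ww Wd N0 (fun i => sup_on f (theta i - H) (theta i + H)) (ltW H0) Hpi) mulr_sumr.
apply: le_trans (_ : \sum_(j < n) 2 * N%:R * 6 ^+ s *
    (F (j + n.-1)%N + F (j + n)%N + F (j + n.+1)%N) <= _).
  apply: ler_sum => j _; have jn := ltn_ord j.
  have jNpi : - pi <= pt H j by rewrite /pt lerDl mulr_ge0 // ltW.
  have cnt := idx_count_le Ww Wd N0 jNpi (ltW (pt_lt j H0)) (big j).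
  have G0 : 0 <= G j by rewrite !addr_ge0.
  apply: le_trans (_ : T * ((node_index W N (pt H j.+1) - node_index W N (pt H j))%:R * G j) <= _).
    apply: ler_wpM2l; first exact: ltW.
    rewrite [leRHS]mulr_natl -sumr_const_nat.
    by rewrite big_nat [leRHS]big_nat; apply: ler_sum => i; exact: z_le.
  have cmp i : (j + n <= i + 1)%N -> (i <= j + n + 1)%N -> piece_mass W H j <= 6 ^+ s * piece_mass W H i.
    move=> h1 h2; rewrite -(wt_periodic Ww j n0).
    have := piece_growth Ww Wd H0 h2 h1.
    by have -> : 2 * (2 * 1 + 1) = 6 :> R by ring.
  have wG : piece_mass W H j * G j <= 6 ^+ s * (F (j + n.-1)%N + F (j + n)%N + F (j + n.+1)%N).
    rewrite /G /F !mulrDr !mulrA; apply: lerD; first apply: lerD;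
      by apply: ler_wpM2r => //; apply: cmp; lia.
  have N2 : 0 <= 2 * N%:R :> R by rewrite mulr_ge0.
  apply: le_trans (_ : 2 * N%:R * (piece_mass W H j * G j) <= _).
    by rewrite mulrA; apply: le_trans (ler_wpM2r G0 cnt) _; rewrite /piece_mass !mulrA.
  by rewrite -[leRHS]mulrA; exact: ler_wpM2l.
rewrite -mulr_sumr !big_split /= !sum_periodic_shift // /piece_sup_sum -/F.
rewrite le_eqVlt; apply/orP; left; apply/eqP; rewrite /F /g; ring.
Qed.

(** Both bounds follow from the Marcinkiewicz-Zygmund inequality, the second one through
    Bernstein's inequality. *)
Lemma node_sums : exists2 C : R, 1 <= C &
  forall (W : R -> R) (n N : nat) (theta x : nat -> R) (q : R -> R),
    periodic_weight W -> doubling (2 ^+ s) W -> (0 < n)%N -> (0 < N)%N ->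
    nodes_quantile W N theta ->
    (forall k, 2 * interval_mass W (- pi) pi <= N%:R * piece_mass W (mz_fine R s n) k) ->
    near_nodes N theta x (mz_fine R s n / 4) -> trig_polynomial n q ->
    \sum_(i < N) sup_on q (theta i - 2 * pi / n%:R) (theta i + 2 * pi / n%:R) <=
      C * \sum_(j < N) `|q (x j)| /\
    \sum_(i < N) sup_on (derive1 q) (theta i - 2 * pi / n%:R) (theta i + 2 * pi / n%:R) <=
      C * n%:R * \sum_(j < N) `|q (x j)|.
Proof.
have [C0 C0_ge0 mz] := marcinkiewicz_zygmund.
have B0 := bern_const_ge0 R s.
pose A : R := 6 * 6 ^+ s.
have A0 : 0 <= A by rewrite mulr_ge0 // exprn_ge0.
have AC : 0 <= A * C0 by exact: mulr_ge0.
exists (1 + A * C0 + A * C0 * bern_const R s).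
  by rewrite -addrA lerDl addr_ge0 // ?(mulr_ge0 AC) //; exact: mulr_ge0 AC B0.
move=> W n N theta x q Ww Wd n0 N0 tq fm xn trq.
have Yq := mz W n N theta x q Ww Wd n0 N0 tq fm xn trq.
set T := interval_mass W (- pi) pi in Yq *; set H := 2 * pi / n%:R in Yq *.
set S := \sum_(j < N) `|q (x j)| in Yq *.
have S0 : 0 <= S by exact: sumr_ge0.
have T0 : 0 < T by exact: (total_mass_gt0 Ww Wd).
have NR : 0 < N%:R :> R by rewrite ltr0n.
have big j : T <= N%:R * piece_mass W H j.
  have := fm (j * mz_coarse R s * mz_split s)%N; rewrite -/T.
  have : piece_mass W (mz_fine R s n) (j * mz_coarse R s * mz_split s) <= piece_mass W H j.
    apply: (mass_le Ww Wd); rewrite ?ptS -pt_coarse mz_fineE -pt_coarse mz_stepE //.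
    rewrite lerD2l /H -(mz_stepE R s n0) -(mz_fineE R s n).
    have f0 := ltW (mz_fine_gt0 R s n0).
    apply: le_trans (_ : (mz_split s)%:R * mz_fine R s n <= _).
      by rewrite ler_peMl // ?ler1n.
    by apply: ler_peMl; [exact: mulr_ge0 | rewrite ler1n].
  by move=> /(ler_wpM2l (ltW NR)); lra.
have conv f c : continuous f -> (forall t, f (t + 2 * pi) = f t) ->
    piece_sup_sum W H n f <= c * (C0 * (T / N%:R) * S) ->
    \sum_(i < N) sup_on f (theta i - H) (theta i + H) <= A * C0 * c * S.
  move=> cf pf fY.
  have := node_sup_sum Ww Wd n0 N0 tq big cf pf; rewrite -/T -/H -/A => h.
  rewrite -(ler_pM2l T0); apply: le_trans h _.
  have AN : 0 <= A * N%:R by rewrite mulr_ge0.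
  apply: le_trans (ler_wpM2l AN fY) _.
  by rewrite le_eqVlt; apply/orP; left; apply/eqP; field; rewrite gt_eqF.
have ACS : 0 <= A * C0 * S by exact: mulr_ge0.
have ACBS : 0 <= A * C0 * bern_const R s * S by rewrite !(mulr_ge0 _ S0) // mulr_ge0.
split.
  have h := conv q 1 (trig_continuous trq) (trig_periodic trq).
  rewrite mul1r mulr1 in h; have := h Yq; lra.
have trq' := (trig_deriv trq).1.
have nR0 : 0 <= n%:R :> R by [].
have h := conv (derive1 q) (bern_const R s * n%:R) (trig_continuous trq') (trig_periodic trq').
apply: le_trans (h _) _.
  apply: le_trans (bernstein_wsum Ww Wd n0 trq) _.
  by apply: ler_wpM2l => //; rewrite mulr_ge0.
have := mulr_ge0 nR0 ACS; have := mulr_ge0 nR0 S0; lra.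
Qed.

End NodeSums.

(** * Existence of equal-weight quadratures *)

Section WintBounds.
Variables (R : realType) (s : nat) (W : R -> R).
Hypothesis W_weight : periodic_weight W.
Hypothesis W_doubling : doubling (2 ^+ s) W.
Let L0 : 0 <= 2 ^+ s :> R. Proof. exact: exprn_ge0. Qed.
Let ccst (c : R) : continuous (fun _ : R => c). Proof. by move=> x; exact: cvg_cst. Qed.

Lemma wint_cst (a b c : R) : weighted_integral W a b (fun=> c) = c * interval_mass W a b.
Proof.
have h0 : weighted_integral W a b (fun=> 0) = 0.
  have E := wint_lin W_weight W_doubling L0 a b (-1) (@ccst 1) (@ccst 1).
  have Z : (fun _ : R => -1 * 1 + 1 : R) = (fun=> 0 : R).
    by apply: funext => t; rewrite mulN1r addNr.
  by rewrite Z in E; rewrite E mulN1r addNr.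
have := wint_lin W_weight W_doubling L0 a b c (@ccst 1) (@ccst 0).
by rewrite h0 mulr1 !addr0 wint1.
Qed.

Lemma wint_near_cst (a b c e : R) (f : R -> R) : continuous f ->
  (forall t, a <= t <= b -> `|f t - c| <= e) ->
  `|weighted_integral W a b f - c * interval_mass W a b| <= e * interval_mass W a b.
Proof.
move=> cf fc.
have h1 : weighted_integral W a b f <= weighted_integral W a b (fun=> c + e).
  apply: (wint_le W_weight W_doubling L0) => // t /fc.
  by rewrite ler_norml => /andP[? ?]; lra.
have h2 : weighted_integral W a b (fun=> c - e) <= weighted_integral W a b f.
  apply: (wint_le W_weight W_doubling L0) => // t /fc.
  by rewrite ler_norml => /andP[? ?]; lra.
rewrite !wint_cst in h1 h2; rewrite ler_norml; apply/andP; split; lra.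
Qed.

End WintBounds.

Section Existence.
Variables (R : realType) (s : nat).

(** An interval of mass [T / N] is shorter than [rho] as soon as all intervals of length
    [rho] are heavier. *)
Lemma arcs (W : R -> R) N (rho : R) : periodic_weight W -> doubling (2 ^+ s) W ->
  (0 < N)%N -> 0 < rho ->
  (forall a, interval_mass W (- pi) pi < N%:R * interval_mass W a (a + rho)) ->
  exists tau : nat -> R, [/\ tau 0%N = - pi, tau N = pi,
    nodes_quantile W N (fun i => tau i.+1) &
    forall i, (i < N)%N -> - pi <= tau i /\ tau i <= tau i.+1 <= tau i + rho /\
       interval_mass W (tau i) (tau i.+1) = interval_mass W (- pi) pi / N%:R].
Proof.
move=> Ww Wd N0 rho0 big; set T := interval_mass W (- pi) pi in big *.
have T0 : 0 < T by exact: (total_mass_gt0 Ww Wd).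
have NR : 0 < N%:R :> R by rewrite ltr0n.
have [tau tauP] := quantile_exists Ww Wd N0; rewrite -/T in tauP.
have inj a b : - pi <= a -> a <= b -> interval_mass W (- pi) a = interval_mass W (- pi) b -> a = b.
  move=> pa ab E; apply/eqP; rewrite eq_le ab leNgt; apply/negP => lt.
  have := mass_gt0 Ww Wd lt; have := mass_add Ww Wd pa ab; lra.
have m00 : interval_mass W (- pi) (- pi) = 0.
  by have := mass_add Ww Wd (lexx (- pi : R)) (lexx _); lra.
exists tau; split.
- have [/andP[h1 h2] E] := tauP 0%N isT; apply/esym/inj => //.
  by rewrite E m00 !mul0r.
- have [/andP[h1 h2] E] := tauP N (leqnn N); apply/inj => //.
  by rewrite E -/T mulrC mulrA mulVf ?mul1r // gt_eqF.
- by move=> i iN; exact: tauP.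
move=> i iN; have [/andP[h1 h2] E] := tauP i (ltnW iN); have [/andP[h3 h4] E'] := tauP i.+1 iN.
have TN : 0 < T / N%:R by rewrite divr_gt0.
have EE : interval_mass W (- pi) (tau i.+1) = interval_mass W (- pi) (tau i) + T / N%:R.
  by rewrite E E' -[i.+1%:R]natr1; ring.
have le1 : tau i <= tau i.+1.
  rewrite leNgt; apply/negP => lt.
  by have := mass_le Ww Wd (lexx (- pi)) (ltW lt); lra.
have ma : interval_mass W (tau i) (tau i.+1) = T / N%:R.
  by have := mass_add Ww Wd h1 le1; lra.
split=> //; split=> //; rewrite le1 /= leNgt; apply/negP => lt.
have := mass_le Ww Wd (lexx (tau i)) (ltW lt); rewrite ma leNgt => /negP; apply.
by rewrite ltr_pdivrMr // mulrC.
Qed.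

Lemma wint_arcs (W : R -> R) (tau : nat -> R) N (f : R -> R) :
  periodic_weight W -> doubling (2 ^+ s) W -> continuous f ->
  (forall i, (i < N)%N -> tau i <= tau i.+1) ->
  weighted_integral W (tau 0%N) (tau N) f = \sum_(i < N) weighted_integral W (tau i) (tau i.+1) f.
Proof.
move=> Ww Wd cf; have L0 : 0 <= 2 ^+ s :> R by exact: exprn_ge0.
elim: N => [|N IH] mono.
  have := wint_add Ww Wd L0 cf (lexx (tau 0%N)) (lexx _); rewrite big_ord0; lra.
rewrite big_ord_recr /= -IH => [|i iN]; last exact/mono/ltnW.
apply: (wint_add Ww Wd L0 cf); last exact: mono.
elim: N mono {IH} => [|N IH] mono //.
apply: le_trans (IH _) (mono N _) => // i iN; exact/mono/ltnW.
Qed.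

(** If every ball has mass at least [C0 * T / N], every interval of length [rho] or
    [mz_fine n], which are fixed multiples of [1 / n], is heavier than the nodes
    it has to carry.  The initial defect is at most [rho] times the sum of the maxima of
    [|p']| near the nodes, and [rho] is so small that the Newton iteration
    stays within the range where [node_sums] applies. *)
Lemma quadrature_exists : exists2 C0 : R, 0 < C0 &
  forall (W : R -> R) (n N : nat), periodic_weight W -> doubling (2 ^+ s) W -> (0 < n)%N ->
    (forall x, C0 * interval_mass W (- pi) pi <= N%:R * interval_mass W (x - n%:R^-1) (x + n%:R^-1)) ->
    exists x : nat -> R, forall p, trig_polynomial n p ->
      weighted_integral W (- pi) pi p = \sum_(i < N) interval_mass W (- pi) pi / N%:R * p (x i).
Proof.
have [C1 C1_ge1 sums] := node_sums R s.
pose mP : R := (mz_coarse R s)%:R * (mz_split s)%:R.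
have mP1 : 1 <= mP by rewrite /mP -natrM ler1n muln_gt0.
(* The summand [mP] makes [2 * b0 = 1 / (C * n)] at most [mz_fine n / 4]. *)
pose C := C1 + mP.
have C1' : 1 <= C by rewrite /C; lra.
pose K (y : R) : R := (2 * y) ^+ s.
have K0 y : 1 <= y -> 0 < K y by move=> y1; rewrite exprn_gt0 //; lra.
have CC : 1 <= 4 * C ^+ 2 by have : 1 <= C ^+ 2 by [rewrite exprn_ege1]; lra.
exists (2 * K mP + 2 * K (4 * C ^+ 2)).
  by have := K0 _ mP1; have := K0 _ CC; lra.
move=> W n N Ww Wd n0 big; set T := interval_mass W (- pi) pi in big *.
have T0 : 0 < T by exact: (total_mass_gt0 Ww Wd).
have nR : 0 < n%:R :> R by rewrite ltr0n.
have N0 : (0 < N)%N.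
  rewrite lt0n; apply/eqP => N00; have := big 0; rewrite N00 mul0r leNgt => /negP; apply.
  by rewrite mulr_gt0 //; have := K0 _ mP1; have := K0 _ CC; lra.
have NR : 0 < N%:R :> R by rewrite ltr0n.
have L0 : 0 <= 2 ^+ s :> R by exact: exprn_ge0.
have heavy (y ell a : R) : 1 <= y -> 0 < ell -> n%:R^-1 <= y * (ell / 2) ->
    (2 * K mP + 2 * K (4 * C ^+ 2)) * T <= N%:R * (K y * interval_mass W a (a + ell)).
  move=> y1 l0 yl; apply: le_trans (big (a + ell / 2)) _; apply: ler_wpM2l => //.
  have e : a + ell - a = ell by rewrite addrAC subrr add0r.
  by apply: (mass_compare Ww Wd) => //; rewrite ?e ?ltrDl //; lra.
pose eta := mz_fine R s n; have eta0 : 0 < eta by exact: mz_fine_gt0.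
have etaE : eta * mP = 2 * pi / n%:R.
  by rewrite -(mz_stepE R s n0) -(mz_fineE R s n) /mP -/eta; ring.
have nV : 0 < n%:R^-1 :> R by rewrite invr_gt0.
have p2 := pi_ge2 R.
have HnV : 4 * n%:R^-1 <= 2 * pi / n%:R :> R by apply: ler_wpM2r; [exact: ltW | lra].
have fine k : 2 * T <= N%:R * piece_mass W eta k.
  have := @heavy mP eta (pt eta k) mP1 eta0; rewrite -ptS -/(piece_mass W eta k).
  have -> : mP * (eta / 2) = (eta * mP) / 2 by ring.
  have e : n%:R^-1 <= eta * mP / 2 by rewrite etaE; lra.
  move=> /(_ e) h.
  have KmP := K0 _ mP1; have KC := K0 _ CC.
  rewrite -(ler_pM2l KmP) [leRHS]mulrCA; apply: le_trans h.
  by have := mulr_gt0 KC T0; lra.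
(* This gives [C * n * b0 = 1 / 2] for [b0 = rho * C]. *)
pose rho : R := (2 * C ^+ 2 * n%:R)^-1.
have C2 : 0 < C ^+ 2 by rewrite exprn_gt0 //; lra.
have rho0 : 0 < rho by rewrite /rho invr_gt0 mulr_gt0 // mulr_gt0.
have rhoE : rho * (2 * C ^+ 2) = n%:R^-1.
  by rewrite /rho; field; rewrite !gt_eqF //; lra.
have arc a : T < N%:R * interval_mass W a (a + rho).
  have h := @heavy (4 * C ^+ 2) rho a CC rho0.
  have e : 4 * C ^+ 2 * (rho / 2) = n%:R^-1 by rewrite -rhoE; field.
  rewrite e in h; have {}h := h (lexx _).
  have KmP := K0 _ mP1; have KC := K0 _ CC.
  rewrite -(ltr_pM2l KC) [ltRHS]mulrCA; apply: lt_le_trans h.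
  by have := mulr_gt0 KC T0; have := mulr_gt0 KmP T0; lra.
have [tau [tau0 tauN tq tauP]] := arcs Ww Wd N0 rho0 arc.
pose theta i := tau i.+1; pose H : R := 2 * pi / n%:R.
have rhoH : rho <= H.
  rewrite /H; apply: le_trans HnV; rewrite -rhoE.
  have c1 : 1 <= 2 * C ^+ 2 * 4 by lra.
  by have := ler_wpM2l (ltW rho0) c1; lra.
pose b0 := rho * C.
have ccst (c : R) : continuous (fun _ : R => c) by move=> x; exact: cvg_cst.
have [||||||||x xE] := @newton_solution R n N theta (eta / 4) H (C * n%:R) b0
   (fun p => N%:R / T * weighted_integral W (- pi) pi p).
- move=> c p q tp tq'; rewrite (wint_lin Ww Wd L0) ?(trig_continuous tp) ?(trig_continuous tq') //; first ring.
  + exact: trig_continuous tp.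
  + exact: trig_continuous tq'.
- by rewrite /b0 mulr_ge0 ?(ltW rho0) //; lra.
- have : eta <= eta * mP by apply: ler_peMr; [exact: ltW | exact: mP1].
  rewrite etaE -/H; lra.
- have e : 2 * b0 * C = n%:R^-1 by rewrite -rhoE /b0; ring.
  have : eta * mP <= eta * C by rewrite ler_pM2l // /C; lra.
  rewrite etaE => h.
  rewrite -(ler_pM2r (lt_le_trans ltr01 C1')) e; lra.
- by rewrite mulr_ge0 //; lra.
- have -> : C * n%:R * b0 = rho * (2 * C ^+ 2) * n%:R / 2 by rewrite /b0; field.
  by rewrite rhoE mulVf ?gt_eqF // mul1r.
- move=> x q xn trq; have [_ h] := sums W n N theta x q Ww Wd n0 N0 tq fine xn trq.
  apply: le_trans h _; apply: ler_wpM2r; first exact: sumr_ge0.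
  by apply: ler_wpM2r => //; rewrite /C; lra.
- move=> p tp; have [tp' dp] := trig_deriv tp; have cp' := trig_continuous tp'; have cp := trig_continuous tp.
  have tn : near_nodes N theta theta (eta / 4).
    by move=> i iN; rewrite subrr normr0 divr_ge0 // ltW.
  have [h _] := sums W n N theta theta (derive1 p) Ww Wd n0 N0 tq fine tn tp'.
  apply: le_trans (_ : rho * \sum_(i < N) sup_on (derive1 p) (theta i - H) (theta i + H) <= _); last first.
    rewrite /b0 -mulrA; apply: ler_wpM2l; first exact: ltW.
    apply: le_trans h _; apply: ler_wpM2r; first exact: sumr_ge0.
    by rewrite /C; lra.
  rewrite /defect -{1}tau0 -{1}tauN (wint_arcs Ww Wd cp) => [|i /tauP [_ [/andP[]]] //].
  rewrite mulr_sumr -sumrB; apply: le_trans (ler_norm_sum _ _ _) _.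
  rewrite mulr_sumr; apply: ler_sum => i _.
  have [_ [/andP[t1 t2] mi]] := tauP i (ltn_ord i); rewrite -/T in mi.
  have near t : tau i <= t <= tau i.+1 ->
     `|p t - p (theta i)| <= rho * sup_on (derive1 p) (theta i - H) (theta i + H).
    move=> /andP[u1 u2].
    have := @lipschitz_bound R p (derive1 p) (theta i - H) (theta i + H) (theta i) t _ dp
      (fun t => le_sup_on cp').
    have hH : 0 < H by lra.
    have z0 : 0 <= sup_on (derive1 p) (theta i - H) (theta i + H) by apply: sup_on_ge0 => //; lra.
    move=> /(_ _ _)/le_trans; apply; rewrite /theta; try (apply/andP; split; lra).
    rewrite mulrC; apply: ler_wpM2r => //.
    by rewrite ler0_norm; lra.
  have := wint_near_cst Ww Wd cp near; rewrite mi => hh.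
  have NT : 0 < N%:R / T by rewrite divr_gt0.
  have NTE : N%:R / T * (T / N%:R) = 1 by field; rewrite !gt_eqF.
  have -> : p (theta i) - N%:R / T * weighted_integral W (tau i) (tau i.+1) p =
     - (N%:R / T * (weighted_integral W (tau i) (tau i.+1) p - p (theta i) * (T / N%:R))).
    by rewrite mulrBr [_ * (p _ * _)]mulrCA NTE mulr1; ring.
  rewrite normrN normrM gtr0_norm //; apply: le_trans (ler_wpM2l (ltW NT) hh) _.
  by rewrite [leLHS]mulrCA NTE mulr1.
exists x => p tp; rewrite -mulr_sumr xE //.
by rewrite mulrA; have -> : T / N%:R * (N%:R / T) = 1 by [field; rewrite !gt_eqF]; rewrite mul1r.
Qed.

End Existence.

(** * Integrals of rapidly decaying functions *)

Section Tails.
Variables (R : realType) (s : nat).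

Lemma periodic_representative (x y : R) : exists2 y', `|x - y'| <= pi &
  forall g : R -> R, (forall t, g (t + 2 * pi) = g t) -> g y' = g y.
Proof.
have p0 := pi_gt0 R; have p20 : 0 < 2 * pi :> R by lra.
pose k := Num.floor ((x - y + pi) / (2 * pi)).
exists (y + k%:~R * (2 * pi)); last first.
  move=> g pg; have nat_per m t : g (t + m%:R * (2 * pi)) = g t.
    elim: m => [|m IH]; first by rewrite mul0r addr0.
    by rewrite -[m.+1%:R]natr1 mulrDl mul1r addrA pg.
  case: k => m; first exact: nat_per.
  by rewrite -[LHS](nat_per m.+1) NegzE mulrNz; congr g; ring.
have := floor_itv ((x - y + pi) / (2 * pi)); rewrite -/k => /andP[k1 k2].
move: k1 k2; rewrite ler_pdivlMr // ltr_pdivrMr // intrD mulrDl mul1r => k1 k2.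
by rewrite ler_norml; apply/andP; split; lra.
Qed.

Variable W : R -> R.
Hypothesis W_weight : periodic_weight W.
Hypothesis W_doubling : doubling (2 ^+ s) W.
Local Notation mass := (interval_mass W).
Local Notation wint := (weighted_integral W).
Local Notation T := (mass (- pi) pi).
Let L0 : 0 <= 2 ^+ s :> R. Proof. exact: exprn_ge0. Qed.

(** Moving the left end by at most a period removes an integral at one end and adds
    its translate at the other. *)
Lemma wint_period (f : R -> R) (a b : R) : continuous f -> (forall t, f (t + 2 * pi) = f t) ->
  wint a (a + 2 * pi) f = wint b (b + 2 * pi) f.
Proof.
move=> cf pf; have p0 := pi_gt0 R.
have near (u v : R) : u <= v -> v <= u + 2 * pi ->
    wint u (u + 2 * pi) f = wint v (v + 2 * pi) f.
  move=> uv vu.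
  rewrite (wint_add W_weight W_doubling L0 cf uv vu).
  have vu2 : u + 2 * pi <= v + 2 * pi by lra.
  rewrite (wint_add W_weight W_doubling L0 cf vu vu2).
  by rewrite (wint_shift W_weight) // addrC.
have [b' ab' per] := periodic_representative a b.
rewrite -(per (fun u => wint u (u + 2 * pi) f)); last first.
  by move=> t; rewrite (wint_shift W_weight).
move: ab'; rewrite ler_norml => /andP[h1 h2].
have [h|/ltW h] := leP a b'; first by apply: near; lra.
by apply/esym/near; lra.
Qed.

Variable n : nat.
Hypothesis n0 : (0 < n)%N.
Let nR : 0 < n%:R :> R. Proof. by rewrite ltr0n. Qed.
Local Notation r := (n%:R^-1 : R).
Local Notation ball_mass y := (mass (y - r) (y + r)).

Let r0 : 0 < r. Proof. by rewrite invr_gt0. Qed.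

Definition tail_const : R := 4 * (2 ^+ (s + 2) * 8 ^+ s).

Lemma tail_piece (f : R -> R) (y a b K : R) (d : nat) : continuous f -> 0 <= K ->
  (forall t, `|t - y| <= pi -> `|f t| * (1 + n%:R * `|t - y|) ^+ (s + 2) <= K) ->
  (forall t, a <= t <= b -> `|t - y| <= pi /\ pi * d%:R * r <= `|t - y| <= pi * d.+1%:R * r) ->
  a <= b ->
  `|wint a b f| <= K * (2 ^+ (s + 2) * 8 ^+ s) * ((1 + d.+1%:R) ^+ 2)^-1 * ball_mass y.
Proof.
move=> cf K0 fK tab ab; have p2 := pi_ge2 R; have p4 := pi_le4 R.
have d0 : 0 <= d%:R :> R by [].
have dS : d.+1%:R = d%:R + 1 :> R by rewrite natr1.
set b' : R := 1 + d.+1%:R; have b'1 : 1 <= b' by rewrite /b' lerDl.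
have b'0 : 0 < b' by lra.
pose e := K * 2 ^+ (s + 2) / b' ^+ (s + 2).
have fe t : a <= t <= b -> `|f t - 0| <= e.
  move=> /tab [tpi /andP[t1 t2]]; rewrite subr0 /e ler_pdivlMr ?exprn_gt0 //.
  have h : b' <= 2 * (1 + n%:R * `|t - y|).
    have : n%:R * (pi * d%:R * r) <= n%:R * `|t - y| by apply: ler_wpM2l => //; exact: ltW.
    have -> : n%:R * (pi * d%:R * r) = pi * d%:R by field; rewrite gt_eqF.
    by have := ler_wpM2r d0 p2; rewrite /b' dS; lra.
  apply: le_trans (_ : `|f t| * (2 * (1 + n%:R * `|t - y|)) ^+ (s + 2) <= _).
    apply: ler_wpM2l => //; apply: lerXn2r; rewrite ?nnegrE; [exact: ltW | | exact: h].
    exact: le_trans (ltW b'0) h.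
  rewrite exprMn mulrCA [leRHS]mulrC; apply: ler_wpM2l; first exact: exprn_ge0.
  exact: fK.
have := wint_near_cst W_weight W_doubling cf fe; rewrite mul0r subr0 => /le_trans; apply.
have e0 : 0 <= e by rewrite /e divr_ge0 ?mulr_ge0 ?exprn_ge0 // ltW.
have mb : mass a b <= (8 * b') ^+ s * ball_mass y.
  apply: le_trans (_ : mass (y - 4 * b' * r) (y + 4 * b' * r) <= _).
    have abI t : a <= t <= b -> `|t - y| <= 4 * b' * r.
      move=> /tab [_ /andP[_ h]]; apply: le_trans h _; apply: ler_wpM2r; first exact: ltW.
      apply: ler_pM => //; [lra | by rewrite /b'; lra].
    have := abI a; have := abI b; rewrite !lexx ab => /(_ isT) + /(_ isT).
    rewrite !ler_norml => /andP[h1 h2] /andP[h3 h4].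
    by apply: (mass_le W_weight W_doubling); lra.
  have -> : 8 * b' = 2 * (4 * b') by ring.
  by apply: (mass_growth W_weight W_doubling) => //; lra.
apply: le_trans (ler_wpM2l e0 mb) _.
rewrite le_eqVlt; apply/orP; left; apply/eqP.
rewrite /e exprMn [b' ^+ (s + 2)]exprD; field.
by rewrite !expf_neq0 // gt_eqF.
Qed.

(** At distance between [pi d / n] and [pi (d + 1) / n] from [y] the function is at most
    of order [(1 + d) ^ (- s - 2)], while the mass is at most of order [(1 + d) ^ s]. *)
Lemma tail_integral (f : R -> R) (y K : R) : continuous f ->
  (forall t, f (t + 2 * pi) = f t) -> 0 <= K ->
  (forall t, `|t - y| <= pi -> `|f t| * (1 + n%:R * `|t - y|) ^+ (s + 2) <= K) ->
  wint (- pi) pi f <= K * tail_const * ball_mass y.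
Proof.
move=> cf pf K0 fK; have p0 := pi_gt0 R; have r0' := r0; have nR' := nR.
have -> : wint (- pi) pi f = wint (y - pi) (y + pi) f.
  have := wint_period (- pi) (y - pi) cf pf.
  have -> : - pi + 2 * pi = pi :> R by ring.
  by have -> : y - pi + 2 * pi = y + pi by ring.
have h1 : y - pi <= y by lra.
have h2 : y <= y + pi by lra.
rewrite (wint_add W_weight W_doubling L0 cf h1 h2).
have rn : n%:R * r = 1 by rewrite mulfV // gt_eqF.
have m0 : 0 <= ball_mass y by exact: (mass_ge0 W_weight).
have pr0 : 0 < pi * r by rewrite mulr_gt0.
set c := K * (2 ^+ (s + 2) * 8 ^+ s).
have c0 : 0 <= c by rewrite !mulr_ge0 ?exprn_ge0.
have right_half : wint y (y + pi) f <= c * ball_mass y * 2.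
  pose tau i : R := y + pi * i%:R * r.
  have E0 : tau 0%N = y by rewrite /tau mulr0 mul0r addr0.
  have E : tau n = y + pi by rewrite /tau -mulrA rn mulr1.
  rewrite -{1}E0 -E.
  have tauS i : tau i.+1 = tau i + pi * r by rewrite /tau -[i.+1%:R]natr1; ring.
  rewrite (wint_arcs W_weight W_doubling cf); last by move=> i _; rewrite tauS lerDl ltW.
  apply: le_trans (_ : \sum_(i < n) c * ball_mass y * ((1 + i%:R) ^+ 2)^-1 <= _); last first.
    rewrite -mulr_sumr; apply: ler_wpM2l; first exact: mulr_ge0.
    exact: sum_inv_sqr.
  apply: ler_sum => i _; apply: le_trans (ler_norm _) _.
  apply: le_trans (tail_piece (y := y) (d := i) cf K0 fK _ _) _.
  - move=> t; rewrite tauS /tau => /andP[t1 t2].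
    have i0 : 0 <= pi * i%:R * r by rewrite !mulr_ge0 // ltW.
    have i1 : pi * i.+1%:R * r = pi * i%:R * r + pi * r by rewrite -[i.+1%:R]natr1; ring.
    have i2 : pi * i.+1%:R * r <= pi.
      have : i.+1%:R <= n%:R :> R by rewrite ler_nat.
      move=> /(ler_wpM2r (ltW r0')); rewrite rn => /(ler_wpM2l (ltW p0)).
      by rewrite mulr1 mulrA.
    by rewrite ger0_norm; [split; [lra | apply/andP; split; lra] | lra].
  - by rewrite tauS lerDl ltW.
  rewrite -/c mulrAC; apply: ler_wpM2l; first exact: mulr_ge0.
  have i0 : 0 <= i%:R :> R by [].
  rewrite lef_pV2 ?posrE ?exprn_gt0 //; try by rewrite ltr_pwDl.
  by apply: lerXn2r; rewrite ?nnegrE ?addr_ge0 // lerD2l ler_nat.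
have left_half : wint (y - pi) y f <= c * ball_mass y * 2.
  pose tau i : R := y - pi + pi * i%:R * r.
  have E0 : tau 0%N = y - pi by rewrite /tau mulr0 mul0r addr0.
  have E : tau n = y by rewrite /tau -mulrA rn mulr1 subrK.
  rewrite -E0 -[X in wint _ X _]E.
  have tauS i : tau i.+1 = tau i + pi * r by rewrite /tau -[i.+1%:R]natr1; ring.
  rewrite (wint_arcs W_weight W_doubling cf); last by move=> i _; rewrite tauS lerDl ltW.
  apply: le_trans (_ : \sum_(i < n) c * ball_mass y * ((1 + (n - i)%:R) ^+ 2)^-1 <= _); last first.
    rewrite -mulr_sumr; apply: ler_wpM2l; first exact: mulr_ge0.
    exact: sum_inv_sqr_rev.
  apply: ler_sum => i _; apply: le_trans (ler_norm _) _.
  have iE : (n - i.+1).+1 = (n - i)%N by rewrite -subSn.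
  apply: le_trans (tail_piece (y := y) (d := (n - i.+1)%N) cf K0 fK _ _) _.
  - move=> t; rewrite tauS /tau => /andP[t1 t2].
    have i0 : 0 <= pi * i%:R * r by rewrite !mulr_ge0 // ltW.
    have dE : pi * (n - i.+1)%:R * r = pi - pi * i%:R * r - pi * r.
      rewrite natrB // -[i.+1%:R]natr1.
      have -> : pi * (n%:R - (i%:R + 1)) * r = pi * (n%:R * r) - pi * i%:R * r - pi * r by ring.
      by rewrite rn mulr1.
    have d0 : 0 <= pi * (n - i.+1)%:R * r by rewrite !mulr_ge0 // ltW.
    have dS : pi * (n - i.+1).+1%:R * r = pi * (n - i.+1)%:R * r + pi * r.
      by rewrite -[(n - i.+1).+1%:R]natr1; ring.
    by rewrite ler0_norm; [split; [lra | apply/andP; split; lra] | lra].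
  - by rewrite tauS lerDl ltW.
  by rewrite iE -/c mulrAC.
have -> : K * tail_const * ball_mass y = c * ball_mass y * 2 + c * ball_mass y * 2.
  by rewrite /tail_const /c; ring.
exact: lerD.
Qed.

End Tails.

(** * Lower bound for the number of nodes *)

Section NodeCount.
Variables (R : realType) (s : nat).

(** Large enough for the test polynomial of [node_count_ge] to have positive integral. *)
Definition node_kappa : R := 4 ^+ (s + 2) * (jackson_const R (s + 2) * tail_const R s + 1).
Definition lower_const : R :=
  jackson_const R (s + 2) * tail_const R s * (2 * (8 * node_kappa + 1)) ^+ s.

Lemma tail_const_gt0 : 0 < tail_const R s.
Proof. by rewrite !mulr_gt0 ?exprn_gt0. Qed.

Lemma jackson_const_gt0 e : 0 < jackson_const R e.
Proof. by rewrite exprn_gt0 // ltr_pwDl // mulr_ge0 // exprn_ge0. Qed.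

Lemma node_kappa_ge1 : 1 <= node_kappa.
Proof.
have h : 1 <= 4 ^+ (s + 2) :> R by rewrite exprn_ege1 // ler1n.
have := mulr_gt0 (jackson_const_gt0 (s + 2)) tail_const_gt0 => h2.
rewrite -[leLHS]mulr1; apply: ler_pM => //; lra.
Qed.

Lemma lower_const_gt0 : 0 < lower_const.
Proof.
have := node_kappa_ge1 => h.
rewrite mulr_gt0 ?exprn_gt0 ?mulr_gt0 ?tail_const_gt0 ?jackson_const_gt0 //; lra.
Qed.

Variable W : R -> R.
Hypothesis W_weight : periodic_weight W.
Hypothesis W_doubling : doubling (2 ^+ s) W.
Local Notation mass := (interval_mass W).
Local Notation wint := (weighted_integral W).
Local Notation T := (mass (- pi) pi).
Variable n : nat.
Hypothesis n0 : (0 < n)%N.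
Let nR : 0 < n%:R :> R. Proof. by rewrite ltr0n. Qed.
Local Notation r := (n%:R^-1 : R).
Local Notation e := (s + 2)%N.
Local Notation J y := (fun t => jackson n e (t - y)).
Let L0 : 0 <= 2 ^+ s :> R. Proof. exact: exprn_ge0. Qed.

Lemma peak_trig (y : R) : trig_polynomial n.-1 (J y).
Proof. exact: (trig_translate (- y) (jackson_trig R n e)). Qed.

Lemma peak_integral_le (y : R) :
  wint (- pi) pi (J y) <= jackson_const R e * tail_const R s * mass (y - r) (y + r).
Proof.
have tJ := peak_trig y.
apply: (tail_integral W_weight W_doubling n0 (trig_continuous tJ) (trig_periodic tJ)).
  exact: ltW (jackson_const_gt0 _).
move=> t tpi; have e0 : (0 < e)%N by rewrite addn2.
apply: le_trans (jackson_decay n0 e0 tpi).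
rewrite ger0_norm ?jackson_ge0 //; apply: ler_wpM2l; first exact: jackson_ge0.
apply: ler_weXn2l; last by rewrite leq_pmull.
by rewrite lerDl mulr_ge0.
Qed.

(** [1 - cos (t - y)] is at most [|t - y| ^ 2], which costs two orders of the decay and
    gains the factor [n ^ (- 2)]. *)
Lemma peak_moment_le (y : R) :
  wint (- pi) pi (fun t => (1 - cos (t - y)) * jackson n e (t - y)) <=
    r ^+ 2 * jackson_const R e * tail_const R s * mass (y - r) (y + r).
Proof.
have tJ := peak_trig y.
have tc : trig_polynomial 1 (fun t => 1 - cos (t - y)).
  apply: trig_ext (trig_translate (- y) (trig_lin (-1) (trig_cos R (leqnn 1)) (trig_cst 1 1))) => t.
  by rewrite /= mul1r mulN1r addrC.
have tp := trig_mul tc tJ.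
apply: (tail_integral W_weight W_doubling n0 (trig_continuous tp) (trig_periodic tp)).
  by rewrite mulr_ge0 ?exprn_ge0 ?invr_ge0 // ltW // jackson_const_gt0.
move=> t tpi; have e0 : (0 < e)%N by rewrite addn2.
have J0 := jackson_ge0 n e (t - y).
have c0 : 0 <= 1 - cos (t - y) by rewrite subr_ge0 cos_le1.
rewrite ger0_norm ?mulr_ge0 //.
have nr : 0 <= n%:R * `|t - y| by rewrite mulr_ge0.
set Q := 1 + n%:R * `|t - y|; have Q1 : 1 <= Q by rewrite /Q lerDl.
have h : 1 - cos (t - y) <= r ^+ 2 * Q ^+ 2.
  apply: le_trans (one_sub_cos_le _) _.
  have -> : r ^+ 2 * Q ^+ 2 = (r * Q) ^+ 2 by rewrite exprMn.
  apply: le_trans (_ : `|t - y| ^+ 2 <= _).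
    by rewrite real_normK ?num_real //; have := sqr_ge0 (t - y); lra.
  apply: lerXn2r; rewrite ?nnegrE // ?mulr_ge0 ?invr_ge0 //; first lra.
  rewrite /Q mulrDr mulr1 mulKf ?gt_eqF // lerDr invr_ge0; exact: ltW.
apply: le_trans (_ : r ^+ 2 * Q ^+ 2 * jackson n e (t - y) * Q ^+ e <= _).
  apply: ler_wpM2r; first by rewrite exprn_ge0 //; lra.
  exact: ler_wpM2r.
have -> : r ^+ 2 * Q ^+ 2 * jackson n e (t - y) * Q ^+ e =
  r ^+ 2 * (jackson n e (t - y) * Q ^+ (2 + e)) by rewrite [Q ^+ (2 + e)]exprD; set Z := Q ^+ e; ring.
apply: ler_wpM2l; first by rewrite exprn_ge0 // invr_ge0.
apply: le_trans (jackson_decay n0 e0 tpi).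
apply: ler_wpM2l => //; apply: ler_weXn2l => //; lia.
Qed.

Lemma peak_integral_ge (y : R) :
  (4 ^+ e)^-1 * mass (y - r) (y + r) <= wint (- pi) pi (J y).
Proof.
have tJ := peak_trig y; have cJ := trig_continuous tJ.
have p2 := pi_ge2 R.
have r0 : 0 < r by rewrite invr_gt0.
have r1 : r <= 1 by rewrite invf_le1 // ler1n.
have ccst (c : R) : continuous (fun _ : R => c) by move=> x; exact: cvg_cst.
have J_ge0 a b : a <= b -> 0 <= wint a b (J y).
  move=> ab; have := wint_le W_weight W_doubling L0 (a := a) (b := b) (@ccst 0) cJ.
  rewrite (wint_cst W_weight W_doubling) mul0r; apply => t _; exact: jackson_ge0.
have -> : wint (- pi) pi (J y) = wint (y - pi) (y + pi) (J y).
  have := wint_period W_weight W_doubling (- pi) (y - pi) cJ (trig_periodic tJ).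
  have -> : - pi + 2 * pi = pi :> R by ring.
  by have -> : y - pi + 2 * pi = y + pi by ring.
have h1 : y - pi <= y - r by lra.
have h2 : y - r <= y + pi by lra.
have h3 : y - r <= y + r by lra.
have h4 : y + r <= y + pi by lra.
rewrite (wint_add W_weight W_doubling L0 cJ h1 h2) (wint_add W_weight W_doubling L0 cJ h3 h4).
have m1 := J_ge0 _ _ h1; have m2 := J_ge0 _ _ h4.
have : wint (y - r) (y + r) (fun=> (4 ^+ e)^-1) <= wint (y - r) (y + r) (J y).
  apply: (wint_le W_weight W_doubling L0 (@ccst _) cJ) => t /andP[t1 t2].
  by apply: jackson_ge => //; rewrite ler_norml; apply/andP; split; lra.
rewrite (wint_cst W_weight W_doubling); lra.
Qed.

(** A node within [8 * node_kappa / n] of [y] modulo the period is found by integrating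
    [p]; the kernel centred at it bounds the common weight. *)
Lemma node_count_ge (N : nat) (x : 'I_N -> R) :
  (forall p, trig_polynomial n p -> wint (- pi) pi p = \sum_(i < N) T / N%:R * p (x i)) ->
  forall y, T <= lower_const * N%:R * mass (y - r) (y + r).
Proof.
move=> quad y; have nR' := nR; have r0 : 0 < r by rewrite invr_gt0.
have T0 : 0 < T by exact: (total_mass_gt0 W_weight W_doubling).
have m0 := mass_ball_gt0 W_weight W_doubling y r0.
have k1 := node_kappa_ge1; have jt := mulr_gt0 (jackson_const_gt0 e) tail_const_gt0.
set kap := node_kappa in k1.
pose p t := (kap * r ^+ 2 - (1 - cos (t - y))) * jackson n e (t - y).
have tJ := peak_trig y; have cJ := trig_continuous tJ.
have tc : trig_polynomial 1 (fun t => 1 - cos (t - y)).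
  apply: trig_ext (trig_translate (- y) (trig_lin (-1) (trig_cos R (leqnn 1)) (trig_cst 1 1))) => t.
  by rewrite /= mul1r mulN1r addrC.
have tcJ := trig_mul tc tJ.
have ctcJ : continuous (fun t => (1 - cos (t - y)) * jackson n e (t - y)) := trig_continuous tcJ.
have nE : (1 + n.-1)%N = n by rewrite add1n prednK.
have nn : (n.-1 <= n)%N by exact: leq_pred.
have pE : p = fun t => -1 * ((1 - cos (t - y)) * jackson n e (t - y)) + kap * r ^+ 2 * jackson n e (t - y).
  by apply/funext => t; rewrite /p; ring.
have tkJ : trig_polynomial n (fun t => kap * r ^+ 2 * jackson n e (t - y)).
  exact: trigZ (trig_le nn tJ).
have tp : trig_polynomial n p.
  by rewrite pE; apply: trig_lin => //; rewrite -[X in trig_polynomial X _]nE.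
have r2 : 0 < r ^+ 2 by rewrite exprn_gt0.
have pos : 0 < wint (- pi) pi p.
  rewrite pE (wint_lin W_weight W_doubling L0) //; last exact: trig_continuous tkJ.
    have -> : wint (- pi) pi (fun t => kap * r ^+ 2 * jackson n e (t - y)) =
       kap * r ^+ 2 * wint (- pi) pi (J y).
      have c0 : continuous (fun _ : R => 0 : R) by move=> z; exact: cvg_cst.
      have := wint_lin W_weight W_doubling L0 (- pi) pi (kap * r ^+ 2) cJ c0.
      rewrite (wint_cst W_weight W_doubling) mul0r addr0 => <-.
      by congr (weighted_integral _ _ _ _); apply: funext => t; rewrite addr0.
    have h1 := peak_moment_le y; have h2 := peak_integral_ge y.
    have kr : 0 <= kap * r ^+ 2 by rewrite mulr_ge0 ?(ltW r2) //; lra.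
    have := ler_wpM2l kr h2.
    have -> : kap * r ^+ 2 * ((4 ^+ e)^-1 * mass (y - r) (y + r)) =
      r ^+ 2 * (jackson_const R e * tail_const R s + 1) * mass (y - r) (y + r).
      have F0 : 4 ^+ e != 0 :> R by rewrite expf_neq0.
      rewrite /kap /node_kappa; set F := 4 ^+ e in F0 *; set D := jackson_const R e * _.
      by rewrite -/D; field; rewrite F0 gt_eqF.
    have := mulr_gt0 r2 m0; lra.
have N0 : (0 < N)%N.
  rewrite lt0n; apply/eqP => N00; move: pos; rewrite quad // big1 ?ltxx // => i _.
  by have := ltn_ord i; rewrite {2}N00.
have NR : 0 < N%:R :> R by rewrite ltr0n.
have [i pi_pos] : exists i, 0 < p (x i).
  apply: contrapT => no; move: pos; rewrite quad // ltNge => /negP; apply.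
  apply: sumr_le0 => i _; rewrite mulr_ge0_le0 ?divr_ge0 ?(ltW T0) // leNgt.
  by apply/negP => h; apply: no; exists i.
have close : 1 - cos (x i - y) < kap * r ^+ 2.
  rewrite ltNge; apply/negP => h; move: pi_pos; rewrite ltNge => /negP; apply.
  by rewrite /p mulr_le0_ge0 ?jackson_ge0 // subr_le0.
have [y' xy' per] := periodic_representative (x i) y.
have cper : cos (x i - y') = cos (x i - y).
  apply: (per (fun t => cos (x i - t))) => t.
  have := trig_periodic (trig_cos R (leqnn 1)) (x i - (t + 2 * pi)).
  by rewrite !mul1r => <-; congr cos; ring.
have mper : mass (y' - r) (y' + r) = mass (y - r) (y + r).
  apply: (per (fun t => mass (t - r) (t + r))) => t.
  by rewrite addrAC [t + 2 * pi + r]addrAC; exact: mass_shift.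
have dist : `|x i - y'| <= 8 * kap * r.
  have h := one_sub_cos_ge xy'; rewrite cper in h.
  (* [kap >= 1] replaces the square root of [8 * kap] by [8 * kap]. *)
  have sq : `|x i - y'| ^+ 2 <= (8 * kap * r) ^+ 2.
    rewrite real_normK ?num_real // exprMn.
    have : 8 * kap <= (8 * kap) ^+ 2 by rewrite expr2 ler_peMl //; lra.
    move=> /(ler_wpM2r (ltW r2)); lra.
  by rewrite ler_pXn2r ?nnegrE // in sq; rewrite !mulr_ge0 ?(ltW r0) //; lra.
have small : mass (x i - r) (x i + r) <= (2 * (8 * kap + 1)) ^+ s * mass (y - r) (y + r).
  rewrite -mper; apply: le_trans (_ : mass (y' - (8 * kap + 1) * r) (y' + (8 * kap + 1) * r) <= _).
    move: dist; rewrite ler_norml => /andP[d1 d2].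
    by apply: (mass_le W_weight W_doubling); lra.
  by apply: (mass_growth W_weight W_doubling) => //; lra.
have TN : 0 < T / N%:R by rewrite divr_gt0.
have one : T / N%:R <= wint (- pi) pi (J (x i)).
  rewrite quad; last exact: trig_le (peak_trig (x i)).
  rewrite (bigD1 i) //= subrr jackson0 mulr1 lerDl.
  by apply: sumr_ge0 => k _; rewrite mulr_ge0 ?jackson_ge0 // ltW.
have := le_trans one (peak_integral_le (x i)).
move/le_trans/(_ (ler_wpM2l (ltW jt) small)).
rewrite ler_pdivrMr // /lower_const -/kap => h.
by apply: le_trans h _; rewrite le_eqVlt; apply/orP; left; apply/eqP; ring.
Qed.

End NodeCount.

(** * Node numbers and the smallest mass of a ball *)

Section Assembly.
Variable R : realType.

Lemma doubling_weaken (L L' : R) (W : R -> R) : (forall t, 0 <= W t) -> L <= L' ->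
  doubling L W -> doubling L' W.
Proof.
move=> W0 LL dW d a d0; apply: le_trans (dW d a d0) _.
apply: lee_wpmul2r; last by rewrite lee_fin.
by apply: integral_ge0 => t _; rewrite lee_fin.
Qed.

Lemma sorted_nodes (N : nat) (x : nat -> R) : exists theta : 'I_N -> R,
  (forall i j : 'I_N, (i <= j)%N -> theta i <= theta j) /\
  forall p : R -> R, \sum_(i < N) p (theta i) = \sum_(i < N) p (x i).
Proof.
pose t := sort <=%R (mkseq x N).
have tN : size t = N by rewrite size_sort size_mkseq.
exists (fun i => nth 0 t i); split=> [i j ij|p].
  apply: (sorted_leq_nth le_trans lexx) => //; rewrite ?inE ?tN //.
  by apply: sort_sorted; exact: le_total.
rewrite -(big_mkord xpredT (fun i => p (nth 0 t i))) -{1}tN.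
rewrite -(big_nth 0 xpredT p) (perm_big (mkseq x N)) /=; last by rewrite perm_sort.
by rewrite big_map -{1}[N]subn0 big_mkord.
Qed.

Section Weight.
Variables (s : nat) (W : R -> R).
Hypothesis W_weight : periodic_weight W.
Hypothesis W_doubling : doubling (2 ^+ s) W.
Let L0 : 0 <= 2 ^+ s :> R. Proof. exact: exprn_ge0. Qed.
Local Notation mass := (interval_mass W).
Local Notation T := (mass (- pi) pi).
Variable n : nat.
Hypothesis n0 : (0 < n)%N.
Local Notation r := (n%:R^-1 : R).

Lemma mass_ball_ge (y : R) : T <= (8 * n%:R) ^+ s * mass (y - r) (y + r).
Proof.
have nR : 0 < n%:R :> R by rewrite ltr0n.
have n1 : 1 <= n%:R :> R by rewrite ler1n.
have r0 : 0 < r by rewrite invr_gt0.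
have p4 := pi_le4 R.
have -> : T = mass (y - pi) (y + pi).
  have c1 : continuous (fun _ : R => 1 : R) by move=> z; exact: cvg_cst.
  have := wint_period W_weight W_doubling (- pi) (y - pi) c1 (fun=> erefl).
  rewrite !wint1; have -> : - pi + 2 * pi = pi :> R by ring.
  by have -> : y - pi + 2 * pi = y + pi by ring.
(* The interval of radius [4 * n * r = 4] contains a period. *)
have -> : 8 * n%:R = 2 * (4 * n%:R) :> R by ring.
have n4 : 1 <= 4 * n%:R :> R by lra.
apply: le_trans (mass_growth W_weight W_doubling y r0 n4).
by apply: (mass_le W_weight W_doubling); rewrite -mulrA mulfV ?gt_eqF //; lra.
Qed.

(** By [mass_ball_ge] the infimum in [Rtrig] is at least [T / (8 n) ^ s], so that
    the ratio can be computed in the reals. *)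
Lemma min_ball_mass : exists m : R, [/\ 0 < m,
  ereal_inf (range (fun x : R => interval_integral (x - r) (x + r) W)) = m%:E,
  forall x, m <= mass (x - r) (x + r) &
  forall z, (forall x, z <= mass (x - r) (x + r)) -> z <= m].
Proof.
have mE := massE W_weight W_doubling L0.
set I := ereal_inf _.
have T0 := total_mass_gt0 W_weight W_doubling.
have K0 : 0 < (8 * n%:R) ^+ s :> R by rewrite exprn_gt0 // mulr_gt0 // ltr0n.
have lb : ((T / (8 * n%:R) ^+ s)%:E <= I)%E.
  apply: le_ereal_inf_tmp => _ [x _ <-]; rewrite mE lee_fin ler_pdivrMr // mulrC.
  exact: mass_ball_ge.
have ub x : (I <= (mass (x - r) (x + r))%:E)%E.
  by apply: ereal_inf_lbound; exists x => //; rewrite mE.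
have Ifin : I = (fine I)%:E.
  rewrite fineK // fin_numE; apply/andP; split; apply/eqP => E.
    by move: lb; rewrite E leeNy_eq.
  by have := ub 0; rewrite E leye_eq.
exists (fine I); split => //.
- have : 0 < T / (8 * n%:R) ^+ s by rewrite divr_gt0.
  by move/lt_le_trans; apply; rewrite -lee_fin -Ifin.
- by move=> x; rewrite -lee_fin -Ifin.
- move=> z zP; rewrite -lee_fin -Ifin.
  by apply: le_ereal_inf_tmp => _ [x _ <-]; rewrite mE lee_fin.
Qed.

End Weight.

End Assembly.

Theorem theorem1p2 (R : realType) (L : R) (hL : 2 <= L) :
  exists c C : R, 0 < c /\ 0 < C /\
    forall W : R -> R, periodic_weight W -> doubling L W ->
    forall n : nat, (1 <= n)%N ->
      [/\ (c%:E * Rtrig W n <= Ntrig W n)%E,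
          (Ntrig W n <= Ntrig_bar W n)%E &
          (Ntrig_bar W n <= C%:E * Rtrig W n)%E].
Proof.
pose s := Num.bound L.
have Ls : L <= 2 ^+ s.
  apply: le_trans (ltW (archi_boundP _)) _; first lra.
  by rewrite -natrX ler_nat ltnW // ltn_expl.
have [C0 C0_gt0 quad] := quadrature_exists R s.
have lc := lower_const_gt0 R s.
exists (lower_const R s)^-1, (C0 + 1); split; [by rewrite invr_gt0 | split; first lra].
move=> W Ww Wd0 n n0.
have Wd : doubling (2 ^+ s) W by apply: doubling_weaken Ls Wd0; case: Ww.
have L0 : 0 <= 2 ^+ s :> R by exact: exprn_ge0.
have [m [m0 infE m_le m_max]] := min_ball_mass Ww Wd n0.
set T := interval_mass W (- pi) pi.
have T0 : 0 < T by exact: (total_mass_gt0 Ww Wd).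
have RE : Rtrig W n = (T / m)%:E.
  by rewrite /Rtrig infE (massE Ww Wd L0) inver gt_eqF // -EFinM.
have wE p : trig_polynomial n p ->
    interval_integral (- pi) pi (fun t => p t * W t) = (weighted_integral W (- pi) pi p)%:E.
  by move=> tp; apply: (wintE Ww Wd L0); exact: trig_continuous tp.
rewrite RE -!EFinM; split.
- apply: le_ereal_inf_tmp => _ [N [theta [w [[_ q] weq]]] <-]; rewrite lee_fin.
  have T1 : T = \sum_(i < N) w i.
    have := q _ (trig_cst n 1); rewrite wE; last exact: trig_cst.
    by rewrite wint1 => -[E]; rewrite /T E; apply: eq_bigr => i _; rewrite mulr1.
  have [i0 _|noN] := pickP 'I_N; last first.
    by move: T0; rewrite T1 big1 ?ltxx // => i; have := noN i.
  have NR : 0 < N%:R :> R by rewrite ltr0n (leq_ltn_trans _ (ltn_ord i0)).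
  have wi i : w i = T / N%:R.
    rewrite T1 (eq_bigr (fun=> w i)) => [|j _]; last exact: weq.
    by rewrite sumr_const card_ord -[w i *+ N]mulr_natr mulfK // gt_eqF.
  have cnt := node_count_ge Ww Wd n0 (N := N) (x := theta) _.
  have h : T / (lower_const R s * N%:R) <= m.
    apply: m_max => y; rewrite ler_pdivrMr; last exact: mulr_gt0.
    rewrite mulrC; apply: cnt => p tp.
    have := q p tp; rewrite wE // => -[E]; rewrite E.
    by apply: eq_bigr => i _; rewrite wi.
  rewrite ler_pdivrMr in h; last exact: mulr_gt0.
  rewrite mulrA ler_pdivrMr // mulrC ler_pdivrMr //; apply: le_trans h _.
  by rewrite le_eqVlt; apply/orP; left; apply/eqP; ring.
- apply: le_ereal_inf_tmp => _ [M MP <-]; apply: ereal_inf_lbound.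
  by exists M => //; apply: MP.
(* A ball lies within a period; this absorbs the rounding of [C0 * T / m] to an
   integer. *)
have Tm : 1 <= T / m.
  rewrite ler_pdivlMr // mul1r; apply: le_trans (m_le 0) _.
  have p2 := pi_ge2 R; have r1 : n%:R^-1 <= 1 :> R by rewrite invf_le1 ?ltr0n // ler1n.
  by apply: (mass_le Ww Wd); lra.
pose M := (Num.truncn (C0 * (T / m))).+1.
have CT0 : 0 <= C0 * (T / m) by rewrite mulr_ge0 ?ltW // (lt_le_trans ltr01).
have /andP[M1 M2] := truncn_itv CT0.
apply: le_trans (_ : (M%:R)%:E <= _)%E; last first.
  by rewrite lee_fin /M -natr1; lra.
apply: ereal_inf_lbound; exists M => // N MN.
have NM : C0 * (T / m) <= N%:R.
  by apply: le_trans (ltW M2) _; rewrite ler_nat.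
have [|x xP] := quad W n N Ww Wd n0.
  move=> y; apply: le_trans (_ : N%:R * m <= _); last by apply: ler_wpM2l.
  by rewrite -ler_pdivrMr // -mulrA.
have [theta [th_mono th_sum]] := sorted_nodes N x.
exists theta, (fun=> T / N%:R); split; last by [].
split=> // p tp; rewrite wE //; congr EFin.
by rewrite xP // -!mulr_sumr th_sum.
Qed.
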